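(* Let $x:M^n\to\mathbb{R}^{n+1}$ be a locally strongly convex canonical centroaffine hypersurface. Then it is locally centroaffinely equivalent to one of the following hypersurfaces: (i) $x_1^{\alpha_1}x_2^{\alpha_2}\cdots x_{n+1}^{\alpha_{n+1}}=1$, where either $\alpha_i>0$ for $1\le i\le n+1$, or $\alpha_1<0$ and $\alpha_i>0$ for $2\le i\le n+1$ with $\sum_{i=1}^{n+1}\alpha_i<0$; (ii) $x_1^{\alpha_1}x_2^{\alpha_2}\cdots x_{n-1}^{\alpha_{n-1}}(x_n^2+x_{n+1}^2)^{\alpha_n}\exp\left(\alpha_{n+1}\arctan\frac{x_n}{x_{n+1}}\right)=1$, where $\alpha_i<0$ for $1\le i\le n-1$ and $2\alpha_n+\sum_{i=1}^{n-1}\alpha_i>0$; (iii) $x_{n+1}=\frac{1}{2x_1}(x_2^2+\cdots+x_{v-1}^2)-x_1(-\ln x_1+\alpha_v\ln x_v+\cdots+\alpha_n\ln x_n)$, where $2\le v\le n+1$ and $\alpha_i$ ($v\le i\le n$) are real numbers satisfying $\alpha_i>0$ for $v\le i\le n$ and $\sum_{i=v}^n\alpha_i<1$.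
   Context: Let $D$ be the standard flat connection of $\mathbb{R}^{n+1}$ and $O$ the origin. An immersion $x:M^n\to\mathbb{R}^{n+1}$ of a smooth $n$-manifold is a centroaffine hypersurface if at each point the position vector $x$ is transversal to the tangent hyperplane. For $\varepsilon\in\{1,-1\}$ the Gauss formula $D_Xx_*(Y)=x_*(\nabla_XY)+h(X,Y)(-\varepsilon x)$ defines the induced connection $\nabla$ and the centroaffine metric $h$. The hypersurface is locally strongly convex if $h$ is definite; then $\varepsilon$ is chosen so that $h$ is positive definite. $\hat\nabla$ is the Levi-Civita connection of $h$ and $C=\nabla h$ is the cubic form. The hypersurface is canonical if $h$ is flat and $\hat\nabla C=0$. Two hypersurfaces are centroaffinely equivalent if they correspond under an element of $\mathrm{GL}(n+1,\mathbb{R})$ (an affine transformation fixing $O$); ''locally'' means open parts correspond. $(x_1,\dots,x_{n+1})$ are the coordinates of $\mathbb{R}^{n+1}$; empty sums and products are $0$ and $1$ respectively. *)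

(* Defs.v *)
From HB Require Import structures.
From mathcomp Require Import all_boot all_order all_algebra.
From mathcomp Require Import all_classical all_reals all_analysis.

Set Implicit Arguments.
Unset Strict Implicit.
Unset Printing Implicit Defensive.

Import Order.TTheory GRing.Theory Num.Theory.
Import numFieldNormedType.Exports.

Local Open Scope classical_set_scope.
Local Open Scope ring_scope.

Section Calculus.
Context {R : realType} {n : nat}.

Definition partial {W : normedModType R} (i : 'I_n) (f : 'rV[R]_n -> W) :
    'rV[R]_n -> W :=
  'D_(delta_mx 0 i) f.

(* C^infinity on an open set U: every iterated partial derivative is
   differentiable, hence continuous, on U. *)
Definition smooth_on {m : nat} (U : set 'rV[R]_n) (f : 'rV[R]_n -> 'rV[R]_m) :
    Prop :=
  forall (s : seq 'I_n) u, U u -> differentiable (foldr partial f s) u.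

End Calculus.

(* [chart_inv] is only meaningful on the image of [chart_dom]. *)
Record chart (R : realType) (n : nat) (M : topologicalType) := Chart {
  chart_dom : set M;
  chart_map : M -> 'rV[R]_n;
  chart_inv : 'rV[R]_n -> M }.

Section Manifold.
Context {R : realType} {n : nat} {M : topologicalType}.
Implicit Types (c : chart R n M) (A : set (chart R n M)).

Definition chart_img c : set 'rV[R]_n := chart_map c @` chart_dom c.

Definition is_chart c : Prop :=
  [/\ open (chart_dom c), open (chart_img c),
      (forall p, chart_dom c p -> {for p, continuous (chart_map c)}),
      (forall u, chart_img c u -> {for u, continuous (chart_inv c)})
    & forall p, chart_dom c p -> chart_inv c (chart_map c p) = p].

Definition smooth_atlas A : Prop :=
  [/\ (forall c, A c -> is_chart c),
      (forall p, exists2 c, A c & chart_dom c p)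
    & forall c d, A c -> A d ->
        smooth_on (chart_map c @` (chart_dom c `&` chart_dom d))
                  (chart_map d \o chart_inv c)].

Definition smooth_manifold A : Prop :=
  [/\ hausdorff_space M, @second_countable M & smooth_atlas A].

End Manifold.

(* Tensor calculus in local coordinates.  A connection is given by its
   Christoffel symbols: nabla_(d_i) d_j = \sum_k G i j k d_k. *)
Section LocalTensors.
Context {R : realType} {n : nat}.
Implicit Types (G : 'I_n -> 'I_n -> 'I_n -> 'rV[R]_n -> R)
  (g : 'rV[R]_n -> 'M[R]_n) (T : 'I_n -> 'I_n -> 'I_n -> 'rV[R]_n -> R).

Definition posdef (B : 'M[R]_n) : Prop :=
  forall v : 'rV[R]_n, v != 0 -> 0 < (v *m B *m v^T) 0 0.

Definition levi_civita g (i j k : 'I_n) (u : 'rV[R]_n) : R :=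
  2^-1 * \sum_(l < n) invmx (g u) k l *
    (partial i (fun w => g w j l) u + partial j (fun w => g w i l) u
     - partial l (fun w => g w i j) u).

(* l-th component of R(d_i, d_j) d_k. *)
Definition curvature G (i j k l : 'I_n) (u : 'rV[R]_n) : R :=
  partial i (G j k l) u - partial j (G i k l) u
  + \sum_(m < n) (G j k m u * G i m l u - G i k m u * G j m l u).

(* (nabla_(d_i) g)(d_j, d_k) *)
Definition cov_deriv2 G g (i j k : 'I_n) (u : 'rV[R]_n) : R :=
  partial i (fun w => g w j k) u
  - \sum_(m < n) G i j m u * g u m k - \sum_(m < n) G i k m u * g u j m.

(* (nabla_(d_l) T)(d_i, d_j, d_k) *)
Definition cov_deriv3 G T (l i j k : 'I_n) (u : 'rV[R]_n) : R :=
  partial l (T i j k) u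
  - \sum_(m < n) G l i m u * T m j k u - \sum_(m < n) G l j m u * T i m k u
  - \sum_(m < n) G l k m u * T i j m u.

End LocalTensors.

(* Centroaffine geometry of a local parametrization f of a hypersurface; row k
   of 'J f u is the tangent vector d_k f (u). *)
Section LocalCentroaffine.
Context {R : realType} {n : nat}.
Implicit Types (f : 'rV[R]_n -> 'rV[R]_n.+1) (u : 'rV[R]_n) (eps : R).

Definition immersed_at f u : Prop := row_free ('J f u).

Definition transversal_at f u : Prop := ~~ (f u <= 'J f u)%MS.

Definition ca_frame f u : 'M[R]_(n.+1) := col_mx (f u) ('J f u).

(* The coordinates of d_i d_j f (u) in the basis (f, d_1 f, ..., d_n f). *)
Definition gauss_coef f (i j : 'I_n) u : 'rV[R]_(1 + n) :=
  partial i (partial j f) u *m invmx (ca_frame f u).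

Definition induced_connection f (i j k : 'I_n) u : R :=
  rsubmx (gauss_coef f i j u) 0 k.

(* In the Gauss formula the coefficient of f is - eps h, and eps ^+ 2 = 1. *)
Definition ca_metric eps f u : 'M[R]_n :=
  \matrix_(i, j) (- eps * lsubmx (gauss_coef f i j u) 0 0).

Lemma ca_frame_unit f u :
  immersed_at f u -> transversal_at f u -> ca_frame f u \in unitmx.
Proof.
move=> fJ tf; rewrite -row_full_unit /row_full eqn_leq rank_leq_col /=.
have sJ : ('J f u < f u + 'J f u)%MS.
  by rewrite ltmxE addsmxSr /=; apply: contra tf; apply/submx_trans/addsmxSl.
have := rank_ltmx sJ; rewrite (eqP fJ).
by rewrite (addsmxE (f u) ('J f u)).
Qed.

Lemma gauss_formula eps f (i j : 'I_n) u : eps = 1 \/ eps = - 1 ->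
  immersed_at f u -> transversal_at f u ->
  partial i (partial j f) u =
    \sum_(k < n) induced_connection f i j k u *: row k ('J f u)
    + ca_metric eps f u i j *: (- eps *: f u).
Proof.
move=> eps1 fJ tf.
rewrite -[LHS](mulmxKV (ca_frame_unit fJ tf)) -/(gauss_coef f i j u).
rewrite -[X in X *m _](hsubmxK (gauss_coef f i j u)) /ca_frame.
rewrite (mul_row_col _ _ (f u) ('J f u)) addrC; congr (_ + _).
  by rewrite mulmx_sum_row.
rewrite [lsubmx _]mx11_scalar mul_scalar_mx !mxE scalerA; congr (_ *: _).
by rewrite mulrAC mulrNN; case: eps1 => ->; rewrite ?mulrNN mulr1 mul1r.
Qed.

Definition cubic_form eps f : 'I_n -> 'I_n -> 'I_n -> 'rV[R]_n -> R :=
  cov_deriv2 (induced_connection f) (ca_metric eps f).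

End LocalCentroaffine.

Section Hypersurface.
Context {R : realType} {n : nat} {M : topologicalType}.
Implicit Types (A : set (chart R n M)) (x : M -> 'rV[R]_n.+1) (eps : R).

Definition local_param x (c : chart R n M) : 'rV[R]_n -> 'rV[R]_n.+1 :=
  x \o chart_inv c.

Definition centroaffine_hypersurface A x : Prop :=
  forall c, A c ->
    smooth_on (chart_img c) (local_param x c) /\
    (forall u, chart_img c u ->
       immersed_at (local_param x c) u /\ transversal_at (local_param x c) u).

Definition locally_strongly_convex A x eps : Prop :=
  forall c u, A c -> chart_img c u -> posdef (ca_metric eps (local_param x c) u).

Definition flat_metric A x eps : Prop :=
  forall c u, A c -> chart_img c u -> forall i j k l : 'I_n,
    curvature (levi_civita (ca_metric eps (local_param x c))) i j k l u = 0.

Definition parallel_cubic_form A x eps : Prop :=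
  forall c u, A c -> chart_img c u -> forall l i j k : 'I_n,
    cov_deriv3 (levi_civita (ca_metric eps (local_param x c)))
               (cubic_form eps (local_param x c)) l i j k u = 0.

Definition canonical_hypersurface A x eps : Prop :=
  flat_metric A x eps /\ parallel_cubic_form A x eps.

(* Near p, an open part of the hypersurface x is mapped onto an open part of H
   by an element of GL(n+1, R), acting on row vectors from the right. *)
Definition locally_equivalent_at x (p : M) (H : set 'rV[R]_n.+1) : Prop :=
  exists (V : set M) (O : set 'rV[R]_n.+1) (B : 'M[R]_n.+1),
    [/\ open V, V p, open O, B \in unitmx
      & [set x q *m B | q in V] = H `&` O].

End Hypersurface.

(* Coordinates and exponents are numbered from 1 to n+1; the values of
   alpha : nat -> R outside that range are irrelevant.  Real powers and
   logarithms are taken of positive numbers only, which has to be required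
   explicitly because [powR] and [ln] are total. *)
Section Models.
Context {R : realType} {n : nat}.
Implicit Types (H : set 'rV[R]_n.+1) (y : 'rV[R]_n.+1) (alpha : nat -> R).

Definition coord1 y (i : nat) : R := y 0 (inord i.-1).

Definition model_i H : Prop :=
  exists alpha : nat -> R,
    ((forall i, (1 <= i <= n.+1)%N -> 0 < alpha i) \/
     [/\ alpha 1%N < 0, (forall i, (2 <= i <= n.+1)%N -> 0 < alpha i)
       & \sum_(1 <= i < n.+2) alpha i < 0]) /\
    H = [set y | (forall i, (1 <= i <= n.+1)%N -> 0 < coord1 y i) /\
                 \prod_(1 <= i < n.+2) coord1 y i `^ alpha i = 1].

Definition model_ii H : Prop :=
  exists alpha : nat -> R,
    [/\ (forall i, (1 <= i <= n.-1)%N -> alpha i < 0),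
        0 < 2 * alpha n + \sum_(1 <= i < n) alpha i
      & H = [set y |
          [/\ (forall i, (1 <= i <= n.-1)%N -> 0 < coord1 y i),
              coord1 y n.+1 != 0
            & (\prod_(1 <= i < n) coord1 y i `^ alpha i)
              * (coord1 y n ^+ 2 + coord1 y n.+1 ^+ 2) `^ alpha n
              * expR (alpha n.+1 * atan (coord1 y n / coord1 y n.+1)) = 1]]].

Definition model_iii H : Prop :=
  exists (v : nat) (alpha : nat -> R),
    [/\ (2 <= v <= n.+1)%N,
        (forall i, (v <= i <= n)%N -> 0 < alpha i),
        \sum_(v <= i < n.+1) alpha i < 1
      & H = [set y |
          [/\ 0 < coord1 y 1%N,
              (forall i, (v <= i <= n)%N -> 0 < coord1 y i)
            & coord1 y n.+1 =
                1 / (2 * coord1 y 1%N) * (\sum_(2 <= i < v) coord1 y i ^+ 2)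
                - coord1 y 1%N * (- ln (coord1 y 1%N)
                    + \sum_(v <= i < n.+1) alpha i * ln (coord1 y i))]]].

End Models.

(* Main.v *)
Require Import Defs.
From mathcomp Require Import all_boot all_order all_algebra.
From mathcomp Require Import all_classical all_reals all_analysis.
From mathcomp Require Import ring lra.
From mathcomp.real_closed Require Import complex.
Set Implicit Arguments.
Unset Strict Implicit.
Unset Printing Implicit Defensive.
Import Order.TTheory GRing.Theory Num.Theory.
Import numFieldNormedType.Exports.
Local Open Scope classical_set_scope.
Local Open Scope ring_scope.

(** The proof reduces the geometry to linear algebra.  For a local
    parametrization f, let F be the frame with rows f, d_1 f, ..., d_n f.  The
    Gauss formula reads d_i F = conn_i F, and conn_i splits as
    Ahat_i + Ghat_i, where Ghat_i carries the Levi-Civita connection of h and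
    Ahat_i the difference tensor K of the two connections.  Since K is
    - (1/2) C with an index raised, flatness of h makes Ghat flat, parallelism
    of C makes Ahat parallel for Ghat, and the integrability of conn then
    forces the matrices Ahat_i to commute ([Ahat_comm]).  The Codazzi equation
    makes C totally symmetric, so the Ahat_i are self-adjoint for the form
    that gives f square 1, makes f orthogonal to the tangent space, and
    restricts to - eps h on it ([Ahat_selfadjoint]).

    Conjugating by the frame gives matrices ambient_op_i with
    d_i f = f ambient_op_i that solve a linear system whose coefficients are
    the Christoffel symbols of h ([ambient_op_derive]).  By uniqueness for such
    systems, ambient_op_i (u) stays in the span of the ambient_op_j (u0)
    ([span_const]).  So the gradient of every linear coordinate of f is
    expressed through finitely many commuting self-adjoint matrices
    ([coord_grad]), and f is governed by their simultaneous normal form.  The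
    form is definite when eps = -1 and Lorentzian when eps = 1.  A definite
    form allows a common eigenbasis ([normal_form_definite]); a Lorentzian one
    leaves three possibilities ([normal_form_lorentz]): a common eigenbasis, a
    pair of complex conjugate eigenvectors, or a null eigenvector.  In adapted
    coordinates the logarithm of the defining equation of model (i), (ii) or
    (iii) respectively then has zero gradient and vanishes at the base point
    ([lands_diag], [lands_complex], [lands_null]).

    Two things remain.  The image has to be an open part of the model: the
    position vector is transversal, so the positive cone over an open part of
    the hypersurface is open in R^(n+1) ([cone_chart_open]), and a model meets
    each ray at most once, so it meets this cone exactly in the image.  And the
    model has to be the same along a connected component: the set of points
    near which x is mapped into H by a linear map is clearly open, and it is
    closed because the models are locally homogeneous under GL(n+1)
    ([maps_into_component]). *)

(** * Differential calculus in coordinates *)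

Lemma differentiable_epsP {R : realType} (V W : normedModType R) (f : V -> W) x :
  differentiable f x <-> exists2 L : {linear V -> W}, continuous L &
    forall e, 0 < e -> \forall k \near (0 : V),
      `|f (x + k) - f x - L k| <= e * `|k|.
Proof.
split=> [df|[L cL HL]].
  exists ('d f x); first exact: diff_continuous.
  move=> e e0; have := diff_locally df => /eqaddoP/(_ e e0); apply: filterS => k.
  by rewrite !fctE /= [k + x]addrC opprD addrA.
have H : f \o shift x = cst (f x) + L +o_ (0 : V) id.
  apply/eqaddoP => e e0; apply: filterS (HL e e0) => k.
  by rewrite !fctE /= [k + x]addrC opprD addrA.
have E := diff_unique cL H.
by apply/diff_locallyP; rewrite E; split.
Qed.

Lemma near_translate {R : realType} (V : normedModType R) (x : V) (U : set V) :
  nbhs x U -> \forall k \near (0 : V), U (x + k).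
Proof.
move=> xU; have : \near x, U x by [].
by rewrite (near_shift 0) subr0; apply: filterS => k; rewrite /= addrC.
Qed.

Section ScalarCalculus.
Context {R : realType} {n : nat}.
Implicit Types (g h : 'rV[R]_n -> R) (u v : 'rV[R]_n) (U : set 'rV[R]_n).

Lemma diff_add g h u : differentiable g u -> differentiable h u ->
  differentiable (fun w => g w + h w) u.
Proof. by move=> dg dh; exact: (differentiableD dg dh). Qed.

Lemma diff_sub g h u : differentiable g u -> differentiable h u ->
  differentiable (fun w => g w - h w) u.
Proof. by move=> dg dh; exact: (differentiableB dg dh). Qed.

Lemma diff_opp g u : differentiable g u -> differentiable (fun w => - g w) u.
Proof. by move=> dg; exact: (differentiableN dg). Qed.

Lemma diff_mul g h u : differentiable g u -> differentiable h u ->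
  differentiable (fun w => g w * h w) u.
Proof. by move=> dg dh; exact: (differentiableM dg dh). Qed.

Lemma diff_inv g u : differentiable g u -> g u != 0 ->
  differentiable (fun w => (g w)^-1) u.
Proof. by move=> dg g0; exact: (differentiableV dg g0). Qed.

Lemma diff_const (c : R) u : differentiable (fun _ : 'rV[R]_n => c) u.
Proof. exact: differentiable_cst. Qed.

Lemma diff_sum I (r : seq I) (P : pred I) (F : I -> 'rV[R]_n -> R) u :
  (forall i, P i -> differentiable (F i) u) ->
  differentiable (fun w => \sum_(i <- r | P i) F i w) u.
Proof.
move=> dF; elim: r => [|a r IH].
  by under eq_fun do rewrite big_nil; exact: (diff_const 0).
have [Pa|nPa] := boolP (P a).
  under eq_fun do rewrite big_cons Pa.
  by apply: diff_add => //; exact: dF.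
by under eq_fun do rewrite big_cons (negbTE nPa).
Qed.

(** [partial] for scalar functions, sealed so that unification never reaches
    the limit of difference quotients behind it. *)
Definition pd i g : 'rV[R]_n -> R := locked (partial i g).

Lemma pdE i g : pd i g = partial i g.
Proof. by rewrite /pd -lock. Qed.

Lemma pd_add i g h u : differentiable g u -> differentiable h u ->
  pd i (fun w => g w + h w) u = pd i g u + pd i h u.
Proof. by move=> dg dh; rewrite /pd -!lock; apply: deriveD; exact: diff_derivable. Qed.

Lemma pd_sub i g h u : differentiable g u -> differentiable h u ->
  pd i (fun w => g w - h w) u = pd i g u - pd i h u.
Proof. by move=> dg dh; rewrite /pd -!lock; apply: deriveB; exact: diff_derivable. Qed.

Lemma pd_opp i g u : differentiable g u ->
  pd i (fun w => - g w) u = - pd i g u.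
Proof. by move=> dg; rewrite /pd -!lock; apply: deriveN; exact: diff_derivable. Qed.

Lemma pd_mul i g h u : differentiable g u -> differentiable h u ->
  pd i (fun w => g w * h w) u = pd i g u * h u + g u * pd i h u.
Proof.
move=> dg dh; rewrite /pd -!lock /partial.
rewrite [LHS]deriveM; [|exact: diff_derivable..].
by rewrite addrC; congr (_ + _); rewrite /GRing.scale/= mulrC.
Qed.

Lemma pd_const i (c : R) u : pd i (fun _ : 'rV[R]_n => c) u = 0.
Proof. by rewrite /pd -lock; exact: derive_cst. Qed.

Lemma pd_inv i g u : differentiable g u -> g u != 0 ->
  pd i (fun w => (g w)^-1) u = - (g u)^-1 * (g u)^-1 * pd i g u.
Proof.
move=> dg g0; rewrite /pd -!lock /partial [LHS]deriveV//; last exact: diff_derivable.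
rewrite /GRing.scale/= expr2 invfM. by rewrite !mulNr.
Qed.

Lemma pd_sum i I (r : seq I) (P : pred I) (F : I -> 'rV[R]_n -> R) u :
  (forall k, P k -> differentiable (F k) u) ->
  pd i (fun w => \sum_(k <- r | P k) F k w) u =
  \sum_(k <- r | P k) pd i (F k) u.
Proof.
move=> dF; elim: r => [|a r IH].
  by under eq_fun do rewrite big_nil; rewrite pd_const big_nil.
rewrite big_cons; have [Pa|nPa] := boolP (P a).
  under eq_fun do rewrite big_cons Pa.
  by rewrite pd_add ?IH//; [exact: dF|exact: diff_sum].
by under eq_fun do rewrite big_cons (negbTE nPa).
Qed.

Lemma pd_near i g h u U : open U -> U u -> {in U, g =1 h} ->
  pd i g u = pd i h u.
Proof.
move=> oU Uu gh; rewrite /pd -!lock; apply: near_eq_derive; near=> w.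
by apply: gh; rewrite inE; near: w; exact: open_nbhs_nbhs.
Unshelve. all: by end_near. Qed.

Lemma diff_near g h u U : open U -> U u -> {in U, g =1 h} ->
  differentiable g u -> differentiable h u.
Proof.
move=> oU Uu gh /differentiable_epsP[L cL HL]; apply/differentiable_epsP.
exists L => // e e0; have hu : g u = h u by apply: gh; rewrite inE.
have nU := near_translate (open_nbhs_nbhs (conj oU Uu)).
by apply: filterS2 (HL e e0) nU => k Hk Uk; rewrite -hu -gh ?inE.
Qed.

(** Differentiability of all partial derivatives up to order k.  Recursion on k
    is what makes closure under products and inverses provable: the Leibniz
    rule trades one order of a product for products of lower order. *)
Fixpoint Ck (k : nat) U g : Prop :=
  (forall u, U u -> differentiable g u) /\
  if k is k'.+1 then forall i, Ck k' U (pd i g) else True.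

Lemma Ck_diff k U g u : Ck k U g -> U u -> differentiable g u.
Proof. by case: k => [|k] [dg _]; exact: dg. Qed.

Lemma Ck_pd k U g i : Ck k.+1 U g -> Ck k U (pd i g).
Proof. by case=> _; exact. Qed.

Lemma CkS k U g : Ck k.+1 U g -> Ck k U g.
Proof.
elim: k g => [|k IH] g [dg pg]; split=> // i; exact/IH/pg.
Qed.

Lemma Ck_ext k U g h : open U -> {in U, g =1 h} -> Ck k U g -> Ck k U h.
Proof.
move=> oU; elim: k g h => [|k IH] g h gh [dg pg].
  by split=> // u Uu; apply: (diff_near oU Uu gh); exact: dg.
split=> [u Uu|i]; first by apply: (diff_near oU Uu gh); exact: dg.
by apply: IH (pg i) => u /set_mem Uu; exact: (pd_near i oU Uu gh).
Qed.

Lemma Ck_const k U c : Ck k U (fun _ => c).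
Proof.
elim: k c => [|k IH] c; (split=> [u _|]; first exact: diff_const) => // i.
rewrite (_ : pd i _ = fun _ => 0) //.
by apply/funext => u; rewrite pd_const.
Qed.

Lemma Ck_add k U g h : open U -> Ck k U g -> Ck k U h ->
  Ck k U (fun u => g u + h u).
Proof.
move=> oU; elim: k g h => [|k IH] g h Cg Ch.
  by split=> // u Uu; apply: diff_add; [exact: (Ck_diff Cg)|exact: (Ck_diff Ch)].
split=> [u Uu|i]; first by apply: diff_add; [exact: (Ck_diff Cg)|exact: (Ck_diff Ch)].
apply: (Ck_ext oU _ (IH _ _ (Ck_pd i Cg) (Ck_pd i Ch))) => u /set_mem Uu.
by rewrite pd_add//; [exact: (Ck_diff Cg)|exact: (Ck_diff Ch)].
Qed.

Lemma Ck_opp k U g : open U -> Ck k U g -> Ck k U (fun u => - g u).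
Proof.
move=> oU; elim: k g => [|k IH] g Cg.
  by split=> // u Uu; apply: diff_opp; exact: (Ck_diff Cg).
split=> [u Uu|i]; first by apply: diff_opp; exact: (Ck_diff Cg).
apply: (Ck_ext oU _ (IH _ (Ck_pd i Cg))) => u /set_mem Uu.
by rewrite pd_opp//; exact: (Ck_diff Cg).
Qed.

Lemma Ck_sub k U g h : open U -> Ck k U g -> Ck k U h ->
  Ck k U (fun u => g u - h u).
Proof. by move=> oU Cg Ch; apply: Ck_add => //; exact: Ck_opp. Qed.

Lemma Ck_mul k U g h : open U -> Ck k U g -> Ck k U h ->
  Ck k U (fun u => g u * h u).
Proof.
move=> oU; elim: k g h => [|k IH] g h Cg Ch.
  by split=> // u Uu; apply: diff_mul; [exact: (Ck_diff Cg)|exact: (Ck_diff Ch)].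
split=> [u Uu|i]; first by apply: diff_mul; [exact: (Ck_diff Cg)|exact: (Ck_diff Ch)].
apply: (Ck_ext oU _ (Ck_add oU (IH _ _ (Ck_pd i Cg) (CkS Ch))
                               (IH _ _ (CkS Cg) (Ck_pd i Ch)))) => u /set_mem Uu.
by rewrite pd_mul//; [exact: (Ck_diff Cg)|exact: (Ck_diff Ch)].
Qed.

Lemma Ck_inv k U g : open U -> (forall u, U u -> g u != 0) -> Ck k U g ->
  Ck k U (fun u => (g u)^-1).
Proof.
move=> oU g0; elim: k => [|k IH] Cg.
  by split=> // u Uu; apply: diff_inv; [exact: (Ck_diff Cg)|exact: g0].
split=> [u Uu|i]; first by apply: diff_inv; [exact: (Ck_diff Cg)|exact: g0].
have Ci := IH (CkS Cg).
apply: (Ck_ext oU _ (Ck_mul oU (Ck_mul oU (Ck_opp oU Ci) Ci) (Ck_pd i Cg))).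
by move=> u /set_mem Uu; rewrite pd_inv//; [exact: (Ck_diff Cg)|exact: g0].
Qed.

Lemma Ck_sum k U I (r : seq I) (P : pred I) (F : I -> 'rV[R]_n -> R) :
  open U -> (forall i, P i -> Ck k U (F i)) ->
  Ck k U (fun w => \sum_(i <- r | P i) F i w).
Proof.
move=> oU dF; elim: r => [|a r IH].
  by under eq_fun do rewrite big_nil; exact: Ck_const.
have [Pa|nPa] := boolP (P a).
  under eq_fun do rewrite big_cons Pa.
  by apply: Ck_add => //; exact: dF.
by under eq_fun do rewrite big_cons (negbTE nPa).
Qed.

Lemma Ck_prod k U I (r : seq I) (P : pred I) (F : I -> 'rV[R]_n -> R) :
  open U -> (forall i, P i -> Ck k U (F i)) ->
  Ck k U (fun w => \prod_(i <- r | P i) F i w).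
Proof.
move=> oU dF; elim: r => [|a r IH].
  by under eq_fun do rewrite big_nil; exact: Ck_const.
have [Pa|nPa] := boolP (P a).
  under eq_fun do rewrite big_cons Pa.
  by apply: Ck_mul => //; exact: dF.
by under eq_fun do rewrite big_cons (negbTE nPa).
Qed.

End ScalarCalculus.

Section MatrixCalculus.
Context {R : realType} {n : nat}.
Implicit Types (u v : 'rV[R]_n) (U : set 'rV[R]_n).

Definition Cmx k U p q (A : 'rV[R]_n -> 'M[R]_(p, q)) : Prop :=
  forall i j, Ck k U (fun u => A u i j).

Definition dmx p q (i : 'I_n) (A : 'rV[R]_n -> 'M[R]_(p, q)) u : 'M[R]_(p, q) :=
  locked (\matrix_(a, b) pd i (fun w => A w a b) u).

Lemma dmxE p q i (A : 'rV[R]_n -> 'M[R]_(p, q)) u a b :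
  dmx i A u a b = pd i (fun w => A w a b) u.
Proof. by rewrite /dmx -lock mxE. Qed.

Lemma Cmx_mul k U p q r (A : 'rV[R]_n -> 'M[R]_(p, q)) (B : 'rV[R]_n -> 'M[R]_(q, r)) :
  open U -> Cmx k U A -> Cmx k U B -> Cmx k U (fun u => A u *m B u).
Proof.
move=> oU CA CB i j; under eq_fun do rewrite mxE.
by apply: Ck_sum => // l _; apply: Ck_mul.
Qed.

Lemma dmx_mul i u p q r (A : 'rV[R]_n -> 'M[R]_(p, q)) (B : 'rV[R]_n -> 'M[R]_(q, r)) U :
  Cmx 0 U A -> Cmx 0 U B -> U u ->
  dmx i (fun w => A w *m B w) u = dmx i A u *m B u + A u *m dmx i B u.
Proof.
move=> CA CB Uu; apply/matrixP => a b; rewrite dmxE [RHS]mxE [in RHS]mxE [X in _ + X]mxE.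
under eq_fun do rewrite mxE.
rewrite pd_sum => [|l _]; last first.
  by apply: diff_mul; [exact: (Ck_diff (CA _ _) Uu)|exact: (Ck_diff (CB _ _) Uu)].
rewrite -big_split; apply: eq_bigr => l _ /=; rewrite !dmxE pd_mul//.
- exact: (Ck_diff (CA _ _) Uu).
- exact: (Ck_diff (CB _ _) Uu).
Qed.

Lemma Ck_det k U p (A : 'rV[R]_n -> 'M[R]_p) : open U -> Cmx k U A ->
  Ck k U (fun u => \det (A u)).
Proof.
move=> oU CA; rewrite /determinant; apply: Ck_sum => // s _.
by apply: Ck_mul => //; [exact: Ck_const|apply: Ck_prod].
Qed.

Lemma Cmx_inv k U p (A : 'rV[R]_n -> 'M[R]_p) : open U -> Cmx k U A ->
  (forall u, U u -> A u \in unitmx) -> Cmx k U (fun u => invmx (A u)).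
Proof.
move=> oU CA Au i j.
have C1 : Ck k U (fun u => (\det (A u))^-1 * \adj (A u) i j).
  apply: Ck_mul => //.
    apply: Ck_inv => //; last exact: Ck_det.
    by move=> u Uu; rewrite -unitfE -unitmxE; exact: Au.
  under eq_fun do rewrite mxE /cofactor.
  apply: Ck_mul => //; first exact: Ck_const.
  by apply: Ck_det => // a b; under eq_fun do rewrite !mxE.
apply: (Ck_ext oU _ C1) => u /set_mem Uu /=.
by rewrite /invmx Au// [RHS]mxE.
Qed.

Lemma dmx_near i p q (A B : 'rV[R]_n -> 'M[R]_(p, q)) u U : open U -> U u ->
  {in U, A =1 B} -> dmx i A u = dmx i B u.
Proof.
move=> oU Uu AB; apply/matrixP => a b; rewrite !dmxE.
by apply: (pd_near i oU Uu) => w Uw; rewrite AB.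
Qed.

Lemma dmx_const i p q (A : 'M[R]_(p, q)) u : dmx i (fun _ => A) u = 0.
Proof. by apply/matrixP => a b; rewrite dmxE mxE pd_const. Qed.

End MatrixCalculus.

Section Lines.
Context {R : realType} {n : nat}.
Implicit Types (g h : 'rV[R]_n -> R) (u v : 'rV[R]_n) (U : set 'rV[R]_n).

Lemma derive_partials g u v : differentiable g u ->
  'D_v g u = \sum_i v 0 i * pd i g u.
Proof.
move=> dg; rewrite deriveE// [in LHS](row_sum_delta v) linear_sum.
by apply: eq_bigr => i _; rewrite linearZ /= pdE /partial deriveE.
Qed.

Lemma is_derive_line g u v (t : R) : differentiable g (u + t *: v) ->
  is_derive t 1 (fun s : R => g (u + s *: v))
    (\sum_i v 0 i * pd i g (u + t *: v)).
Proof.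
move=> dg; have E : (fun h : R => h^-1 *: (((fun s : R => g (u + s *: v)) \o shift t) (h *: 1)
    - g (u + t *: v))) = (fun h : R => h^-1 *: ((g \o shift (u + t *: v)) (h *: v)
    - g (u + t *: v))).
  apply/funext => h /=; congr (_ *: (g _ - _)).
  by rewrite scalerDl -scalerA scale1r addrCA.
rewrite -derive_partials//; apply: DeriveDef; last by rewrite /derive E.
by rewrite /derivable E; exact: (diff_derivable dg).
Qed.

Lemma norm_delta (i : 'I_n) : `|delta_mx 0 i : 'rV[R]_n| <= 1.
Proof.
rewrite [leLHS]/Num.Def.normr/= mx_normrE; apply: bigmax_le => // -[a b] _.
by rewrite mxE; case: (_ && _); rewrite ?normr0 ?normr1.
Qed.

End Lines.

Section Schwarz.
Context {R : realType} {n : nat}.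
Implicit Types (f : 'rV[R]_n -> R) (u : 'rV[R]_n) (U : set 'rV[R]_n).

Let Delta f u (i j : 'I_n) (t : R) :=
  f (u + t *: delta_mx 0 j + t *: delta_mx 0 i) - f (u + t *: delta_mx 0 i)
  - (f (u + t *: delta_mx 0 j) - f u).

(** The mean value theorem turns the second difference into t times an increment
    of d_i f at an intermediate point, and differentiability of d_i f at u alone
    evaluates that increment up to o(t); no continuity of the second derivatives
    is involved. *)
Lemma second_difference f u i j U : open U -> U u ->
  (forall w, U w -> differentiable f w) -> differentiable (pd i f) u ->
  forall e, 0 < e -> exists2 d, 0 < d & forall t, 0 < t < d ->
    `|Delta f u i j t - t ^+ 2 * pd j (pd i f) u| <= e * t ^+ 2.
Proof.
move=> oU Uu df dfi e e0.
have e5 : 0 < e / 5 by rewrite divr_gt0.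
have [L cL HL] := iffLR (differentiable_epsP _ _) dfi.
have EL : forall k, 'd (pd i f) u k = L k.
  have : 'd (pd i f) u = L :> (_ -> _).
    apply: diff_unique => //; apply/eqaddoP => e' e'0; apply: filterS (HL e' e'0) => k.
    by rewrite !fctE /= [_ + k]addrC opprD addrA.
  by move=> ->.
have /nbhs_ballP[d1 /= d10 H1] := near_translate (open_nbhs_nbhs (conj oU Uu)).
have /nbhs_ballP[d2 /= d20 H2] := HL _ e5.
exists (Num.min d1 d2 / 2); first by rewrite divr_gt0// lt_min d10.
move=> t /andP[t0]; rewrite ltr_pdivlMr// lt_min => /andP[td1 td2].
have small (a b : R) : 0 <= a <= t -> 0 <= b <= t ->
    `|a *: delta_mx 0 j + b *: delta_mx 0 i : 'rV[R]_n| <= t * 2.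
  move=> /andP[a0 at_] /andP[b0 bt]; rewrite (le_trans (ler_normD _ _))// !normrZ.
  rewrite mulr_natr mulr2n; apply: lerD.
    by rewrite -[leRHS]mulr1 ler_pM ?norm_delta// ger0_norm.
  by rewrite -[leRHS]mulr1 ler_pM ?norm_delta// ger0_norm.
have inU (a b : R) : 0 <= a <= t -> 0 <= b <= t ->
    U (u + a *: delta_mx 0 j + b *: delta_mx 0 i).
  move=> ha hb; rewrite -addrA; apply: H1.
  by rewrite -ball_normE /= sub0r normrN (le_lt_trans (small _ _ ha hb)).
pose phi (s : R) := f (u + t *: delta_mx 0 j + s *: delta_mx 0 i) - f (u + s *: delta_mx 0 i).
pose dphi (s : R) := pd i f (u + t *: delta_mx 0 j + s *: delta_mx 0 i)
   - pd i f (u + s *: delta_mx 0 i).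
have sumd (F : 'I_n -> R) : \sum_k (delta_mx 0 i : 'rV[R]_n) 0 k * F k = F i.
  rewrite (bigD1 i)//= mxE !eqxx mul1r big1 ?addr0// => k /negbTE ki.
  by rewrite mxE ki mul0r.
have dph (s : R) : 0 <= s <= t -> is_derive s 1 phi (dphi s).
  move=> hs; apply: is_deriveB.
    have := @is_derive_line R n f (u + t *: delta_mx 0 j) (delta_mx 0 i) s.
    by rewrite sumd; apply; apply: df; apply: inU => //; rewrite lexx ltW.
  have := @is_derive_line R n f u (delta_mx 0 i) s.
  rewrite sumd; apply; apply: df; have := @inU 0 s; rewrite scale0r addr0.
  by apply => //; rewrite lexx ltW.
have [c ctt Hc] : exists2 c, c \in `]0, t[ & phi t - phi 0 = dphi c * (t - 0).
  apply: MVT => //.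
    by move=> s; rewrite in_itv /= => /andP[s0 st]; apply: dph; rewrite !ltW.
  apply: derivable_within_continuous => s; rewrite in_itv /= => hs.
  by have [] := dph s hs.
have hc : 0 <= c <= t by move: ctt; rewrite in_itv /= => /andP[? ?]; rewrite !ltW.
have -> : Delta f u i j t = dphi c * t.
  rewrite subr0 in Hc; rewrite -Hc /phi scale0r !addr0 /Delta.
  by rewrite opprB addrA.
have ht : 0 <= t <= t by rewrite lexx ltW.
have h0 : 0 <= (0 : R) <= t by rewrite lexx ltW.
have B1 := H2 (t *: delta_mx 0 j + c *: delta_mx 0 i).
have B2 := H2 (0 *: delta_mx 0 j + c *: delta_mx 0 i).
have {}B1 := B1 _; have {}B2 := B2 _.
have bb k : `|k| <= t * 2 -> ball (0 : 'rV[R]_n) d2 k.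
  by move=> hk; rewrite -ball_normE /= sub0r normrN (le_lt_trans hk).
have {B1} /= B1 := B1 (bb _ (small _ _ ht hc)).
have {B2} /= B2 := B2 (bb _ (small _ _ h0 hc)).
have {}B1 := le_trans B1 (ler_wpM2l (ltW e5) (small _ _ ht hc)).
have {}B2 := le_trans B2 (ler_wpM2l (ltW e5) (small _ _ h0 hc)).
move: B1 B2; rewrite scale0r add0r !addrA linearD /= linearZ /=.
have -> : L (delta_mx 0 j) = pd j (pd i f) u.
  by rewrite -EL -deriveE// [in RHS]pdE.
rewrite /dphi; set p := pd j _ u; set q := pd i f u.
set X := pd i f _; set Y := pd i f _; set Z := L _.
rewrite ![_ *: p]/(_ * p) => B1 B2.
have -> : (X - Y) * t - t ^+ 2 * p = t * ((X - q - (t * p + Z)) - (Y - q - Z)) by ring.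
rewrite normrM (gtr0_norm t0).
have -> : e * t ^+ 2 = t * (e * t) by ring.
rewrite ler_pM2l//; apply: (le_trans (ler_normB _ _)); apply: le_trans (lerD B1 B2) _.
have et0 : 0 <= e * t by rewrite mulr_ge0 ?ltW.
by lra.
Qed.

(** The second difference does not depend on the order of the two directions, so
    both mixed derivatives are its limit after division by t^2. *)
Lemma schwarz f u i j U : open U -> U u ->
  (forall w, U w -> differentiable f w) -> differentiable (pd i f) u ->
  differentiable (pd j f) u ->
  pd i (pd j f) u = pd j (pd i f) u.
Proof.
move=> oU Uu df di dj; apply/eqP; rewrite -subr_eq0 -normr_le0.
apply/ler_addgt0Pl => e e0; rewrite addr0.
have e2 : 0 < e / 2 by rewrite divr_gt0.
have [d1 d10 H1] := second_difference j oU Uu df di e2.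
have [d2 d20 H2] := second_difference i oU Uu df dj e2.
pose t := Num.min d1 d2 / 2.
have m0 : 0 < Num.min d1 d2 by rewrite lt_min d10.
have t0 : 0 < t by rewrite divr_gt0.
have tm : t < Num.min d1 d2 by rewrite ltr_pdivrMr// ltr_pMr// ltr1n.
move: tm; rewrite lt_min => /andP[td1 td2].
have {H1} := H1 t; rewrite t0 td1 => /(_ isT) H1.
have {H2} := H2 t; rewrite t0 td2 => /(_ isT).
have -> : Delta f u j i t = Delta f u i j t.
  by rewrite /Delta -!addrA [t *: _ + t *: _]addrC; ring.
move=> H2; have t20 : 0 < t ^+ 2 by rewrite exprn_gt0.
rewrite -(ler_pM2l t20) -{1}(gtr0_norm t20) -normrM.
set D := Delta _ _ _ _ _ in H1 H2; set X := pd i _ u in H2 *.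
set Y := pd j _ u in H1 *.
have -> : t ^+ 2 * (X - Y) = (D - t ^+ 2 * Y) - (D - t ^+ 2 * X) by ring.
apply: (le_trans (ler_normB _ _)); apply: le_trans (lerD H1 H2) _.
by rewrite -mulrDl -splitr mulrC.
Qed.

End Schwarz.

(** * Linear systems of differential equations and open maps *)

Section BallSegments.
Context {R : realType} {n : nat}.
Implicit Types (g : 'rV[R]_n -> R) (u : 'rV[R]_n).

Lemma segment_in_ball u0 u r (t : R) : ball u0 r u -> 0 <= t <= 1 ->
  ball u0 r (u0 + t *: (u - u0)).
Proof.
rewrite -ball_normE /= => ur /andP[t0 t1].
rewrite opprD addNKr normrN normrZ ger0_norm// -normrN opprB.
by apply: le_lt_trans ur; rewrite ler_piMl.
Qed.

Lemma const_on_ball g u0 r : (forall u, ball u0 r u -> differentiable g u) ->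
  (forall u i, ball u0 r u -> pd i g u = 0) ->
  forall u, ball u0 r u -> g u = g u0.
Proof.
move=> dg pg u ur; pose phi (t : R) := g (u0 + t *: (u - u0)).
have dphi (t : R) : 0 <= t <= 1 -> is_derive t 1 phi 0.
  move=> t01; have tr := segment_in_ball ur t01.
  have := @is_derive_line R n g u0 (u - u0) t (dg _ tr).
  by rewrite big1// => i _; rewrite pg// mulr0.
have [||c _] := @MVT R phi (fun=> 0) 0 1 ltr01.
- by move=> t; rewrite in_itv /= => /andP[t0 t1]; apply: dphi; rewrite !ltW.
- apply: derivable_within_continuous => t; rewrite in_itv /= => ht.
  by have [] := dphi t ht.
rewrite mul0r /phi scale1r scale0r addr0 => /eqP.
by rewrite subr_eq0 [u0 + _]addrC subrK => /eqP.
Qed.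

End BallSegments.

Section Gronwall.
Context {R : realType}.

Lemma continuous_bigsum (T : topologicalType) (I : Type) (r : seq I)
    (f : I -> T -> R) (t : T) :
  (forall i, {for t, continuous (f i)}) ->
  {for t, continuous (fun s => \sum_(i <- r) f i s)}.
Proof.
move=> H; elim: r => [|i r IH].
  rewrite (_ : (fun s => _) = (fun=> 0)); first exact: cvg_cst.
  by apply/funext => s; rewrite big_nil.
rewrite (_ : (fun s => _) = (f i \+ (fun s => \sum_(i <- r) f i s))).
  exact: (continuousD (H i) IH).
by apply/funext => s; rewrite big_cons.
Qed.

Lemma is_derive_bigsum (I : Type) (r : seq I) (f df : I -> R -> R) (t : R) :
  (forall i, is_derive t 1 (f i) (df i t)) ->
  is_derive t 1 (fun s => \sum_(i <- r) f i s) (\sum_(i <- r) df i t).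
Proof.
move=> H; elim: r => [|i r IH].
  by under eq_fun do rewrite big_nil; rewrite big_nil; exact: is_derive_cst.
under eq_fun do rewrite big_cons; rewrite big_cons.
exact: (is_deriveD (H i) IH).
Qed.

(** Gronwall: with K = 2 C #|I|, the function exp (- K t) * \sum_i (w i t)^2 is
    nonincreasing, and it starts at 0. *)
Lemma linear_ode_zero (I : finType) (w : I -> R -> R) (a : I -> I -> R -> R) (C : R) :
  0 <= C ->
  (forall t : R, 0 <= t <= 1 -> forall i m, `|a i m t| <= C) ->
  (forall t : R, 0 <= t <= 1 -> forall i,
     is_derive t 1 (w i) (\sum_m a i m t * w m t)) ->
  (forall i, w i 0 = 0) -> forall i, w i 1 = 0.
Proof.
move=> C0 aC dw w0.
pose N (t : R) := \sum_i w i t ^+ 2.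
pose K := C *+ #|I| *+ 2.
pose E (t : R) := expR (- K * t) * N t.
pose dN (t : R) := \sum_i (\sum_m a i m t * w m t) * w i t *+ 2.
pose dE (t : R) := expR (- K * t) * (dN t - K * N t).
have DN (t : R) : 0 <= t <= 1 -> is_derive t 1 N (dN t).
  move=> ht; apply: (@is_derive_bigsum _ _ (fun i s => w i s ^+ 2)
    (fun i s => (\sum_m a i m s * w m s) * w i s *+ 2)) => i.
  have Di := dw t ht i.
  rewrite (_ : (fun s : R => _) = (w i) ^+ 2); last by apply/funext => s; rewrite fctE.
  apply: is_derive_eq; rewrite /GRing.scale /= expr1.
  by rewrite ?mulrnAl mul1r mulrC.
have DE (t : R) : 0 <= t <= 1 -> is_derive t 1 E (dE t).
  move=> ht; have D1 := DN t ht.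
  have D2 : is_derive t 1 (fun s : R => expR (- K * s)) (expR (- K * t) * - K).
    have D3 : is_derive t 1 (fun s : R => - K * s) (- K).
      have -> : (fun s : R => - K * s) = (- K \*: id) by [].
      by apply: is_derive_eq; rewrite /GRing.scale /= mulr1.
    by apply: (@is_derive1_comp _ expR (fun s : R => - K * s)).
  apply: is_derive_eq; rewrite /dE /GRing.scale /=; ring.
have dE0 (t : R) : 0 <= t <= 1 -> dE t <= 0.
  move=> ht; rewrite /dE pmulr_rle0 ?expR_gt0// subr_le0 /dN /K.
  (* Symmetrized so that a_im w_m w_i is compared termwise with w_i^2 + w_m^2. *)
  have -> : C *+ #|I| *+ 2 * N t = \sum_i \sum_m (C * (w i t ^+ 2 + w m t ^+ 2)).
    under eq_bigr do rewrite -mulr_sumr big_split /= sumr_const -/(N t).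
    rewrite -mulr_sumr big_split /= sumr_const -/(N t) sumrMnl.
    by rewrite -mulr2n !mulrnAl !mulrnAr.
  apply: ler_sum => i _; rewrite mulr_suml -sumrMnl; apply: ler_sum => m _.
  apply: (le_trans (ler_norm _)).
  rewrite normrMn !normrM -mulrA -mulrnAr.
  apply: (@le_trans _ _ (C * (`|w m t| * `|w i t| *+ 2))).
    by rewrite ler_wpM2r ?mulrn_wge0 ?mulr_ge0// aC.
  rewrite ler_wpM2l// -(real_normK (num_real (w i t))) -(real_normK (num_real (w m t))).
  have := sqr_ge0 (`|w i t| - `|w m t|); lra.
have [||c] := @MVT R E dE 0 1 ltr01.
- by move=> t; rewrite in_itv /= => /andP[t0 t1]; apply: DE; rewrite !ltW.
- apply: derivable_within_continuous => t; rewrite in_itv /= => ht.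
  by have [] := DE t ht.
rewrite in_itv /= => /andP[c0 c1].
rewrite {2}/E /N big1 => [|i _]; last by rewrite w0 expr0n.
rewrite mulr0 !subr0 mulr1 => EE.
have : N 1 <= 0.
  have := dE0 c; rewrite -EE /E pmulr_rle0 ?expR_gt0//; apply.
  by rewrite !ltW.
move=> N1 i; apply/eqP; rewrite -sqrf_eq0 eq_le sqr_ge0 andbT.
apply: le_trans N1; rewrite /N (bigD1 i)//= lerDl sumr_ge0// => *.
exact: sqr_ge0.
Qed.

(** On a ball, restriction to the segment from the centre reduces the system of
    partial differential equations to an ordinary one. *)
Lemma linear_system_zero n (I : finType) (w : I -> 'rV[R]_n -> R)
    (G : 'I_n -> I -> I -> 'rV[R]_n -> R) u0 r :
  (forall i u, ball u0 r u -> differentiable (w i) u) ->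
  (forall l i m u, ball u0 r u -> {for u, continuous (G l i m)}) ->
  (forall l i u, ball u0 r u -> pd l (w i) u = \sum_m G l i m u * w m u) ->
  (forall i, w i u0 = 0) -> forall i u, ball u0 r u -> w i u = 0.
Proof.
move=> dw cG pw w0 i0 u ur; pose L (t : R) := u0 + t *: (u - u0).
pose a i m (t : R) := \sum_l (u - u0) 0 l * G l i m (L t).
have LE : L 1 = u by rewrite /L scale1r addrC subrK.
have L0 : L 0 = u0 by rewrite /L scale0r addr0.
have cL : continuous L.
  move=> t; apply: cvgD; first exact: cvg_cst.
  by apply: cvgZr_tmp; exact: cvg_id.
have ca i m (t : R) : 0 <= t <= 1 -> {for t, continuous (a i m)}.
  move=> ht; have tr := segment_in_ball ur ht.
  apply: (@continuous_bigsum _ _ _ (fun l s => (u - u0) 0 l * G l i m (L s))) => l.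
  apply: cvgM; first exact: cvg_cst.
  exact: (continuous_comp (cL t) (cG l i m _ tr)).
have bnd (p : I * I) : exists C, forall t : R, 0 <= t <= 1 -> `|a p.1 p.2 t| <= C.
  have [|t _ Ht] := @EVT_max R (fun t => `|a p.1 p.2 t|) 0 1 ler01.
    apply: continuous_in_subspaceT => t /set_mem; rewrite /= in_itv /= => ht.
    by apply: continuous_comp; [exact: ca|exact: norm_continuous].
  by exists `|a p.1 p.2 t| => s hs; apply: Ht; rewrite in_itv.
have [C HC] := choice bnd.
rewrite -LE.
apply: (@linear_ode_zero I (fun i t => w i (L t)) a (\sum_p `|C p|)) => //.
- by rewrite sumr_ge0.
- move=> t ht i' m; rewrite (le_trans (HC (i', m) t ht))//.
  rewrite (bigD1 (i', m))//= (le_trans (ler_norm _))// lerDl sumr_ge0//.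
- move=> t ht i'; have tr := segment_in_ball ur ht.
  have := @is_derive_line R n (w i') u0 (u - u0) t (dw i' _ tr).
  have -> // : \sum_i (u - u0) 0 i * pd i (w i') (u0 + t *: (u - u0)) =
    \sum_m a i' m t * w m (L t).
  under eq_bigr do rewrite pw// mulr_sumr.
  rewrite exchange_big; apply: eq_bigr => m _ /=.
  by rewrite /a mulr_suml; apply: eq_bigr => l _; rewrite mulrA.
- by move=> i'; rewrite L0.
Qed.

End Gronwall.

Section VectorFunctions.
Context {R : realType} {n : nat}.
Implicit Types (u : 'rV[R]_n).

Lemma differentiable_entry m (g : 'rV[R]_n -> 'rV[R]_m) u k :
  differentiable g u -> differentiable (fun w => g w 0 k) u.
Proof.
move=> dg; apply: (@differentiable_comp _ _ _ _ g (fun v : 'rV[R]_m => v 0 k)) => //.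
exact: differentiable_coord.
Qed.

Lemma differentiable_rowP m (g : 'rV[R]_n -> 'rV[R]_m) u :
  (forall k, differentiable (fun w => g w 0 k) u) -> differentiable g u.
Proof.
move=> H; have -> : g = \sum_(k < m) (fun w => g w 0 k *: (delta_mx 0 k : 'rV[R]_m)).
  by apply/funext => w; rewrite fct_sumE [LHS]row_sum_delta.
by apply: differentiable_sum => k; exact: differentiableZl.
Qed.

Lemma partial_row m (g : 'rV[R]_n -> 'rV[R]_m) u i k : differentiable g u ->
  partial i g u 0 k = pd i (fun w => g w 0 k) u.
Proof.
by move=> dg; rewrite pdE /partial derive_mx ?mxE//; exact: diff_derivable.
Qed.

Lemma row_jacobian m (g : 'rV[R]_n -> 'rV[R]_m) u i : differentiable g u ->
  row i ('J g u) = partial i g u.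
Proof. by move=> dg; rewrite rowE /partial deriveEjacobian. Qed.

Lemma jacobian_partial m (g : 'rV[R]_n -> 'rV[R]_m) u i k : differentiable g u ->
  'J g u i k = partial i g u 0 k.
Proof. by move=> dg; rewrite -row_jacobian// [RHS]mxE. Qed.

Lemma jacobian_entry m (g : 'rV[R]_n -> 'rV[R]_m) u i k : differentiable g u ->
  'J g u i k = pd i (fun w => g w 0 k) u.
Proof. by move=> dg; rewrite -partial_row// -row_jacobian// [RHS]mxE. Qed.

Lemma norm_entry m (v : 'rV[R]_m) k : `|v 0 k| <= `|v|.
Proof.
rewrite [leRHS]/Num.Def.normr/= mx_normrE.
exact: (le_bigmax _ (fun ij => `|v ij.1 ij.2|) (0, k)).
Qed.

Lemma norm_row_le m (v : 'rV[R]_m) c : 0 <= c -> (forall k, `|v 0 k| <= c) -> `|v| <= c.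
Proof.
move=> c0 H; rewrite [leLHS]/Num.Def.normr/= mx_normrE; apply: bigmax_le => // -[a b] _.
by rewrite /= (ord1 a).
Qed.

Lemma norm_mulmx p m (A : 'M[R]_(p, m)) : exists2 C, 0 < C &
  forall v : 'rV[R]_p, `|v *m A| <= C * `|v|.
Proof.
exists (1 + \sum_i \sum_j `|A i j|).
  by rewrite ltr_pwDl// sumr_ge0// => i _; rewrite sumr_ge0.
move=> v; apply: norm_row_le => [|k].
  rewrite mulr_ge0// addr_ge0// sumr_ge0// => i _; exact: sumr_ge0.
rewrite mxE (le_trans (ler_norm_sum _ _ _))//.
apply: (@le_trans _ _ (\sum_i `|A i k| * `|v|)).
  apply: ler_sum => i _; rewrite normrM mulrC ler_wpM2l//; exact: norm_entry.
rewrite -mulr_suml ler_wpM2r// (@le_trans _ _ (\sum_i \sum_j `|A i j|))//.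
  apply: ler_sum => i _; rewrite (bigD1 k)//= lerDl; exact: sumr_ge0.
by rewrite lerDr.
Qed.

End VectorFunctions.

Section OpenMapping.
Context {R : realType} {n : nat}.

(** Least-squares proof: for y near g z0, the squared distance Q from g z to y has
    a minimum over a small closed ball around z0.  On the boundary sphere Q
    exceeds Q z0, because g moves these points away from g z0, so the minimum is interior; its
    gradient 2 (g z - y) ('J g z)^T then vanishes, and g z = y. *)
Lemma open_image (g : 'rV[R]_n -> 'rV[R]_n) (U : set 'rV[R]_n) : open U ->
  (forall z, U z -> differentiable g z /\ 'J g z \in unitmx) -> open (g @` U).
Proof.
move=> oU H; rewrite openE => _ [z0 Uz0 <-].
have [dg0 J0] := H _ Uz0.
have [C C0 HC] := norm_mulmx (invmx ('J g z0)).
(* Invertibility of the Jacobian gives |h J| >= |h| / C; half of this survives the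
   first-order error on a small ball. *)
have lowJ (h : 'rV[R]_n) : C^-1 * `|h| <= `|h *m 'J g z0|.
  by rewrite ler_pdivrMl//; have := HC (h *m 'J g z0); rewrite mulmxK.
have c0 : 0 < C^-1 / 2 by rewrite divr_gt0 ?invr_gt0.
have [L cL HL] := iffLR (differentiable_epsP _ _) dg0.
have EL k : k *m 'J g z0 = L k.
  have EL : 'd g z0 = L :> (_ -> _).
    apply: diff_unique => //; apply/eqaddoP => e' e'0; apply: filterS (HL e' e'0) => k'.
    by rewrite !fctE /= [_ + k']addrC opprD addrA.
  by rewrite -deriveEjacobian// deriveE// EL.
have /nbhs_ballP[d1 /= d10 H1] := near_translate (open_nbhs_nbhs (conj oU Uz0)).
have /nbhs_ballP[d2 /= d20 H2] := HL _ c0.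
pose d := Num.min d1 d2 / 2.
have m0 : 0 < Num.min d1 d2 by rewrite lt_min d10.
have d0 : 0 < d by rewrite divr_gt0.
have : d < Num.min d1 d2 by rewrite ltr_pdivrMr// ltr_pMr// ltr1n.
rewrite lt_min => /andP[dd1 dd2].
have low h : `|h| <= d -> C^-1 / 2 * `|h| <= `|g (z0 + h) - g z0|.
  move=> hd; have hb : ball (0 : 'rV[R]_n) d2 h.
    by rewrite -ball_normE /= sub0r normrN (le_lt_trans hd).
  have := H2 _ hb => /=; rewrite -EL => E.
  set X := g (z0 + h) - g z0 in E *.
  have T : `|h *m 'J g z0| <= `|X| + C^-1 / 2 * `|h|.
    rewrite -[h *m _](subKr X) (le_trans (ler_normB _ _))//.
    by rewrite lerD2l.
  have := le_trans (lowJ h) T; rewrite {1}[C^-1]splitr mulrDl.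
  by rewrite lerD2r.
(* The factor n + 2 absorbs the loss between the sup norm and the sum of squares:
   Q z0 <= n eta^2 while Q > (n + 1)^2 eta^2 on the sphere. *)
pose eta := C^-1 / 2 * d / (n%:R + 2).
have n2 : 0 < n%:R + 2 :> R by rewrite ltr_wpDl.
have eta0 : 0 < eta by rewrite divr_gt0// mulr_gt0.
apply/nbhs_ballP; exists eta => //= y; rewrite -ball_normE /= => yb.
pose Q z := \sum_k (g z 0 k - y 0 k) ^+ 2.
pose K : set 'rV[R]_n := closed_ball z0 d.
have KE : K = closed_ball_ (@Num.Def.normr _ _) z0 d by rewrite /K closed_ballE.
have KU z : K z -> U z.
  rewrite KE /closed_ball_ /= => zd; rewrite -(subrKC z0 z); apply: H1.
  by rewrite -ball_normE /= sub0r normrN distrC (le_lt_trans zd).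
have dQ z : U z -> differentiable Q z.
  move=> Uz; apply: diff_sum => k _.
  under eq_fun do rewrite expr2.
  by apply: diff_mul; apply: diff_sub; (exact: diff_const || exact: (differentiable_entry k (H z Uz).1)).
have cK : compact K.
  apply: bounded_closed_compact; last exact: closed_ball_closed.
  exists (`|z0| + d); split; first exact: num_real.
  move=> M hM z; rewrite KE /closed_ball_ /= => zd.
  rewrite (le_trans _ (ltW hM))// -(subrKC z0 z) (le_trans (ler_normD _ _))//.
  by rewrite lerD2l distrC.
have [||zs zsK Hmin] := @EVT_min_rV R n Q K _ cK.
- by exists z0; rewrite KE /closed_ball_ /= subrr normr0 ltW.
- apply: continuous_in_subspaceT => z /set_mem Kz.
  by apply: differentiable_continuous; apply: dQ; exact: KU.
have {}zsK := set_mem zsK.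
have Qlow z (a : R) : 0 <= a -> a < `|g z - y| -> a ^+ 2 < Q z.
  move=> a0 az; rewrite ltNge; apply/negP => Qa; move: az; rewrite ltNge => /negP; apply.
  apply: norm_row_le => // k; rewrite !mxE -(ler_pXn2r (_ : 0 < 2)%N) ?nnegrE//.
  rewrite real_normK ?num_real// (le_trans _ Qa)// /Q (bigD1 k)//= lerDl.
  by apply: sumr_ge0 => *; exact: sqr_ge0.
have Q0 : Q z0 <= n%:R * eta ^+ 2.
  apply: (@le_trans _ _ (\sum_(k < n) eta ^+ 2)); last first.
    by rewrite sumr_const card_ord mulr_natl.
  apply: ler_sum => k _; rewrite -real_normK ?num_real//.
  rewrite ler_pXn2r ?nnegrE// ?ltW//.
  apply: le_lt_trans yb; have := norm_entry (g z0 - y) k; by rewrite !mxE.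
have zsd : `|z0 - zs| < d.
  have : `|z0 - zs| <= d by move: zsK; rewrite KE.
  rewrite le_eqVlt => /orP[/eqP zd|//].
  have Lw := low (zs - z0); rewrite distrC zd lexx subrKC in Lw.
  have {}Lw := Lw isT.
  have E : (n%:R + 1) * eta < `|g zs - y|.
    have T : `|g zs - g z0| <= `|g zs - y| + `|g z0 - y|.
      rewrite -[g zs - g z0](subrKA y) (le_trans (ler_normD _ _))// lerD2l.
      by rewrite distrC.
    have : C^-1 / 2 * d = (n%:R + 2) * eta by rewrite /eta [RHS]mulrC divfK// gt_eqF.
    by move=> E1; rewrite E1 in Lw; lra.
  have n1 : 0 <= (n%:R + 1) * eta by rewrite mulr_ge0 ?addr_ge0// ltW.
  have := Qlow _ _ n1 E; have := Hmin z0.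
  have -> : z0 \in K by rewrite inE KE /closed_ball_ /= subrr normr0 ltW.
  move=> /(_ isT) => A B; have := lt_le_trans B (le_trans A Q0).
  rewrite exprMn ltr_pM2r ?exprn_gt0// => Abs.
  have n0 : 0 <= n%:R :> R by [].
  have : n%:R <= (n%:R + 1) ^+ 2 :> R by have := sqr_ge0 (n%:R : R); lra.
  by rewrite leNgt Abs.
have Uzs := KU _ zsK; have [dgs Js] := H _ Uzs.
have grad i : pd i Q zs = 0.
  pose e : 'rV[R]_n := delta_mx 0 i.
  pose rho := (d - `|z0 - zs|) / 2.
  have rho0 : 0 < rho by rewrite divr_gt0// subr_gt0.
  have inK (t : R) : - rho < t < rho -> K (zs + t *: e).
    move=> /andP[t1 t2]; rewrite KE /closed_ball_ /= opprD addrA.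
    rewrite (le_trans (ler_normB _ _))// normrZ.
    have te : `|t| * `|e| <= rho.
      by rewrite -[leRHS]mulr1 ler_pM ?norm_delta// ler_norml !ltW.
    rewrite -lerBrDl (le_trans te)// /rho ler_pdivrMr// ler_peMr// ?ler1n//.
    by rewrite subr_ge0 ltW.
  have dline (t : R) : - rho < t < rho -> is_derive t 1 (fun s : R => Q (zs + s *: e))
      (\sum_k e 0 k * pd k Q (zs + t *: e)).
    by move=> ht; apply: is_derive_line; apply: dQ; apply: KU; exact: inK.
  have D0 : is_derive (0 : R) 1 (fun s : R => Q (zs + s *: e)) 0.
    apply: (@derive1_at_min _ _ (- rho) rho).
    - by rewrite ge0_cp// ltW.
    - by move=> t; rewrite in_itv /= => /dline[].
    - by rewrite in_itv /= oppr_lt0 rho0.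
    - move=> t; rewrite in_itv /= scale0r addr0 => ht; apply: Hmin.
      by rewrite inE; exact: inK.
  have D00 : - rho < 0 < rho by rewrite oppr_lt0 rho0.
  have [_] := dline 0 D00.
  rewrite (@derive_val _ _ _ _ _ _ _ D0) scale0r addr0 => /esym.
  rewrite (bigD1 i)//= big1 => [|k ki]; last by rewrite !mxE eqxx (negbTE ki) mul0r.
  by rewrite !mxE !eqxx mul1r addr0.
exists zs => //; apply/eqP; rewrite -subr_eq0; apply/eqP.
have : 'J g zs *m (g zs - y)^T = 0.
  apply/matrixP => i j; rewrite (ord1 j) {j} [RHS]mxE.
  have := grad i; rewrite /Q pd_sum => [|k _]; last first.
    under eq_fun do rewrite expr2.
    by apply: diff_mul; apply: diff_sub; (exact: diff_const || exact: (differentiable_entry k dgs)).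
  under eq_bigr => k _.
    under eq_fun do rewrite expr2.
    rewrite pd_mul; try (by apply: diff_sub; (exact: diff_const || exact: (differentiable_entry k dgs))).
    rewrite pd_sub; [|exact: (differentiable_entry k dgs)|exact: diff_const].
    rewrite pd_const subr0 -(jacobian_entry _ _ dgs) mulrC -mulr2n -mulr_natl.
    over.
  rewrite -mulr_sumr => /eqP; rewrite mulf_eq0 pnatr_eq0 /= => /eqP E.
  by rewrite mxE -[RHS]E; apply: eq_bigr => k _; rewrite !mxE mulrC.
move=> /(congr1 (mulmx (invmx ('J g zs)))); rewrite mulmxA mulVmx// mul1mx mulmx0.
by move=> /(congr1 trmx); rewrite trmxK trmx0.
Qed.

End OpenMapping.

(** * Structure equations of a canonical centroaffine hypersurface *)

Section StructureEquations.
Context {R : realType} {n : nat} (eps : R) (f : 'rV[R]_n -> 'rV[R]_n.+1) (U : set 'rV[R]_n).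
Context (oU : open U) (sf : smooth_on U f)
  (regf : forall u, U u -> immersed_at f u /\ transversal_at f u).

Lemma smooth_entry k s (b : 'I_n.+1) : Ck k U (fun u => foldr partial f s u 0 b).
Proof.
elim: k s => [|k IH] s.
  by split=> // u Uu; apply: differentiable_entry; exact: sf.
split=> [u Uu|i]; first by apply: differentiable_entry; exact: sf.
apply: (Ck_ext oU _ (IH (i :: s))) => u /set_mem Uu /=.
by rewrite partial_row//; exact: sf.
Qed.

Let df u (Uu : U u) : differentiable f u := sf [::] Uu.
Let dpf i u (Uu : U u) : differentiable (partial i f) u := sf [:: i] Uu.

(** [ca_frame], sealed and typed with 1 + n rows so that its blocks are seen. *)
Definition frame u : 'M[R]_(1 + n) :=
  locked (col_mx (f u : 'rV[R]_(1 + n)) ('J f u : 'M[R]_(n, 1 + n))).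

Lemma frame_up u b : frame u (lshift n 0) b = f u 0 b.
Proof. by rewrite /frame -lock; exact: col_mxEu. Qed.

Lemma frame_down u j b : U u -> frame u (rshift 1 j) b = partial j f u 0 b.
Proof. by move=> Uu; rewrite /frame -lock col_mxEd; exact: (jacobian_partial j b (df Uu)). Qed.

Lemma frame_unit u : U u -> frame u \in unitmx.
Proof. by rewrite /frame -lock => /regf[i t]; exact: ca_frame_unit. Qed.

Lemma frame_smooth k : Cmx k U frame.
Proof.
move=> a b; case: (split_ordP a) => j ->.
  by apply: (Ck_ext oU _ (smooth_entry k [::] b)) => u _; rewrite (ord1 j) frame_up.
by apply: (Ck_ext oU _ (smooth_entry k [:: j] b)) => u /set_mem Uu; rewrite frame_down.
Qed.

Lemma gauss_coef_smooth k i j b : Ck k U (fun u => gauss_coef f i j u 0 b).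
Proof.
have C : Cmx k U (fun u => partial i (partial j f) u *m invmx (frame u)).
  apply: Cmx_mul => //.
    by move=> a c; rewrite (ord1 a); exact: (smooth_entry k [:: i; j] c).
  by apply: Cmx_inv => //; [exact: frame_smooth|exact: frame_unit].
by apply: (Ck_ext oU _ (C 0 b)) => u _; rewrite /frame -lock.
Qed.

(** Sealed coefficients: [radial] is the component of d_i d_j f along f, [Gm] the
    induced connection, [LC] the Levi-Civita connection of the metric [h]. *)
Definition radial (i j : 'I_n) u : R := locked (lsubmx (gauss_coef f i j u) 0 0).
Definition Gm := locked (induced_connection f).
Definition h := locked (ca_metric eps f).
Definition LC := locked (levi_civita (ca_metric eps f)).

Lemma radialE i j u : radial i j u = gauss_coef f i j u 0 (lshift n 0).
Proof. by rewrite /radial -lock mxE. Qed.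
Lemma GmE i j k u : Gm i j k u = gauss_coef f i j u 0 (rshift 1 k).
Proof. by rewrite /Gm -lock /induced_connection mxE. Qed.

Lemma radial_smooth k i j : Ck k U (radial i j).
Proof.
by apply: (Ck_ext oU _ (gauss_coef_smooth k i j (lshift n 0))) => u _; rewrite radialE.
Qed.

Lemma Gm_smooth k i j m : Ck k U (Gm i j m).
Proof.
by apply: (Ck_ext oU _ (gauss_coef_smooth k i j (rshift 1 m))) => u _; rewrite GmE.
Qed.

Lemma hE i j u : h u i j = - eps * radial i j u.
Proof. by rewrite /h /radial -!lock mxE. Qed.

Lemma h_smooth k i j : Ck k U (fun u => h u i j).
Proof.
under eq_fun do rewrite hE.
by apply: Ck_mul => //; [exact: Ck_const|exact: radial_smooth].
Qed.

Lemma partial_partial_sym i j u : U u ->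
  partial i (partial j f) u = partial j (partial i f) u.
Proof.
move=> Uu; apply/rowP => b.
have H1 := @partial_row R n n.+1 (partial j f) u i b (dpf j Uu).
have H2 := partial_row j b (dpf i Uu).
apply: (etrans H1); apply: (etrans _ (esym H2)).
have E k w : U w -> partial k f w 0 b = pd k (fun w => f w 0 b) w.
  by move=> Uw; rewrite partial_row//; exact: df.
have D k : differentiable (pd k (fun w => f w 0 b)) u.
  exact: (Ck_diff (Ck_pd k (smooth_entry 1 [::] b)) Uu).
rewrite (pd_near i oU Uu (h := pd j (fun w => f w 0 b))); last first.
  by move=> w /set_mem Uw; exact: E.
rewrite [RHS](pd_near j oU Uu (h := pd i (fun w => f w 0 b))); last first.
  by move=> w /set_mem Uw; exact: E.
apply: (schwarz oU Uu) => // w Uw; exact: (Ck_diff (smooth_entry 0 [::] b)).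
Qed.

Lemma gauss_coef_sym i j u : U u -> gauss_coef f i j u = gauss_coef f j i u.
Proof. by move=> Uu; rewrite /gauss_coef partial_partial_sym. Qed.

Lemma radial_sym i j u : U u -> radial i j u = radial j i u.
Proof. by move=> Uu; rewrite !radialE gauss_coef_sym. Qed.

Lemma Gm_sym i j k u : U u -> Gm i j k u = Gm j i k u.
Proof. by move=> Uu; rewrite !GmE gauss_coef_sym. Qed.

Lemma gauss_frame i j u : U u -> gauss_coef f i j u *m frame u = partial i (partial j f) u.
Proof.
move=> Uu; have := frame_unit Uu; rewrite /frame -lock => Fu; exact: (mulmxKV Fu).
Qed.

(** The common shape of all coefficient matrices of the moving frame: row 0
    is the image of f, namely e times d_i f, and row j that of d_j f. *)
Definition blk (c : 'I_n -> 'I_n -> R) (G : 'I_n -> 'I_n -> 'I_n -> R) (e : R) i : 'M[R]_(1 + n) :=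
  locked (block_mx 0 (e *: delta_mx 0 i) (\col_j c i j) (\matrix_(j, k) G i j k)).

Lemma blkE00 c G e i : blk c G e i (lshift n 0) (lshift n 0) = 0.
Proof. by rewrite /blk -lock block_mxEul mxE. Qed.
Lemma blkE0d c G e i k : blk c G e i (lshift n 0) (rshift 1 k) = e * (k == i)%:R.
Proof. by rewrite /blk -lock block_mxEur !mxE. Qed.
Lemma blkEd0 c G e i j : blk c G e i (rshift 1 j) (lshift n 0) = c i j.
Proof. by rewrite /blk -lock block_mxEdl mxE. Qed.
Lemma blkEdd c G e i j k : blk c G e i (rshift 1 j) (rshift 1 k) = G i j k.
Proof. by rewrite /blk -lock block_mxEdr mxE. Qed.
Definition blkE := (blkE00, blkE0d, blkEd0, blkEdd).

Lemma block_eqP (A B : 'M[R]_(1 + n)) :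
  A (lshift n 0) (lshift n 0) = B (lshift n 0) (lshift n 0) ->
  (forall k, A (lshift n 0) (rshift 1 k) = B (lshift n 0) (rshift 1 k)) ->
  (forall j, A (rshift 1 j) (lshift n 0) = B (rshift 1 j) (lshift n 0)) ->
  (forall j k, A (rshift 1 j) (rshift 1 k) = B (rshift 1 j) (rshift 1 k)) -> A = B.
Proof.
move=> H1 H2 H3 H4; apply/matrixP => a b.
by case: (split_ordP a) => j ->; case: (split_ordP b) => k ->; rewrite ?(ord1 j) ?(ord1 k).
Qed.

Lemma blockM (A B : 'M[R]_(1 + n)) a b : (A *m B) a b =
  A a (lshift n 0) * B (lshift n 0) b + \sum_m A a (rshift 1 m) * B (rshift 1 m) b.
Proof. by rewrite mxE big_split_ord big_ord1. Qed.

Lemma sum_kronecker (F : 'I_n -> R) i e : \sum_m e * (m == i)%:R * F m = e * F i.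
Proof.
rewrite (bigD1 i)//= eqxx mulr1 big1 ?addr0// => m /negbTE ->.
by rewrite mulr0 mul0r.
Qed.

Definition conn i u : 'M[R]_(1 + n) :=
  blk (fun i j => radial i j u) (fun i j k => Gm i j k u) 1 i.

Lemma connE i u : conn i u = blk (fun i j => radial i j u) (fun i j k => Gm i j k u) 1 i.
Proof. by []. Qed.

Lemma dframe i u : U u -> dmx i frame u = conn i u *m frame u.
Proof.
move=> Uu; apply/matrixP => a b; rewrite dmxE blockM connE.
case: (split_ordP a) => j ->.
  rewrite (ord1 j) blkE00 mul0r add0r.
  under [RHS]eq_bigr do rewrite blkE0d.
  rewrite sum_kronecker.
  rewrite mul1r; apply: (etrans _ (esym (frame_down i b Uu))).
  apply: (etrans _ (esym (partial_row i b (df Uu)))).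
  by under eq_fun do rewrite frame_up.
rewrite (pd_near i oU Uu (h := fun w => partial j f w 0 b)); last first.
  by move=> w /set_mem Uw; rewrite frame_down.
rewrite -(partial_row i b (dpf j Uu)).
rewrite -(gauss_frame i j Uu) blkEd0.
rewrite mxE big_split_ord big_ord1; congr (_ + _).
  by rewrite radialE.
by apply: eq_bigr => m _; rewrite blkEdd GmE.
Qed.

Lemma conn_smooth k i : Cmx k U (conn i).
Proof.
move=> a b; case: (split_ordP a) => j ->; case: (split_ordP b) => m ->.
- by rewrite (ord1 j) (ord1 m); under eq_fun do rewrite connE blkE00; exact: Ck_const.
- by rewrite (ord1 j); under eq_fun do rewrite connE blkE0d; exact: Ck_const.
- by rewrite (ord1 m); under eq_fun do rewrite connE blkEd0; exact: radial_smooth.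
- by under eq_fun do rewrite connE blkEdd; exact: Gm_smooth.
Qed.

(** Symmetry of second derivatives of the frame, divided by the frame. *)
Lemma integrability i l u : U u ->
  dmx l (conn i) u + conn i u *m conn l u = dmx i (conn l) u + conn l u *m conn i u.
Proof.
move=> Uu; apply: (can_inj (mulmxK (frame_unit Uu))).
have E1 p q : dmx p (conn q) u *m frame u + conn q u *m (conn p u *m frame u) =
    dmx p (dmx q frame) u.
  rewrite -dframe// -(dmx_mul p (conn_smooth 0 q) (frame_smooth 0) Uu).
  by apply: (dmx_near p oU Uu) => w /set_mem Uw; rewrite dframe.
rewrite (mulmxDl (dmx l (conn i) u)) -(mulmxA (conn i u)) E1.
rewrite (mulmxDl (dmx i (conn l) u)) -(mulmxA (conn l u)) E1.
have E2 p q a b : dmx p (dmx q frame) u a b = pd p (pd q (fun w => frame w a b)) u.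
  rewrite dmxE; congr (pd p _ u); apply/funext => w; exact: dmxE.
apply/matrixP => a b; apply: (etrans (E2 _ _ _ _)); apply: (etrans _ (esym (E2 _ _ _ _))).
apply: (schwarz oU Uu).
- by move=> w Uw; exact: (Ck_diff (frame_smooth 0 a b)).
- exact: (Ck_diff (Ck_pd _ (frame_smooth 1 a b)) Uu).
- exact: (Ck_diff (Ck_pd _ (frame_smooth 1 a b)) Uu).
Qed.

(** The column of f in [integrability]. *)
Lemma codazzi i j l u : U u ->
  pd l (radial i j) u + \sum_m Gm i j m u * radial l m u =
  pd i (radial l j) u + \sum_m Gm l j m u * radial i m u.
Proof.
move=> Uu.
have E p q : (dmx q (conn p) u + conn p u *m conn q u) (rshift 1 j) (lshift n 0) =
    pd q (radial p j) u + \sum_m Gm p j m u * radial q m u.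
  rewrite mxE dmxE blockM !connE blkE00 mulr0 add0r; congr (_ + _).
    by under eq_fun do rewrite connE blkEd0.
  by apply: eq_bigr => m _; rewrite blkEdd blkEd0.
apply: (etrans (esym (E i l))); apply: (etrans _ (E l i)).
by rewrite (integrability i l Uu).
Qed.

Context (eps1 : eps = 1 \/ eps = - 1) (pdh : forall u, U u -> posdef (ca_metric eps f u)).

Lemma h_sym i j u : U u -> h u i j = h u j i.
Proof. by move=> Uu; rewrite !hE radial_sym. Qed.

Lemma posdef_unitmx (B : 'M[R]_n) : posdef B -> B \in unitmx.
Proof.
move=> pB; rewrite -row_free_unit; apply: inj_row_free => v vB.
apply/eqP/negPn/negP => /pB; by rewrite vB mul0mx mxE ltxx.
Qed.

Lemma h_unit u : U u -> h u \in unitmx.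
Proof. by rewrite /h -lock => /pdh/posdef_unitmx. Qed.

Lemma LCE i j k u : LC i j k u =
  2^-1 * \sum_l invmx (h u) k l *
    (pd i (fun w => h w j l) u + pd j (fun w => h w i l) u
     - pd l (fun w => h w i j) u).
Proof.
rewrite /LC /h -!lock /levi_civita; congr (_ * _); apply: eq_bigr => l _.
by rewrite !pdE.
Qed.

Lemma LC_smooth k i j m : Ck k U (LC i j m).
Proof.
apply: (Ck_ext oU (g := fun u => 2^-1 * \sum_l invmx (h u) m l *
    (pd i (fun w => h w j l) u + pd j (fun w => h w i l) u
     - pd l (fun w => h w i j) u))); first by move=> u _; rewrite LCE.
apply: Ck_mul => //; first exact: Ck_const.
apply: Ck_sum => // l _; apply: Ck_mul => //.
  by apply: (Cmx_inv oU _ h_unit) => a b; exact: h_smooth.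
by apply: Ck_sub => //; [apply: Ck_add => //|]; apply: Ck_pd; exact: h_smooth.
Qed.

Lemma pd_h_sym l i j u : U u ->
  pd l (fun w => h w i j) u = pd l (fun w => h w j i) u.
Proof. by move=> Uu; apply: (pd_near l oU Uu) => w /set_mem; exact: h_sym. Qed.

Lemma LC_sym i j k u : U u -> LC i j k u = LC j i k u.
Proof.
move=> Uu; rewrite !LCE; congr (_ * _); apply: eq_bigr => l _.
by rewrite (pd_h_sym l i j Uu); congr (_ * _); ring.
Qed.

Lemma LC_lower l i j u : U u -> \sum_m LC l i m u * h u m j =
  2^-1 * (pd l (fun w => h w i j) u + pd i (fun w => h w l j) u
          - pd j (fun w => h w l i) u).
Proof.
move=> Uu; pose X p := pd l (fun w => h w i p) u + pd i (fun w => h w l p) u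
          - pd p (fun w => h w l i) u.
transitivity (2^-1 * \sum_p X p * (h u *m invmx (h u)) j p).
  rewrite mulr_sumr; under [RHS]eq_bigr do rewrite mxE mulr_sumr mulr_sumr.
  rewrite exchange_big; apply: eq_bigr => m _ /=.
  rewrite LCE mulr_sumr mulr_suml; apply: eq_bigr => p _.
  by rewrite (h_sym j m Uu) /X; ring.
rewrite mulmxV ?h_unit// (bigD1 j)//= big1 => [|p pj]; last first.
  by rewrite mxE eq_sym (negbTE pj) mulr0.
by rewrite mxE eqxx mulr1 addr0.
Qed.

Lemma LC_metric l i j u : U u -> pd l (fun w => h w i j) u =
  \sum_m LC l i m u * h u m j + \sum_m LC l j m u * h u i m.
Proof.
move=> Uu; under [X in _ + X]eq_bigr do rewrite (h_sym i _ Uu).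
rewrite !LC_lower// (pd_h_sym l i j Uu) (pd_h_sym i l j Uu) (pd_h_sym j l i Uu).
by lra.
Qed.

(** The difference tensor of the two connections; in [Klow] the upper index is
    lowered with h. *)
Definition KK i j k u : R := locked (Gm i j k u - LC i j k u).
Definition Klow i j k u : R := locked (\sum_m KK i j m u * h u m k).

Lemma KKE i j k u : KK i j k u = Gm i j k u - LC i j k u.
Proof. by rewrite /KK -lock. Qed.
Lemma KlowE i j k u : Klow i j k u = \sum_m KK i j m u * h u m k.
Proof. by rewrite /Klow -lock. Qed.

Lemma KK_smooth k i j m : Ck k U (KK i j m).
Proof.
apply: (Ck_ext oU _ (Ck_sub oU (Gm_smooth k i j m) (LC_smooth k i j m))) => u _.
by rewrite KKE.
Qed.

Lemma Klow_smooth k i j m : Ck k U (Klow i j m).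
Proof.
apply: (Ck_ext oU (g := fun u => \sum_p KK i j p u * h u p m)).
  by move=> u _; rewrite KlowE.
by apply: Ck_sum => // p _; apply: Ck_mul => //; [exact: KK_smooth|exact: h_smooth].
Qed.

Lemma KK_sym i j k u : U u -> KK i j k u = KK j i k u.
Proof. by move=> Uu; rewrite !KKE Gm_sym// LC_sym. Qed.

Lemma Klow_sym12 i j k u : U u -> Klow i j k u = Klow j i k u.
Proof. by move=> Uu; rewrite !KlowE; apply: eq_bigr => m _; rewrite KK_sym. Qed.

Definition cub := locked (cubic_form eps f).

Lemma cubE i j k u : cub i j k u = pd i (fun w => h w j k) u
  - \sum_m Gm i j m u * h u m k - \sum_m Gm i k m u * h u j m.
Proof. by rewrite /cub /h /Gm -!lock !pdE. Qed.

(** As h is parallel for its Levi-Civita connection, only the difference tensor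
    contributes to the derivative of h along the induced connection. *)
Lemma cubicE i j k u : U u -> cub i j k u = - Klow i j k u - Klow i k j u.
Proof.
move=> Uu; rewrite cubE LC_metric// !KlowE.
have E p q r : \sum_m KK p q m u * h u m r =
   \sum_m Gm p q m u * h u m r - \sum_m LC p q m u * h u m r.
  by rewrite -sumrB; apply: eq_bigr => m _; rewrite KKE mulrBl.
have S (F : 'I_n -> R) : \sum_m F m * h u j m = \sum_m F m * h u m j.
  by apply: eq_bigr => m _; rewrite h_sym.
by rewrite !E !S; ring.
Qed.

Lemma codazzi_h i j l u : U u ->
  pd l (fun w => h w i j) u + \sum_m Gm i j m u * h u l m =
  pd i (fun w => h w l j) u + \sum_m Gm l j m u * h u i m.
Proof.
move=> Uu; have E k p q : pd k (fun w => h w p q) u = - eps * pd k (radial p q) u.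
  under eq_fun do rewrite hE.
  rewrite pd_mul; [|exact: diff_const|exact: (Ck_diff (radial_smooth 0 _ _) Uu)].
  by rewrite pd_const mul0r add0r.
have S p q r : \sum_m Gm p q m u * h u r m = - eps * \sum_m Gm p q m u * radial r m u.
  by rewrite mulr_sumr; apply: eq_bigr => m _; rewrite hE; ring.
apply: (etrans (congr2 +%R (E l i j) (S i j l))).
apply: (etrans _ (esym (congr2 +%R (E i l j) (S l j i)))).
have C := codazzi i j l Uu.
exact: (etrans (esym (mulrDr _ _ _)) (etrans (congr1 _ C) (mulrDr _ _ _))).
Qed.

Lemma cubic_sym i j k u : U u -> cub i j k u = cub j i k u.
Proof.
move=> Uu; rewrite !cubE.
have := codazzi_h j k i Uu => E.
have E1 : \sum_m Gm i j m u * h u m k = \sum_m Gm j i m u * h u m k.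
  by apply: eq_bigr => m _; rewrite Gm_sym.
rewrite E1; lra.
Qed.

(** Codazzi makes C symmetric in all indices, and K is symmetric in the first two;
    solving for K gives total symmetry, whence C = - 2 K. *)
Lemma Klow_sym23 i j k u : U u -> Klow i j k u = Klow i k j u.
Proof.
move=> Uu; have := cubic_sym j k i Uu; rewrite !cubicE//.
rewrite (Klow_sym12 j i k Uu) (Klow_sym12 k j i Uu) (Klow_sym12 k i j Uu).
by lra.
Qed.

Context (flat : forall u, U u -> forall i j k l,
    curvature (levi_civita (ca_metric eps f)) i j k l u = 0)
  (par : forall u, U u -> forall l i j k,
    cov_deriv3 (levi_civita (ca_metric eps f)) (cubic_form eps f) l i j k u = 0).

Lemma Klow_parallel l i j k u : U u -> pd l (Klow i j k) u =
  \sum_m LC l i m u * Klow m j k u + \sum_m LC l j m u * Klow i m k u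
  + \sum_m LC l k m u * Klow i j m u.
Proof.
move=> Uu; have CE p q r w : U w -> cub p q r w = - 2 * Klow p q r w.
  by move=> Uw; rewrite cubicE// (Klow_sym23 p r q Uw); ring.
have : cov_deriv3 LC cub l i j k u = 0 by rewrite /LC /cub -!lock par.
rewrite /cov_deriv3 -pdE (pd_near l oU Uu (h := fun w => - 2 * Klow i j k w)); last first.
  by move=> w /set_mem; exact: CE.
rewrite pd_mul; [|exact: diff_const|exact: (Ck_diff (Klow_smooth 0 _ _ _) Uu)].
rewrite pd_const mul0r add0r.
under eq_bigr do rewrite CE// mulrCA.
under [X in _ - X - _]eq_bigr do rewrite CE// mulrCA.
under [X in _ - X]eq_bigr do rewrite CE// mulrCA.
by rewrite -!mulr_sumr; lra.
Qed.

(** Raising an index preserves parallelism: multiply by h and use that h is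
    parallel. *)
Lemma KK_parallel l i j k u : U u ->
  pd l (KK i j k) u + \sum_m KK i j m u * LC l m k u
  - \sum_m LC l j m u * KK i m k u = \sum_m LC l i m u * KK m j k u.
Proof.
move=> Uu.
pose X k := pd l (KK i j k) u + \sum_m KK i j m u * LC l m k u
  - \sum_m LC l j m u * KK i m k u - \sum_m LC l i m u * KK m j k u.
suff : (\row_k X k) = 0 by move/rowP/(_ k); rewrite !mxE /X => /eqP; rewrite subr_eq0 => /eqP.
apply: (can_inj (mulmxK (h_unit Uu))); rewrite mul0mx; apply/rowP => q; rewrite !mxE.
under eq_bigr do rewrite mxE.
have D : pd l (Klow i j q) u = \sum_m pd l (KK i j m) u * h u m q
    + \sum_m KK i j m u * pd l (fun w => h w m q) u.
  rewrite (pd_near l oU Uu (h := fun w => \sum_m KK i j m w * h w m q)); last first.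
    by move=> w _; rewrite KlowE.
  rewrite pd_sum => [|m _]; last first.
    by apply: diff_mul; [exact: (Ck_diff (KK_smooth 0 _ _ _) Uu)|exact: (Ck_diff (h_smooth 0 _ _) Uu)].
  rewrite -big_split; apply: eq_bigr => m _; rewrite pd_mul//.
  - exact: (Ck_diff (KK_smooth 0 _ _ _) Uu).
  - exact: (Ck_diff (h_smooth 0 _ _) Uu).
have D2 : \sum_m KK i j m u * pd l (fun w => h w m q) u =
    \sum_k (\sum_m KK i j m u * LC l m k u) * h u k q + \sum_m LC l q m u * Klow i j m u.
  under eq_bigr do rewrite LC_metric// mulrDr.
  rewrite big_split /=; congr (_ + _).
    under eq_bigr do rewrite mulr_sumr; rewrite exchange_big; apply: eq_bigr => p _.
    by rewrite mulr_suml; apply: eq_bigr => m _ /=; rewrite mulrA.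
  under eq_bigr do rewrite mulr_sumr; rewrite exchange_big; apply: eq_bigr => p _.
  by rewrite KlowE mulr_sumr; apply: eq_bigr => m _ /=; rewrite mulrCA.
have := Klow_parallel l i j q Uu; rewrite D D2.
have D3 (F : 'I_n -> R) (G : 'I_n -> 'I_n -> R) : \sum_m F m * (\sum_p G m p * h u p q) =
   \sum_k (\sum_m F m * G m k) * h u k q.
  under eq_bigr do rewrite mulr_sumr; rewrite exchange_big; apply: eq_bigr => p _.
  by rewrite mulr_suml; apply: eq_bigr => m _ /=; rewrite mulrA.
have D4 p : \sum_m LC l p m u * Klow m j q u = \sum_k (\sum_m LC l p m u * KK m j k u) * h u k q.
  by under eq_bigr do rewrite KlowE; rewrite D3.
have D5 p : \sum_m LC l p m u * Klow i m q u = \sum_k (\sum_m LC l p m u * KK i m k u) * h u k q.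
  by under eq_bigr do rewrite KlowE; rewrite D3.
rewrite D4 D5 => E.
have -> : \sum_k X k * h u k q =
    \sum_m pd l (KK i j m) u * h u m q
  + \sum_k (\sum_m KK i j m u * LC l m k u) * h u k q
  - \sum_k (\sum_m LC l j m u * KK i m k u) * h u k q
  - \sum_k (\sum_m LC l i m u * KK m j k u) * h u k q.
  rewrite -big_split -!sumrB; apply: eq_bigr => k' _ /=.
  by rewrite /X !mulrBl mulrDl.
have gen (a1 a2 a3 a4 a5 : R) : a1 + (a2 + a3) = a4 + a5 + a3 -> a1 + a2 - a5 - a4 = 0.
  by move=> e; rewrite -[a1 + a2](addrK a3) -[a1 + a2 + a3]addrA e; ring.
exact: gen E.
Qed.

(** The frame equation matrix splits into [Ahat], tensorial, and [Ghat], the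
    Levi-Civita connection on the tangent part, extended by 0 on f. *)
Definition Ahat i u : 'M[R]_(1 + n) :=
  blk (fun i j => radial i j u) (fun i j k => KK i j k u) 1 i.
Definition Ghat i u : 'M[R]_(1 + n) :=
  blk (fun _ _ => 0) (fun i j k => LC i j k u) 0 i.

Lemma AhatE i u : Ahat i u = blk (fun i j => radial i j u) (fun i j k => KK i j k u) 1 i.
Proof. by []. Qed.
Lemma GhatE i u : Ghat i u = blk (fun _ _ => 0) (fun i j k => LC i j k u) 0 i.
Proof. by []. Qed.

Lemma conn_split i u : conn i u = Ahat i u + Ghat i u.
Proof.
rewrite connE AhatE GhatE; apply: block_eqP => [|k|j|j k]; rewrite mxE !blkE.
- by rewrite addr0.
- by rewrite mul0r addr0.
- by rewrite addr0.
- by rewrite KKE subrK.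
Qed.

Lemma blk_smooth k c G e i :
  (forall i j, Ck k U (c i j)) -> (forall i j m, Ck k U (G i j m)) ->
  Cmx k U (fun u => blk (fun i j => c i j u) (fun i j k => G i j k u) e i).
Proof.
move=> Cc CG a b; case: (split_ordP a) => j ->; case: (split_ordP b) => m ->.
- by rewrite (ord1 j) (ord1 m); under eq_fun do rewrite blkE00; exact: Ck_const.
- by rewrite (ord1 j); under eq_fun do rewrite blkE0d; exact: Ck_const.
- by rewrite (ord1 m); under eq_fun do rewrite blkEd0; exact: Cc.
- by under eq_fun do rewrite blkEdd; exact: CG.
Qed.

Lemma Ahat_smooth k i : Cmx k U (Ahat i).
Proof. by apply: blk_smooth => *; [exact: radial_smooth|exact: KK_smooth]. Qed.

Lemma Ghat_smooth k i : Cmx k U (Ghat i).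
Proof. by apply: blk_smooth => *; [exact: Ck_const|exact: LC_smooth]. Qed.

Lemma dblk (c : 'I_n -> 'I_n -> 'rV[R]_n -> R) (G : 'I_n -> 'I_n -> 'I_n -> 'rV[R]_n -> R) e l i u :
  dmx l (fun w => blk (fun i j => c i j w) (fun i j k => G i j k w) e i) u =
  blk (fun i j => pd l (c i j) u) (fun i j k => pd l (G i j k) u) 0 i.
Proof.
apply: block_eqP => [|k|j|j k]; rewrite dmxE !blkE.
- by under eq_fun do rewrite blkE00; rewrite pd_const.
- by under eq_fun do rewrite blkE0d; rewrite pd_const mul0r.
- by under eq_fun do rewrite blkEd0.
- by under eq_fun do rewrite blkEdd.
Qed.

Lemma Ghat_flat i l u : U u ->
  dmx l (Ghat i) u + Ghat i u *m Ghat l u = dmx i (Ghat l) u + Ghat l u *m Ghat i u.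
Proof.
move=> Uu.
have E p q a b : (dmx q (Ghat p) u + Ghat p u *m Ghat q u) a b =
  blk (fun i j => pd q (fun _ => 0) u) (fun i j k => pd q (LC i j k) u) 0 p a b +
  (Ghat p u a (lshift n 0) * Ghat q u (lshift n 0) b +
   \sum_m Ghat p u a (rshift 1 m) * Ghat q u (rshift 1 m) b).
  by rewrite mxE blockM dblk.
have Z (x y : R) (F G : 'I_n -> R) : x * 0 + \sum_m F m * 0 = 0.
  by rewrite mulr0 add0r big1// => m _; rewrite mulr0.
apply: block_eqP => [|k|j|j k]; rewrite !E !GhatE !blkE.
- under eq_bigr do rewrite blkEd0.
  by under [in RHS]eq_bigr do rewrite blkEd0; rewrite !Z.
- under eq_bigr do rewrite blkE0d !mul0r.
  under [in RHS]eq_bigr do rewrite blkE0d !mul0r.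
  by rewrite !mul0r.
- under eq_bigr do rewrite blkEd0.
  under [in RHS]eq_bigr do rewrite blkEd0.
  by rewrite !Z // !pd_const.
- under eq_bigr do rewrite !blkEdd.
  under [in RHS]eq_bigr do rewrite !blkEdd.
  have : curvature LC l i j k u = 0 by rewrite /LC -lock flat.
  have gen (x y a b : R) : x - y + (a - b) = 0 -> x + a = y + b by lra.
  rewrite /curvature -!pdE sumrB !mul0r !add0r; exact: gen.
Qed.

Lemma pd_radial l i j u : U u -> pd l (radial i j) u = - eps * pd l (fun w => h w i j) u.
Proof.
move=> Uu; have -> : pd l (fun w => h w i j) u = - eps * pd l (radial i j) u.
  under eq_fun do rewrite hE.
  rewrite pd_mul; [|exact: diff_const|exact: (Ck_diff (radial_smooth 0 _ _) Uu)].
  by rewrite pd_const mul0r add0r.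
by case: eps1 => ->; ring.
Qed.

Lemma radial_h i j u : radial i j u = - eps * h u i j.
Proof. by rewrite hE; case: eps1 => ->; ring. Qed.

(** In the column of f this is the parallelism of h, in the tangent block that of
    K; the other entries are immediate. *)
Lemma Ahat_parallel i l u : U u ->
  dmx l (Ahat i) u + Ahat i u *m Ghat l u - Ghat l u *m Ahat i u =
  \sum_m LC l i m u *: Ahat m u.
Proof.
move=> Uu.
have E a b : (dmx l (Ahat i) u + Ahat i u *m Ghat l u - Ghat l u *m Ahat i u) a b =
  blk (fun i j => pd l (radial i j) u) (fun i j k => pd l (KK i j k) u) 0 i a b +
  (Ahat i u a (lshift n 0) * Ghat l u (lshift n 0) b +
   \sum_m Ahat i u a (rshift 1 m) * Ghat l u (rshift 1 m) b) -
  (Ghat l u a (lshift n 0) * Ahat i u (lshift n 0) b +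
   \sum_m Ghat l u a (rshift 1 m) * Ahat i u (rshift 1 m) b).
  by rewrite mxE [X in X + _]mxE blockM [X in _ + X]mxE blockM dblk.
have E2 a b : (\sum_m LC l i m u *: Ahat m u) a b = \sum_m LC l i m u * Ahat m u a b.
  by rewrite summxE; apply: eq_bigr => m _; rewrite mxE.
apply: block_eqP => [|k|j|j k]; rewrite E E2 !AhatE !GhatE !blkE.
- under [in RHS]eq_bigr do rewrite AhatE blkE00 mulr0.
  under [X in _ + (_ + X) - _]eq_bigr do rewrite blkEd0 mulr0.
  under [X in _ - (_ + X)]eq_bigr do rewrite blkE0d !mul0r.
  by rewrite !big1// !mul0r !addr0 subr0.
- under [in RHS]eq_bigr do rewrite AhatE blkE0d mul1r.
  under [X in _ + (_ + X) - _]eq_bigr do rewrite blkE0d blkEdd.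
  under [X in _ - (_ + X)]eq_bigr do rewrite blkE0d !mul0r.
  rewrite sum_kronecker [X in _ - (_ + X)]big1// !mul0r add0r mul1r !add0r subr0.
  rewrite (bigD1 k)//= eqxx mulr1 big1 ?addr0 => [|m mk]; last by rewrite eq_sym (negbTE mk) mulr0.
  by [].
- under [in RHS]eq_bigr do rewrite AhatE blkEd0.
  under [X in _ + (_ + X) - _]eq_bigr do rewrite blkEd0 mulr0.
  under [X in _ - (_ + X)]eq_bigr do rewrite blkEdd blkEd0.
  rewrite big1// mulr0 mul0r !addr0 add0r pd_radial// LC_metric//.
  under [X in _ - X]eq_bigr do rewrite radial_h mulrCA.
  under [RHS]eq_bigr do rewrite radial_h mulrCA.
  by rewrite -!mulr_sumr mulrDr addrK.
- under [in RHS]eq_bigr do rewrite AhatE blkEdd.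
  under [X in _ + (_ + X) - _]eq_bigr do rewrite !blkEdd.
  under [X in _ - (_ + X)]eq_bigr do rewrite !blkEdd.
  by rewrite !mul0r mulr0 !add0r KK_parallel.
Qed.

(** Expand [integrability] with conn = Ahat + Ghat: the Ghat terms cancel by
    flatness, the mixed terms by parallelism and symmetry of the Christoffel
    symbols, and only the commutator is left. *)
Lemma Ahat_comm i l u : U u -> Ahat i u *m Ahat l u = Ahat l u *m Ahat i u.
Proof.
move=> Uu; have := integrability i l Uu.
have dC p q : dmx p (conn q) u = dmx p (Ahat q) u + dmx p (Ghat q) u.
  apply/matrixP => a b; rewrite mxE !dmxE -pd_add; first last.
  - exact: (Ck_diff (Ghat_smooth 0 _ _ _) Uu).
  - exact: (Ck_diff (Ahat_smooth 0 _ _ _) Uu).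
  by congr (pd p _ u); apply/funext => w; rewrite conn_split mxE.
rewrite !dC !conn_split !mulmxDl !mulmxDr.
have := Ghat_flat i l Uu; have := Ahat_parallel i l Uu; have := Ahat_parallel l i Uu.
under eq_bigr do rewrite LC_sym//.
move=> <-.
move: (Ahat i u *m Ahat l u) (Ahat l u *m Ahat i u) (Ahat i u *m Ghat l u)
  (Ghat l u *m Ahat i u) (Ghat i u *m Ahat l u) (Ahat l u *m Ghat i u)
  (Ghat i u *m Ghat l u) (Ghat l u *m Ghat i u) (dmx _ _ _) (dmx _ _ _) (dmx _ _ _) (dmx _ _ _).
move=> x1 x2 x3 x4 x5 x6 x7 x8 x9 x10 x11 x12 E1 E2 E3.
apply/matrixP => a b.
have G : forall M N : 'M[R]_(1 + n), M = N -> M a b = N a b by move=> ? ? ->.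
have := G _ _ E1; have := G _ _ E2; have := G _ _ E3.
by rewrite !mxE; lra.
Qed.

(** The bilinear form for which f has square 1 and is orthogonal to the tangent
    space, written in the frame. *)
Definition gram u : 'M[R]_(1 + n) := block_mx 1 0 0 (- eps *: ca_metric eps f u).

Lemma Ahat_selfadjoint i u : U u -> (Ahat i u *m gram u)^T = Ahat i u *m gram u.
Proof.
move=> Uu; have -> : gram u = block_mx 1 0 0 (- eps *: h u) by rewrite /h -lock.
rewrite AhatE /blk -lock mulmx_block !mulmx0 !mul0mx !addr0 !add0r mulmx1 scale1r.
rewrite tr_block_mx trmx0; congr block_mx.
- by apply/matrixP => a b; rewrite -rowE !mxE radial_h.
- by apply/matrixP => a b; rewrite -rowE !mxE radial_h.
- apply/matrixP => a b; rewrite -!scalemxAr mxE mxE [RHS]mxE; congr (_ * _).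
  have E x y : (\matrix_(j, k) KK i j k u *m h u) x y = Klow i x y u.
    by rewrite mxE KlowE; apply: eq_bigr => m _; rewrite mxE.
  by rewrite !E Klow_sym23.
Qed.

(** [Ahat] in the fixed basis of R^(n+1) instead of the moving frame. *)
Definition ambient_op i u : 'M[R]_(1 + n) := locked (invmx (frame u) *m Ahat i u *m frame u).

Lemma ambient_opE i u : ambient_op i u = invmx (frame u) *m Ahat i u *m frame u.
Proof. by rewrite /ambient_op -lock. Qed.

Lemma Cmx_ext k p q (A B : 'rV[R]_n -> 'M[R]_(p, q)) :
  (forall u, A u = B u) -> Cmx k U A -> Cmx k U B.
Proof. by move=> AB CA a b; apply: (Ck_ext oU _ (CA a b)) => u _; rewrite AB. Qed.

Lemma invframe_smooth k : Cmx k U (fun u => invmx (frame u)).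
Proof. by apply: Cmx_inv => //; [exact: frame_smooth|exact: frame_unit]. Qed.

Lemma ambient_op_smooth k i : Cmx k U (ambient_op i).
Proof.
apply: (Cmx_ext (fun u => esym (ambient_opE i u))).
apply: Cmx_mul => //; last exact: frame_smooth.
by apply: Cmx_mul => //; [exact: invframe_smooth|exact: Ahat_smooth].
Qed.

Lemma dinvframe l u : U u ->
  dmx l (fun w => invmx (frame w)) u = - (invmx (frame u) *m conn l u).
Proof.
move=> Uu; apply: (can_inj (mulmxK (frame_unit Uu))).
rewrite mulNmx -mulmxA -dframe//; apply/eqP; rewrite -addr_eq0; apply/eqP.
apply: (etrans (esym (dmx_mul l (invframe_smooth 0) (frame_smooth 0) Uu))).
rewrite -(dmx_const l (1%:M : 'M[R]_(1 + n)) u).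
by apply: (dmx_near _ oU Uu) => w /set_mem Uw; rewrite mulVmx//; exact: frame_unit.
Qed.

(** The frame moves by conn = Ahat + Ghat; its Ahat part drops out because the Ahat
    commute, and the Ghat part is accounted for by parallelism. *)
Lemma ambient_op_derive i l u : U u -> dmx l (ambient_op i) u = \sum_m LC l i m u *: ambient_op m u.
Proof.
move=> Uu.
have -> : \sum_m LC l i m u *: ambient_op m u =
  invmx (frame u) *m (\sum_m LC l i m u *: Ahat m u) *m frame u.
  rewrite mulmx_sumr mulmx_suml; apply: eq_bigr => m _.
  by rewrite ambient_opE -scalemxAr -scalemxAl.
have -> : dmx l (ambient_op i) u = dmx l (fun w => invmx (frame w) *m Ahat i w *m frame w) u.
  by apply: (dmx_near _ oU Uu) => w _; rewrite ambient_opE.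
have CI := Cmx_mul oU (invframe_smooth 0) (Ahat_smooth 0 i).
apply: (etrans (dmx_mul l CI (frame_smooth 0) Uu)).
rewrite (dmx_mul l (invframe_smooth 0) (Ahat_smooth 0 i) Uu) dinvframe// dframe//.
rewrite -Ahat_parallel// conn_split.
have := Ahat_comm i l Uu.
move: (invmx (frame u)) (frame u) (dmx l (Ahat i) u) (Ahat i u) (Ahat l u) (Ghat l u).
move=> I F dA A B G AB.
rewrite [X in _ + X]mulmxA -mulmxDl; congr (_ *m _).
rewrite !(mulmxDr, mulmxBr, mulmxN) !mulmxA mulNmx !mulmxDl -[_ *m A *m B]mulmxA AB mulmxA opprD.
by apply/matrixP => a b; rewrite !mxE; ring.
Qed.

Lemma ambient_op_frame i u : U u -> (f u : 'rV[R]_(1 + n)) *m ambient_op i u = partial i f u.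
Proof.
move=> Uu.
have <- : delta_mx 0 (lshift n 0) *m frame u = f u :> 'rV[R]_(1 + n).
  by rewrite -rowE; apply/rowP => b; rewrite mxE frame_up.
rewrite ambient_opE !mulmxA mulmxK; last exact: frame_unit.
apply/rowP => b; rewrite mxE big_split_ord big_ord1.
have E c : ((delta_mx 0 (lshift n 0) : 'rV[R]_(1 + n)) *m Ahat i u) 0 c = Ahat i u (lshift n 0) c.
  by rewrite -rowE mxE.
under eq_bigr do rewrite E AhatE blkE0d.
rewrite E AhatE blkE00 mul0r /= add0r.
by rewrite sum_kronecker mul1r frame_down.
Qed.

End StructureEquations.

(** * Commuting families of self-adjoint matrices *)

Section CommonEigenpair.
Context {R : realType}.

(** Real and imaginary parts of a common complex eigenvector. *)
Lemma common_pair r (I : finType) (A : I -> 'M[R]_r) : (0 < r)%N ->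
  (forall i j, A i *m A j = A j *m A i) ->
  exists (a b : 'rV[R]_r) (al be : I -> R), (a != 0) || (b != 0) /\
    forall i, a *m A i = al i *: a - be i *: b /\ b *m A i = be i *: a + al i *: b.
Proof.
move=> r0 comm.
pose toC := @complex.real_complex R.
pose As := [seq map_mx toC (A i) | i <- enum I].
have [|v v0 /allP Hv] := @spectral.common_eigenvector _ r As r0.
  move=> _ _ /mapP[i _ ->] /mapP[j _ ->].
  by rewrite /comm_mx -!map_mxM comm.
have ex i : {mu | v *m map_mx toC (A i) = mu *: v}.
  apply: cid; apply/sub_rVP; apply: Hv; apply/mapP; exists i => //.
  by rewrite mem_enum.
pose mu i := sval (ex i).
have muP i : v *m map_mx toC (A i) = mu i *: v by rewrite /mu; case: (ex i).
exists (map_mx (@complex.Re R) v), (map_mx (@complex.Im R) v),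
  (fun i => complex.Re (mu i)), (fun i => complex.Im (mu i)); split.
  apply/negPn/negP; rewrite negb_or !negbK => /andP[/eqP a0 /eqP b0].
  move: v0 => /eqP; apply; apply/rowP => k; rewrite mxE.
  move/rowP/(_ k): a0; move/rowP/(_ k): b0; rewrite !mxE.
  by case: (v 0 k) => x y /= -> ->.
have E i k : (v *m map_mx toC (A i)) 0 k =
    complex.Complex (\sum_j complex.Re (v 0 j) * A i j k) (\sum_j complex.Im (v 0 j) * A i j k).
  rewrite mxE.
  elim/big_rec3: _ => // j x y z _ ->.
  by rewrite !mxE; case: (v 0 j) => p q /=; rewrite /toC /=; congr complex.Complex; simpc; ring.
have ERe i k : (map_mx (@complex.Re R) v *m A i) 0 k = \sum_j complex.Re (v 0 j) * A i j k.
  by rewrite mxE; apply: eq_bigr => j _; rewrite mxE.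
have EIm i k : (map_mx (@complex.Im R) v *m A i) 0 k = \sum_j complex.Im (v 0 j) * A i j k.
  by rewrite mxE; apply: eq_bigr => j _; rewrite mxE.
move=> i; split; apply/rowP => k; move/rowP/(_ k): (muP i); rewrite E ?ERe ?EIm !mxE.
  by case: (mu i) (v 0 k) => p q [x y] /= [-> _].
by case: (mu i) (v 0 k) => p q [x y] /= [_ ->]; rewrite addrC.
Qed.

(** [common_pair] for the restrictions to a basis of the stable subspace X. *)
Lemma common_pair_stable N m (X : 'M[R]_(m, N)) (I : finType) (A : I -> 'M[R]_N) : X != 0 ->
  (forall i, stablemx X (A i)) -> (forall i j, A i *m A j = A j *m A i) ->
  exists (a b : 'rV[R]_N) (al be : I -> R),
    [/\ (a <= X)%MS, (b <= X)%MS, (a != 0) || (b != 0) &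
    forall i, a *m A i = al i *: a - be i *: b /\ b *m A i = be i *: a + al i *: b].
Proof.
move=> X0 st comm; pose Z := row_base X; pose r := \rank X.
have r0 : (0 < r)%N by rewrite lt0n mxrank_eq0.
pose A' i := Z *m A i *m pinvmx Z.
have ZA i : A' i *m Z = Z *m A i.
  rewrite /A' mulmxKpV// eq_row_base; apply: submx_trans (st i).
  by apply: submxMr; rewrite eq_row_base.
have Zf : row_free Z by exact: row_base_free.
have [|a [b [al [be [ab H]]]]] := @common_pair r I A' r0.
  have E i j : A' i *m A' j *m Z = Z *m (A i *m A j) by rewrite -mulmxA (ZA j) (mulmxA (A' i)) (ZA i) mulmxA.
  by move=> i j; apply: (row_free_inj Zf); rewrite E comm -E.
exists (a *m Z), (b *m Z), al, be; split.
- by rewrite (submx_trans (submxMl _ _))// eq_row_base.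
- by rewrite (submx_trans (submxMl _ _))// eq_row_base.
- by rewrite !mulmx_free_eq0.
- move=> i; have [Ha Hb] := H i.
  have E (x : 'rV_r) : x *m Z *m A i = x *m A' i *m Z by rewrite -mulmxA -(ZA i) mulmxA.
  by rewrite !E Ha Hb mulmxBl mulmxDl -!scalemxAl.
Qed.

End CommonEigenpair.

Section BilinearForm.
Context {R : realType} {N : nat} (S : 'M[R]_N) (symS : S^T = S).
Implicit Types x y z : 'rV[R]_N.

Definition bf x y : R := (x *m S *m y^T) 0 0.

Lemma bfDl x y z : bf (x + y) z = bf x z + bf y z.
Proof. by rewrite /bf !mulmxDl mxE. Qed.
Lemma bfDr x y z : bf z (x + y) = bf z x + bf z y.
Proof. by rewrite /bf linearD mulmxDr mxE. Qed.
Lemma bfZl c x y : bf (c *: x) y = c * bf x y.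
Proof. by rewrite /bf -!scalemxAl mxE. Qed.
Lemma bfZr c x y : bf x (c *: y) = c * bf x y.
Proof. by rewrite /bf linearZ -scalemxAr mxE. Qed.
Lemma bfNl x y : bf (- x) y = - bf x y.
Proof. by rewrite -scaleN1r bfZl mulN1r. Qed.
Lemma bfNr x y : bf x (- y) = - bf x y.
Proof. by rewrite -scaleN1r bfZr mulN1r. Qed.
Lemma bfBl x y z : bf (x - y) z = bf x z - bf y z.
Proof. by rewrite bfDl bfNl. Qed.
Lemma bfBr x y z : bf z (x - y) = bf z x - bf z y.
Proof. by rewrite bfDr bfNr. Qed.
Lemma bf0l x : bf 0 x = 0.
Proof. by rewrite /bf !mul0mx mxE. Qed.
Lemma bf0r x : bf x 0 = 0.
Proof. by rewrite /bf trmx0 mulmx0 mxE. Qed.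
Lemma bf_suml I (r : seq I) (P : pred I) (F : I -> 'rV[R]_N) x :
  bf (\sum_(i <- r | P i) F i) x = \sum_(i <- r | P i) bf (F i) x.
Proof. by rewrite /bf !mulmx_suml summxE. Qed.
Lemma bf_sumr I (r : seq I) (P : pred I) (F : I -> 'rV[R]_N) x :
  bf x (\sum_(i <- r | P i) F i) = \sum_(i <- r | P i) bf x (F i).
Proof. by rewrite /bf linear_sum mulmx_sumr summxE. Qed.
Lemma bfC x y : bf x y = bf y x.
Proof.
by rewrite /bf -[x *m S *m y^T]trmxK mxE !trmx_mul trmxK symS mulmxA.
Qed.
Lemma bfA (A : 'M[R]_N) x y : (A *m S)^T = A *m S -> bf (x *m A) y = bf x (y *m A).
Proof.
move=> sA; rewrite /bf trmx_mul -!mulmxA; congr ((_ *m _) 0 0).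
by rewrite !mulmxA -sA trmx_mul symS.
Qed.

Lemma sub_orth m (E : 'M[R]_(m, N)) x : (x <= kermx (S *m E^T))%MS <->
  forall i, bf x (row i E) = 0.
Proof.
split=> [/sub_kermxP H i|H].
  by move/rowP/(_ i): H; rewrite mulmxA !mxE /bf => H; rewrite mxE -[RHS]H; apply: eq_bigr => k _; rewrite !mxE.
apply/sub_kermxP/rowP => i; rewrite mulmxA [RHS]mxE -[RHS](H i) /bf !mxE.
by apply: eq_bigr => k _; rewrite !mxE.
Qed.

Definition neg_orthonormal (d : nat) (D : nat -> 'rV[R]_N) : Prop :=
  forall i j, (i < d)%N -> (j < d)%N -> bf (D i) (D j) = - (i == j)%:R.

(** Families of vectors are indexed by nat throughout; this is how their length is
    identified with the dimension. *)
Lemma separating_free_size m (E : nat -> 'rV[R]_N) :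
  (forall c : nat -> R, \sum_(i < m) c i *: E i = 0 -> forall i, (i < m)%N -> c i = 0) ->
  (forall x, (forall i, (i < m)%N -> bf x (E i) = 0) -> x = 0) -> m = N.
Proof.
move=> free inj; pose M := \matrix_(i < m) E i.
apply/eqP; rewrite eqn_leq; apply/andP; split.
  have /eqP <- : row_free M; last exact: rank_leq_col.
  apply: inj_row_free => v vM; apply/rowP => i; rewrite mxE.
  pose c k := if insub k is Some k' then v 0 k' else 0.
  have cE (k : 'I_m) : c k = v 0 k by rewrite /c valK.
  rewrite -cE; apply: free => //; rewrite -[RHS]vM mulmx_sum_row.
  by apply: eq_bigr => k _; rewrite cE rowK.
have /eqP <- : row_free (S *m M^T); last exact: rank_leq_col.
apply: inj_row_free => v vM; apply: inj => i im.
have /sub_orth/(_ (Ordinal im)) : (v <= kermx (S *m M^T))%MS by apply/sub_kermxP.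
by rewrite rowK.
Qed.

Lemma neg_orthonormal_free d D (c : nat -> R) i : neg_orthonormal d D -> (i < d)%N ->
  bf (\sum_(j < d) c j *: D j) (D i) = - c i.
Proof.
move=> oD id; rewrite bf_suml (bigD1 (Ordinal id))//= big1 => [|j ji].
  by rewrite bfZl oD// eqxx addr0 mulrN1.
rewrite bfZl oD// (_ : (j == i :> nat) = false) ?oppr0 ?mulr0//.
by apply: contraNF ji => /eqP ji; apply/eqP/val_inj.
Qed.

Lemma neg_orthonormal_leq d D : neg_orthonormal d D -> (d <= N)%N.
Proof.
move=> oD; pose M := \matrix_(i < d) D i.
have /eqP <- : row_free M; last exact: rank_leq_col.
apply: inj_row_free => v vM; apply/rowP => i; rewrite mxE.
pose c k := if insub k is Some k' then v 0 k' else 0.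
have cE (k : 'I_d) : c k = v 0 k by rewrite /c valK.
have := neg_orthonormal_free c oD (ltn_ord i).
have -> : \sum_(j < d) c j *: D j = 0.
  rewrite -[RHS]vM mulmx_sum_row; apply: eq_bigr => k _; by rewrite cE rowK.
by rewrite bf0l cE => /eqP; rewrite eq_sym oppr_eq0 => /eqP.
Qed.

(** A family of maximal size exists because orthonormal vectors are independent. *)
Lemma max_neg_orthonormal (P : 'rV[R]_N -> Prop) : exists d D,
  [/\ neg_orthonormal d D, (forall i, (i < d)%N -> P (D i)) &
   forall e, P e -> (forall i, (i < d)%N -> bf e (D i) = 0) -> bf e e != -1].
Proof.
pose Q d := `[< exists D, neg_orthonormal d D /\ forall i, (i < d)%N -> P (D i) >].
have Q0 : exists d, Q d by exists 0%N; apply/asboolP; exists (fun=> 0); split.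
have Qb d : Q d -> (d <= N)%N by move=> /asboolP[D [oD _]]; exact: neg_orthonormal_leq oD.
have [d /asboolP[D [oD PD]] dmax] := ex_maxnP Q0 Qb.
exists d, D; split=> // e Pe eD; apply/negP => /eqP ee.
have : Q d.+1.
  apply/asboolP; exists (fun i => if (i < d)%N then D i else e); split; last first.
    by move=> i _; case: ifPn => [/PD//|_].
  move=> i j; rewrite !ltnS => id jd; have [i1|i1] := ltnP i d; have [j1|j1] := ltnP j d.
  - exact: oD.
  - by rewrite bfC eD// (ltn_eqF (leq_trans i1 j1)) oppr0.
  - by rewrite eD// eq_sym (ltn_eqF (leq_trans j1 i1)) oppr0.
  - have -> : i = j by apply/eqP; rewrite eqn_leq (leq_trans id j1) (leq_trans jd i1).
    by rewrite eqxx.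
by move/dmax; rewrite ltnn.
Qed.

Lemma scale_to_neg1 e : bf e e < 0 -> bf ((Num.sqrt (- bf e e))^-1 *: e) ((Num.sqrt (- bf e e))^-1 *: e) = -1.
Proof.
move=> e0; rewrite bfZl bfZr mulrA -expr2 exprVn sqr_sqrtr ?oppr_ge0 ?ltW//.
by rewrite invrN mulNr mulVf// lt_eqF.
Qed.

End BilinearForm.

Section SelfAdjointFamily.
Context {R : realType} {N : nat} (S : 'M[R]_N) (symS : S^T = S).
Context (I : finType) (A : I -> 'M[R]_N).
Context (comm : forall i j, A i *m A j = A j *m A i)
  (sadj : forall i, (A i *m S)^T = A i *m S).
Local Notation bf := (bf S).
Implicit Types x y e a b : 'rV[R]_N.

Definition eigen e := exists mu : I -> R, forall i, e *m A i = mu i *: e.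

Lemma eigenZ c e : eigen e -> eigen (c *: e).
Proof. by move=> [mu H]; exists mu => i; rewrite -scalemxAl H !scalerA mulrC. Qed.

Lemma bf_sadj i x y : bf (x *m A i) y = bf x (y *m A i).
Proof. exact: bfA. Qed.

Definition orthmx m (E : 'M[R]_(m, N)) : 'M[R]_N := kermx (S *m E^T).

Lemma orthmx_stable m (E : 'M[R]_(m, N)) i : stablemx E (A i) -> stablemx (orthmx E) (A i).
Proof.
move=> /submxP[P EP]; apply/sub_kermxP.
have -> : orthmx E *m A i *m (S *m E^T) = orthmx E *m (S *m (E *m A i)^T).
  have SA : S *m (A i)^T = A i *m S by rewrite -sadj trmx_mul symS.
  by rewrite trmx_mul (mulmxA S) SA !mulmxA.
rewrite EP trmx_mul !mulmxA -[orthmx E *m S *m E^T]mulmxA.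
by rewrite (sub_kermxP (submx_refl _)) mul0mx.
Qed.

(** Compare the two sides of <a A_i, b> = <a, b A_i>: they differ by
    be_i (<a, a> + <b, b>). *)
Lemma pair_isotropic a b (al be : I -> R) :
  (forall i, a *m A i = al i *: a - be i *: b /\ b *m A i = be i *: a + al i *: b) ->
  (exists i, be i != 0) -> bf a a + bf b b = 0.
Proof.
move=> H [i bi]; have [Ha Hb] := H i; have := bf_sadj i a b.
rewrite Ha Hb bfBl bfDr !bfZl !bfZr => E.
have : be i * (bf a a + bf b b) = 0 by rewrite mulrDr; lra.
by move/eqP; rewrite mulf_eq0 (negbTE bi) => /eqP.
Qed.

(** Maximality concerns eigenvectors only; as a stable subspace may have no real
    eigenvector, it is exploited through [negdef_stable_zero]. *)
Definition maximal_system d D := [/\ neg_orthonormal S d D, (forall i, (i < d)%N -> eigen (D i)) &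
   forall e, eigen e -> (forall i, (i < d)%N -> bf e (D i) = 0) -> 0 <= bf e e].

Lemma ex_maximal_system : exists d D, maximal_system d D.
Proof.
have [d [D [oD eD mD]]] := max_neg_orthonormal symS eigen.
exists d, D; split=> // e ee eo; rewrite leNgt; apply/negP => e0.
have := mD _ (eigenZ (Num.sqrt (- bf e e))^-1 ee).
rewrite scale_to_neg1// eqxx => H; apply/notF/H => i id.
by rewrite bfZl eo// mulr0.
Qed.

(** A nonzero stable negative definite subspace would contain a common eigenpair;
    it is real, since a genuinely complex one satisfies <a, a> + <b, b> = 0, and
    this real eigenvector would contradict maximality. *)
Lemma negdef_stable_zero d D m (X : 'M[R]_(m, N)) : maximal_system d D ->
  (forall i, stablemx X (A i)) ->
  (forall x, (x <= X)%MS -> forall i, (i < d)%N -> bf x (D i) = 0) ->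
  (forall x, (x <= X)%MS -> x != 0 -> bf x x < 0) -> X = 0.
Proof.
move=> [oD eD mD] st XD neg; apply/eqP/negPn/negP => X0.
have [a [b [al [be [aX bX ab H]]]]] := common_pair_stable X0 st comm.
have nz x : (x <= X)%MS -> bf x x <= 0.
  move=> xX; have [->|x0] := eqVneq x 0; first by rewrite bf0l.
  exact/ltW/neg.
have noeig x : (x <= X)%MS -> x != 0 -> eigen x -> False.
  move=> xX x0 ex; have := neg x xX x0; rewrite ltNge => /negP; apply.
  by apply: mD => //; exact: XD.
have [[i bi]|nb] := pselect (exists i, be i != 0).
  have E := pair_isotropic H (ex_intro _ i bi).
  have [a0|a0] := eqVneq a 0.
    by move: ab E; rewrite a0 eqxx /= bf0l add0r => b0 E; have := neg b bX b0; rewrite E ltxx.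
  by have := neg a aX a0; have := nz b bX; lra.
have {}nb i : be i = 0 by apply/eqP/negPn/negP => bi; apply: nb; exists i.
case/orP: ab => [a0|b0].
- by apply: (noeig a aX a0); exists al => i; rewrite (H i).1 nb scale0r subr0.
- by apply: (noeig b bX b0); exists al => i; rewrite (H i).2 nb scale0r add0r.
Qed.

Definition sysmx d (D : nat -> 'rV[R]_N) : 'M[R]_(d, N) := \matrix_(i < d) D i.

Lemma sysmx_stable d D i : (forall i, (i < d)%N -> eigen (D i)) -> stablemx (sysmx d D) (A i).
Proof.
move=> eD; apply/row_subP => k; rewrite row_mul rowK.
have [mu ->] := eD k (ltn_ord k); rewrite scalemx_sub//.
by have := row_sub k (sysmx d D); rewrite rowK.
Qed.

Lemma sub_orth_sys d D x : (x <= orthmx (sysmx d D))%MS <->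
  forall i, (i < d)%N -> bf x (D i) = 0.
Proof.
split=> [/sub_orth H i id|H]; first by have := H (Ordinal id); rewrite rowK.
by apply/sub_orth => i; rewrite rowK; exact: H.
Qed.

Lemma sub_orth_col m1 m2 (E1 : 'M[R]_(m1, N)) (E2 : 'M[R]_(m2, N)) x :
  (x <= orthmx (col_mx E1 E2))%MS <-> (x <= orthmx E1)%MS /\ (x <= orthmx E2)%MS.
Proof.
split=> [/sub_orth H|[/sub_orth H1 /sub_orth H2]].
  split; apply/sub_orth => i; first by have := H (lshift _ i); rewrite rowKu.
  by have := H (rshift _ i); rewrite rowKd.
apply/sub_orth => i; case: (split_ordP i) => k ->; by rewrite ?rowKu ?rowKd.
Qed.

Lemma sub_orth_row (e : 'rV[R]_N) x : (x <= orthmx e)%MS <-> bf x e = 0.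
Proof.
split=> [/sub_orth/(_ 0)|H]; first by rewrite row_id.
by apply/sub_orth => i; rewrite row_id.
Qed.

Lemma col_stable m1 m2 (E1 : 'M[R]_(m1, N)) (E2 : 'M[R]_(m2, N)) i :
  stablemx E1 (A i) -> stablemx E2 (A i) -> stablemx (col_mx E1 E2) (A i).
Proof.
move=> s1 s2; rewrite mul_col_mx col_mx_sub; apply/andP; split.
- by apply: (submx_trans s1); rewrite -addsmxE addsmxSl.
- by apply: (submx_trans s2); rewrite -addsmxE addsmxSr.
Qed.

Lemma eigen_stable e i : eigen e -> stablemx e (A i).
Proof. by move=> [mu ->]; rewrite scalemx_sub. Qed.

Lemma pair_stable a b (al be : I -> R) i :
  (forall i, a *m A i = al i *: a - be i *: b /\ b *m A i = be i *: a + al i *: b) ->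
  stablemx (col_mx a b) (A i).
Proof.
move=> H; have [Ha Hb] := H i.
rewrite mul_col_mx Ha Hb col_mx_sub.
have sa : (a <= col_mx a b)%MS by rewrite -addsmxE addsmxSl.
have sb : (b <= col_mx a b)%MS by rewrite -addsmxE addsmxSr.
by rewrite -scaleNr !addmx_sub ?scalemx_sub.
Qed.

(** The orthogonal complement of a maximal system is stable and negative
    definite, hence zero. *)
Lemma negdef_eigenbasis : (forall x, x != 0 -> bf x x < 0) ->
  exists D, neg_orthonormal S N D /\ (forall i, (i < N)%N -> eigen (D i)) /\
    forall x, (forall i, (i < N)%N -> bf x (D i) = 0) -> x = 0.
Proof.
move=> neg; have [d [D mD]] := ex_maximal_system; have [oD eD _] := mD.
have inj x : (forall i, (i < d)%N -> bf x (D i) = 0) -> x = 0.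
  move=> /sub_orth_sys xX; apply/eqP; rewrite -submx0.
  have <- : orthmx (sysmx d D) = 0; last by [].
  apply: (negdef_stable_zero mD) => [i|y yX i id|y _]; last exact: neg.
  - apply: orthmx_stable; exact: sysmx_stable.
  - by move/sub_orth_sys: yX; apply.
have dN : d = N.
  apply: (separating_free_size (E := D)) inj => c c0 i id.
  have := neg_orthonormal_free c oD id; rewrite c0 bf0l => /eqP.
  by rewrite eq_sym oppr_eq0 => /eqP.
by subst d; exists D.
Qed.

Section Lorentz.
Context (f : 'rV[R]_N) (ff : bf f f = 1) (neg : forall x, bf x f = 0 -> x != 0 -> bf x x < 0).

(** The reversed Cauchy-Schwarz inequality with its equality case.  The vector
    z = x - t y orthogonal to f has nonpositive square, and this square is
    <x, x> + t^2 <y, y> with both summands controlled. *)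
Lemma lorentz_orth_le0 x y : y != 0 -> 0 <= bf y y -> bf x y = 0 ->
  bf x x <= 0 /\ (bf x x = 0 -> exists t, x = t *: y).
Proof.
move=> y0 Qy xy.
have fy : bf y f != 0 by apply/negP => /eqP yf; have := neg yf y0; rewrite ltNge Qy.
pose t := bf x f / bf y f; pose z := x - t *: y.
have zf : bf z f = 0 by rewrite bfBl bfZl divfK// subrr.
have Qz : bf z z = bf x x + t ^+ 2 * bf y y.
  by rewrite /z bfBl !bfBr !bfZl !bfZr (bfC symS y x) xy; ring.
have ty : 0 <= t ^+ 2 * bf y y by rewrite mulr_ge0 ?sqr_ge0.
have Qz0 : bf z z <= 0.
  by have [->|z0] := eqVneq z 0; [rewrite bf0l|exact/ltW/neg].
split=> [|Qx]; first by rewrite Qz in Qz0; lra.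
exists t; apply/eqP; rewrite -subr_eq0 -/z; apply/negPn/negP => z0.
by have := neg zf z0; rewrite Qz Qx add0r ltNge ty.
Qed.

Lemma lorentz_orth_lt0 x y : 0 < bf y y -> bf x y = 0 -> x != 0 -> bf x x < 0.
Proof.
move=> Qy xy x0; have y0 : y != 0 by apply: contraTneq Qy => ->; rewrite bf0l ltxx.
have [H1 H2] := lorentz_orth_le0 y0 (ltW Qy) xy.
rewrite lt_neqAle H1 andbT; apply/eqP => Qx; have [t xt] := H2 Qx.
move: xy; rewrite xt bfZl => /eqP; rewrite mulf_eq0 (gt_eqF Qy) orbF => /eqP t0.
by move: x0; rewrite xt t0 scale0r eqxx.
Qed.

(** Let W be the complement of a maximal system and B = A_i - m_i.  The Fitting
    decomposition of B on W splits off a stable subspace W B^k that meets the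
    kernel of B^k trivially; it is orthogonal to w and does not contain it, so it
    is negative definite and vanishes.  Thus B is nilpotent on W.  For y in W
    orthogonal to w, if y B^(2l) is a multiple of w then y B^l is a null vector
    orthogonal to w, hence itself a multiple of w; descending to l = 1 gives the
    claim. *)
Lemma null_eigen_shift d D w (m : I -> R) : maximal_system d D ->
  (forall i, (i < d)%N -> bf w (D i) = 0) -> w != 0 -> bf w w = 0 ->
  (forall i, w *m A i = m i *: w) ->
  forall x, (forall i, (i < d)%N -> bf x (D i) = 0) -> bf x w = 0 ->
  exists ka : I -> R, forall i, x *m A i = m i *: x + ka i *: w.
Proof.
move=> mD wD w0 Qw wA x xD xw.
suff H i : exists k, x *m A i = m i *: x + k *: w.
  by have [ka Hka] := choice H; exists ka.
have [oD eD maxD] := mD.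
pose B := A i - (m i)%:M.
pose W := orthmx (sysmx d D).
have sW j : stablemx W (A j) by apply: orthmx_stable; exact: sysmx_stable.
have WP y : (y <= W)%MS <-> forall i, (i < d)%N -> bf y (D i) = 0 by exact: sub_orth_sys.
pose Bp k := iter k (mulmx B) 1%:M.
have yB y : y *m B = y *m A i - m i *: y by rewrite mulmxBr mul_mx_scalar.
have BpS k : Bp k.+1 = B *m Bp k by [].
have BpD k l : Bp (k + l)%N = Bp k *m Bp l.
  by elim: k => [|k IH]; [rewrite mul1mx|rewrite addSn !BpS IH mulmxA].
have BA j : A j *m B = B *m A j by rewrite mulmxBl mulmxBr comm scalar_mxC.
have BpA k j : Bp k *m A j = A j *m Bp k.
  elim: k => [|k IH]; first by rewrite mul1mx mulmx1.
  by rewrite BpS -mulmxA IH !mulmxA BA.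
have sB : (B *m S)^T = B *m S.
  by rewrite mulmxBl linearB /= sadj mul_scalar_mx linearZ /= symS.
have bfB y z : bf (y *m B) z = bf y (z *m B) by exact: bfA.
have bfBp k y z : bf (y *m Bp k) z = bf y (z *m Bp k).
  elim: k y z => [|k IH] y z; first by rewrite !mulmx1.
  rewrite BpS !mulmxA IH bfB -!mulmxA; congr (bf _ (_ *m _)).
  by elim: k {IH} => [|k IH]; [rewrite mulmx1 mul1mx|rewrite BpS -mulmxA IH].
have wB : w *m B = 0 by rewrite yB wA subrr.
have wBp k : (0 < k)%N -> w *m Bp k = 0 by case: k => // k _; rewrite BpS mulmxA wB mul0mx.
have WB y k : (y <= W)%MS -> (y *m Bp k <= W)%MS.
  elim: k y => [|k IH] y yW; first by rewrite mulmx1.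
  rewrite BpS mulmxA; apply: IH; rewrite yB -scaleNr addmx_sub ?scalemx_sub//.
  exact: submx_trans (submxMr _ yW) (sW i).
(* A positive k minimizing the rank of W B^k: there the rank is stationary. *)
have [k k0 rk] : exists2 k, (0 < k)%N & \rank (W *m Bp k) = \rank (W *m Bp (k + k)%N).
  pose Pp r := `[< exists2 k, (0 < k)%N & \rank (W *m Bp k) = r >].
  have Pex : exists r, Pp r by exists (\rank (W *m Bp 1)); apply/asboolP; exists 1%N.
  have [r /asboolP[k k0 kr] rmin] := ex_minnP Pex.
  exists k => //; apply/eqP; rewrite eqn_leq; apply/andP; split.
    by rewrite kr; apply: rmin; apply/asboolP; exists (k + k)%N => //; rewrite addn_gt0 k0.
  by rewrite BpD mulmxA mxrankM_maxl.
have capX : (W *m Bp k :&: kermx (Bp k))%MS = 0.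
  apply/eqP; rewrite -mxrank_eq0 -(eqn_add2l (\rank (W *m Bp k *m Bp k))) mxrank_mul_ker.
  by rewrite addn0 -mulmxA -BpD rk.
have nilk y : (y <= W)%MS -> y *m Bp k = 0.
  have X0 : W *m Bp k = 0.
    apply: (negdef_stable_zero mD).
    - move=> j; rewrite -mulmxA BpA mulmxA; exact: submxMr (sW j).
    - by move=> z /submxP[c ->]; apply/WP; rewrite mulmxA; apply: WB; exact: submxMl.
    - move=> z /submxP[c ->]; set y0 := c *m W => /=; rewrite mulmxA -/y0 => z0.
      have zw : bf (y0 *m Bp k) w = 0 by rewrite bfBp wBp// bf0r.
      have Qw0 : 0 <= bf w w by rewrite Qw.
      have [H1 H2] := lorentz_orth_le0 w0 Qw0 zw.
      rewrite lt_neqAle H1 andbT; apply/eqP => /H2[t yt].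
      move/eqP: z0; apply; apply/eqP; rewrite -submx0 -capX sub_capmx.
      have -> /= : (y0 *m Bp k <= W *m Bp k)%MS by rewrite /y0 -mulmxA submxMl.
      apply/sub_kermxP.
      by rewrite yt -scalemxAl wBp// scaler0.
  by move=> /submxP[c ->]; rewrite -mulmxA X0 mulmx0.
have down l : (0 < l)%N ->
    (forall y, (y <= W)%MS -> bf y w = 0 -> exists t, y *m Bp l.+1 = t *: w) ->
    forall y, (y <= W)%MS -> bf y w = 0 -> exists t, y *m Bp l = t *: w.
  move=> l0 H y yW yw.
  have Bw k' : bf (y *m Bp k') w = 0.
    by case: k' => [|k']; [rewrite mulmx1|rewrite bfBp wBp// bf0r].
  have Qw0 : 0 <= bf w w by rewrite Qw.
  have [_ H0] := lorentz_orth_le0 w0 Qw0 (Bw l); apply: H0.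
  rewrite bfBp -mulmxA -BpD; case: l l0 H => // l _ H.
  (* For l >= 1 the exponent 2 l is l - 1 plus l + 1, where the hypothesis applies. *)
  rewrite addSn -addnS BpD mulmxA.
  have [t ->] := H (y *m Bp l) (WB _ _ yW) (Bw l).
  by rewrite bfZr yw mulr0.
have {}down l : (exists2 l', (l <= l')%N & forall y, (y <= W)%MS -> bf y w = 0 ->
    exists t, y *m Bp l'.+1 = t *: w) -> forall y, (y <= W)%MS -> bf y w = 0 ->
    exists t, y *m Bp l.+1 = t *: w.
  move=> [l' ll' H]; move: H; rewrite -(subnK ll'); elim: (l' - l)%N => [//|q IH] H.
  by apply: IH; apply: down.
have [t Ht] : exists t, x *m Bp 1 = t *: w.
  apply: (down 0%N) => //; last by apply/WP.
  exists k => // y yW yw; exists 0.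
  have -> : Bp k.+1 = Bp k *m Bp 1%N by rewrite -BpD addn1.
  by rewrite mulmxA nilk// mul0mx scale0r.
by exists t; rewrite -Ht /Bp /= mulmx1 yB addrC subrK.
Qed.

End Lorentz.

End SelfAdjointFamily.

Lemma bf_oppS {R : realType} {N : nat} (S : 'M[R]_N) x y : bf (- S) x y = - bf S x y.
Proof. by rewrite /bf mulmxN mulNmx mxE. Qed.

Section NormalForms.
Context {R : realType} {N : nat} (S : 'M[R]_N) (I : finType) (A : I -> 'M[R]_N) (f : 'rV[R]_N).
Local Notation bf := (bf S).

(** As there are N of them, the forms <., E_i> are then linear coordinates. *)
Definition separating (E : nat -> 'rV[R]_N) : Prop :=
  forall x, (forall i, (i < N)%N -> bf x (E i) = 0) -> x = 0.

(** In the three normal forms E_i is an adapted basis, used through the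
    coordinates <., E_i>; the last clauses are the relations <f, f> = 1 and
    <f, f A_j> = 0 read in that basis, and they are what makes the potentials of
    the models constant. *)
Definition form_diag (E : nat -> 'rV[R]_N) (mu : nat -> I -> R) (lam : nat -> R) : Prop :=
  [/\ separating E,
      forall i, (i < N)%N -> bf f (E i) = 1 /\ forall j, E i *m A j = mu i j *: E i,
      forall j, \sum_(i < N) lam i * mu i j = 0 & \sum_(i < N) lam i = 1].

(** E_(d+1) + i E_d is a common complex eigenvector with eigenvalue
    al_j + i be_j. *)
Definition form_complex d (E : nat -> 'rV[R]_N) (mu : nat -> I -> R) (lam : nat -> R)
    (al be : I -> R) (p q : R) : Prop :=
  [/\ d.+2 = N, separating E,
      forall i, (i < d)%N -> [/\ bf f (E i) = 1, lam i < 0 & forall j, E i *m A j = mu i j *: E i],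
      [/\ bf f (E d) = 0, bf f (E d.+1) = 1 & forall j,
        E d.+1 *m A j = al j *: E d.+1 - be j *: E d /\
        E d *m A j = be j *: E d.+1 + al j *: E d] &
      (forall j, \sum_(i < d) lam i * mu i j + p * al j + q * be j = 0) /\
      \sum_(i < d) lam i + p = 1].

(** E_0 is a null eigenvector, E_1, ..., E_k are mapped to themselves up to E_0,
    E_(k+1), ..., E_(k+d) are eigenvectors, and E_(k+d+1) is dual to E_0. *)
Definition form_null k d (E : nat -> 'rV[R]_N) (mu : nat -> I -> R) (lam : nat -> R)
    (m : I -> R) (ka : nat -> I -> R) (rho : I -> R) : Prop :=
  [/\ (k + d).+2 = N /\ separating E,
      bf f (E 0%N) = 1 /\ forall j, E 0%N *m A j = m j *: E 0%N,
      forall i, (0 < i <= k)%N -> bf f (E i) = 0 /\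
        forall j, E i *m A j = m j *: E i + ka i j *: E 0%N,
      forall i, (k < i <= k + d)%N -> [/\ bf f (E i) = 1, lam i < 0 & forall j, E i *m A j = mu i j *: E i] &
      [/\ bf f (E (k + d).+1) = 0, forall j, E (k + d).+1 *m A j = m j *: E (k + d).+1
          - \sum_(1 <= i < k.+1) ka i j *: E i + rho j *: E 0%N &
      forall j, (1 - \sum_(k.+1 <= i < (k + d).+1) lam i) * m j + rho j
        + \sum_(k.+1 <= i < (k + d).+1) lam i * mu i j = 0]].

Context (symS : S^T = S)
  (comm : forall i j, A i *m A j = A j *m A i)
  (sadj : forall i, (A i *m S)^T = A i *m S)
  (fA : forall i, bf f (f *m A i) = 0)
  (nd : forall x, bf f x = 0 -> (forall i, bf (f *m A i) x = 0) -> x = 0).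

(** If f were orthogonal to e, so would be every f A_i, and these span. *)
Lemma eigen_transverse e mu : (forall i, e *m A i = mu i *: e) -> e != 0 -> bf f e != 0.
Proof.
move=> H; apply: contra => /eqP fe; apply/eqP/nd => // i.
by rewrite (bf_sadj symS sadj) H bfZr fe mulr0.
Qed.

Lemma projection_orth d D x j : neg_orthonormal S d D -> (j < d)%N ->
  bf (x + \sum_(i < d) bf x (D i) *: D i) (D j) = 0.
Proof.
by move=> oD jd; rewrite bfDl (neg_orthonormal_free (fun i => bf x (D i)) oD jd) subrr.
Qed.

(** Orthonormal eigenvectors rescaled so that f pairs to 1 with each; the
    exponents lam_i are the squares of the coordinates of f. *)
Lemma normal_form_definite : bf f f = 1 -> (forall x, x != 0 -> 0 < bf x x) ->
  exists E mu lam, form_diag E mu lam /\ forall i, (i < N)%N -> 0 < lam i.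
Proof.
move=> ff pos.
have symN : (- S)^T = - S by rewrite linearN /= symS.
have sadjN i : (A i *m - S)^T = A i *m - S by rewrite mulmxN linearN /= sadj.
have [|D [oD [eD inj]]] := negdef_eigenbasis symN comm sadjN.
  by move=> x x0; rewrite bf_oppS oppr_lt0 pos.
have oD' i j : (i < N)%N -> (j < N)%N -> bf (D i) (D j) = (i == j)%:R.
  by move=> iN jN; have := oD i j iN jN; rewrite bf_oppS => /oppr_inj.
have ex i : exists mu, (i < N)%N -> forall j, D i *m A j = mu j *: D i.
  have [iN|iN] := ltnP i N; last by exists (fun=> 0).
  by have [mu H] := eD i iN; exists mu.
have [mu Hmu] := choice ex.
pose c i := bf f (D i).
have fE : f = \sum_(i < N) c i *: D i.
  apply/eqP; rewrite -subr_eq0; apply/eqP/inj => j jN; rewrite bf_oppS bfBl bf_suml.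
  rewrite (bigD1 (Ordinal jN))//= bfZl oD'// eqxx mulr1 big1 ?addr0 ?subrr ?oppr0// => k kj.
  rewrite bfZl oD'// (_ : (k == j :> nat) = false) ?mulr0//.
  by apply: contraNF kj => /eqP kj; apply/eqP/val_inj.
have c0 i : (i < N)%N -> c i != 0.
  move=> iN; apply: (eigen_transverse (Hmu i iN)); apply/eqP => D0.
  by have := oD' i i iN iN; rewrite D0 bf0l eqxx => /eqP; rewrite eq_sym oner_eq0.
exists (fun i => (c i)^-1 *: D i), mu, (fun i => c i ^+ 2); split; last first.
  by move=> i iN; rewrite lt_neqAle eq_sym sqrf_eq0 c0// sqr_ge0.
split.
- move=> x Hx; apply: inj => i iN; rewrite bf_oppS; have := Hx i iN; rewrite bfZr => /eqP.
  by rewrite mulf_eq0 invr_eq0 (negbTE (c0 i iN)) => /eqP ->; rewrite oppr0.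
- move=> i iN; rewrite bfZr mulVf ?c0//; split=> // j.
  by rewrite -scalemxAl Hmu// !scalerA mulrC.
- move=> j; rewrite -[RHS](fA j) {2}fE mulmx_suml bf_sumr; apply: eq_bigr => i _.
  by rewrite -scalemxAl bfZr Hmu// bfZr -/(c i); ring.
- rewrite -[RHS]ff {2}fE bf_sumr; apply: eq_bigr => i _.
  by rewrite bfZr -/(c i) expr2.
Qed.

(** A dual family y forces E to be linearly independent. *)
Lemma dual_family_size m (E y : nat -> 'rV[R]_N) :
  (forall i, (i < m)%N -> bf (E i) (y i) != 0) ->
  (forall i j, (i < m)%N -> (j < m)%N -> j != i -> bf (E j) (y i) = 0) ->
  (forall x, (forall i, (i < m)%N -> bf x (E i) = 0) -> x = 0) -> m = N.
Proof.
move=> y1 y0 inj; apply: (separating_free_size (S := S) (E := E)) => // c c0 i im.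
have : bf (\sum_(j < m) c j *: E j) (y i) = 0 by rewrite c0 bf0l.
rewrite bf_suml (bigD1 (Ordinal im))//= big1 => [|j ji]; last first.
  by rewrite bfZl y0 ?mulr0.
by rewrite addr0 bfZl => /eqP; rewrite mulf_eq0 (negbTE (y1 i im)) orbF => /eqP.
Qed.

Context (ff : bf f f = 1) (neg : forall x, bf x f = 0 -> x != 0 -> bf x x < 0).

(** Split off a maximal system D of negative eigenvectors.  On its stable
    complement W take a common eigenpair: a genuinely complex one gives
    [form_complex], a real one of positive square [form_diag], and a real null
    one [form_null].  In the first two cases the pair spans a subspace containing
    a positive vector, so what is left of W is stable and negative definite,
    hence zero.  Throughout, fW is the projection of f to W, and the relations
    rel1 and rel2 express <f, f> = 1 and <f, f A_j> = 0 after splitting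
    f = fW - \sum_i c_i D_i; they become the last clauses of the normal forms. *)
Lemma normal_form_lorentz :
  (exists E mu lam, [/\ form_diag E mu lam, 0 < lam 0%N & forall i, (0 < i < N)%N -> lam i < 0]) \/
  (exists d E mu lam al be p q, form_complex d E mu lam al be p q) \/
  (exists k d E mu lam m ka rho, form_null k d E mu lam m ka rho).
Proof.
have [d [D mD]] := ex_maximal_system symS A; have [oD eD maxD] := mD.
have ex i : exists mu, (i < d)%N -> forall j, D i *m A j = mu j *: D i.
  have [iN|iN] := ltnP i d; last by exists (fun=> 0).
  by have [mu H] := eD i iN; exists mu.
have [mu Hmu] := choice ex.
pose c i := bf f (D i).
have D0 i : (i < d)%N -> D i != 0.
  move=> id; apply/eqP => D0; have := oD i i id id; rewrite D0 bf0l eqxx => /eqP.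
  by rewrite eq_sym oppr_eq0 oner_eq0.
have c0 i : (i < d)%N -> c i != 0 by move=> id; exact: (eigen_transverse (Hmu i id) (D0 i id)).
pose fW := f + \sum_(i < d) c i *: D i.
have fWD j : (j < d)%N -> bf fW (D j) = 0 by exact: projection_orth.
have fE : f = fW - \sum_(i < d) c i *: D i by rewrite /fW addrK.
have fDA j i : (i < d)%N -> bf f (D i *m A j) = c i * mu i j by move=> id; rewrite Hmu// bfZr mulrC.
pose lam i := - c i ^+ 2.
have lam0 i : (i < d)%N -> lam i < 0.
  by move=> id; rewrite oppr_lt0 lt_neqAle eq_sym sqrf_eq0 c0// sqr_ge0.
have rel1 : bf f fW + \sum_(i < d) lam i = 1.
  rewrite -[RHS]ff {3}fE bfBr bf_sumr -sumrN; congr (_ + _); apply: eq_bigr => i _.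
  by rewrite bfZr -/(c i) /lam expr2.
have rel2 j : bf f (fW *m A j) + \sum_(i < d) lam i * mu i j = 0.
  rewrite -[RHS](fA j) {3}fE mulmxBl bfBr mulmx_suml bf_sumr -sumrN; congr (_ + _).
  by apply: eq_bigr => i _; rewrite -scalemxAl bfZr fDA// /lam; ring.
pose W := orthmx S (sysmx d D).
have WP x : (x <= W)%MS <-> forall i, (i < d)%N -> bf x (D i) = 0 by exact: sub_orth_sys.
have sD j : stablemx (sysmx d D) (A j) by exact: sysmx_stable.
have fWW : (fW <= W)%MS by apply/WP.
have fWf : 1 <= bf f fW.
  by rewrite -rel1 gerDl sumr_le0// => i _; exact/ltW/lam0.
have W0 : W != 0.
  apply: contraTneq fWf => W0; move: fWW; rewrite W0 submx0 => /eqP ->.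
  by rewrite bf0r -ltNge ltr01.
have [a [b [al [be [aW bW ab H]]]]] :=
  common_pair_stable W0 (fun j => orthmx_stable symS sadj (sD j)) comm.
have {aW}aD := iffLR (WP a) aW; have {bW}bD := iffLR (WP b) bW.
have Esc i j : (i < d)%N -> ((c i)^-1 *: D i) *m A j = mu i j *: ((c i)^-1 *: D i).
  by move=> id; rewrite -scalemxAl Hmu// !scalerA mulrC.
have fEsc i : (i < d)%N -> bf f ((c i)^-1 *: D i) = 1.
  by move=> id; rewrite bfZr mulVf// c0.
have unsc x i : (i < d)%N -> bf x ((c i)^-1 *: D i) = 0 -> bf x (D i) = 0.
  move=> id /eqP; rewrite bfZr mulf_eq0 invr_eq0 (negbTE (c0 i id)) => /eqP; exact.
have [[i0 bi]|nb] := pselect (exists i, be i != 0).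
  right; left.
  pose s1 := bf f a; pose s2 := bf f b; pose D2 := s1 ^+ 2 + s2 ^+ 2.
  have D20 : D2 != 0.
    rewrite paddr_eq0 ?sqr_ge0// !sqrf_eq0; apply: contraL ab => /andP[/eqP z1 /eqP z2].
    rewrite negb_or !negbK; apply/andP; split; apply/eqP/nd => // i; have [Ha Hb] := H i.
      by rewrite (bf_sadj symS sadj) Ha bfBr !bfZr -/s1 -/s2 z1 z2 !mulr0 subrr.
    by rewrite (bf_sadj symS sadj) Hb bfDr !bfZr -/s1 -/s2 z1 z2 !mulr0 addr0.
  (* Multiply a + i b by the complex number conj (s1 + i s2) / |s1 + i s2|^2, so
     that f pairs to 1 with the new real part and to 0 with the new imaginary
     part. *)
  have [a' [b' [fa fb a'D b'D H']]] : exists a' b', [/\ bf f a' = 1, bf f b' = 0,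
      (forall i, (i < d)%N -> bf a' (D i) = 0), (forall i, (i < d)%N -> bf b' (D i) = 0) &
      forall i, a' *m A i = al i *: a' - be i *: b' /\ b' *m A i = be i *: a' + al i *: b'].
    exists (D2^-1 *: (s1 *: a + s2 *: b)), (D2^-1 *: (s1 *: b - s2 *: a)); split.
    - by rewrite bfZr bfDr !bfZr -/s1 -/s2 -!expr2 mulVf.
    - by rewrite bfZr bfBr !bfZr -/s1 -/s2 [s2 * _]mulrC subrr mulr0.
    - by move=> i id; rewrite bfZl bfDl !bfZl aD// bD// !mulr0 addr0 mulr0.
    - by move=> i id; rewrite bfZl bfBl !bfZl aD// bD// !mulr0 subr0 mulr0.
    - move=> i; have [Ha Hb] := H i.
      rewrite -!scalemxAl mulmxDl mulmxBl -!scalemxAl Ha Hb.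
      by split; apply/rowP => k; rewrite !mxE; ring.
  have iso := pair_isotropic symS sadj H' (ex_intro _ i0 bi).
  pose q := bf a' a'; pose s := bf a' b'.
  have Qb : bf b' b' = - q by rewrite /q; lra.
  have a0 : a' != 0 by apply: contra_eq_neq fa => ->; rewrite bf0r eq_sym oner_neq0.
  (* The Gram matrix of a', b' is [[q, s], [s, -q]]; a Lorentzian form has no
     totally null plane, so it is invertible. *)
  have gr0 : q ^+ 2 + s ^+ 2 != 0.
    rewrite paddr_eq0 ?sqr_ge0// !sqrf_eq0; apply/negP => /andP[/eqP q0 /eqP s0].
    have Qa0 : 0 <= bf a' a' by rewrite -/q q0.
    have ba : bf b' a' = 0 by rewrite (bfC symS).
    have [_ H0] := lorentz_orth_le0 symS neg a0 Qa0 ba.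
    have [|t bt] := H0; first by rewrite Qb q0 oppr0.
    have t0 : t = 0 by move: fb; rewrite bt bfZr fa mulr1.
    have [_ Hb] := H' i0; move: Hb; rewrite bt t0 scale0r mul0mx scaler0 addr0 => /esym/eqP.
    by rewrite scaler_eq0 (negbTE bi) (negbTE a0).
  (* This Gram matrix is traceless and invertible, hence indefinite. *)
  have [c1 [c2 ypos]] : exists c1 c2, 0 < bf (c1 *: a' + c2 *: b') (c1 *: a' + c2 *: b').
    have Qc c1 c2 : bf (c1 *: a' + c2 *: b') (c1 *: a' + c2 *: b') =
        q * (c1 ^+ 2 - c2 ^+ 2) + 2 * s * c1 * c2.
      by rewrite bfDl !bfDr !bfZl !bfZr Qb (bfC symS b') -/q -/s; ring.
    have [q0|q0|q0] := ltgtP q 0.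
    - exists 0, 1; rewrite Qc (_ : _ + _ = - q) ?oppr_gt0//; ring.
    - exists 1, 0; rewrite Qc (_ : _ + _ = q)//; ring.
    - exists 1, s; rewrite Qc q0 (_ : _ + _ = 2 * s ^+ 2); last by ring.
      rewrite mulr_gt0// lt_neqAle eq_sym sqr_ge0 andbT.
      by move: gr0; rewrite q0 expr0n add0r.
  have inj x : (forall i, (i < d)%N -> bf x (D i) = 0) -> bf x a' = 0 -> bf x b' = 0 -> x = 0.
    move=> xD xa xb; apply/eqP; rewrite -submx0.
    have <- : orthmx S (col_mx (sysmx d D) (col_mx a' b')) = 0.
      apply: (negdef_stable_zero symS comm sadj mD).
      - move=> i; apply: orthmx_stable => //; apply: col_stable => //.
        exact: pair_stable H'.
      - by move=> y /sub_orth_col[/WP].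
      - move=> y /sub_orth_col[_ /sub_orth_col[/sub_orth_row ya /sub_orth_row yb]] y0.
        apply: (lorentz_orth_lt0 symS neg ypos _ y0).
        by rewrite bfDr !bfZr ya yb !mulr0 addr0.
    apply/sub_orth_col; split; first by apply/WP.
    by apply/sub_orth_col; split; apply/sub_orth_row.
  pose E i := if (i < d)%N then (c i)^-1 *: D i else if i == d then b' else a'.
  have ED i : (i < d)%N -> E i = (c i)^-1 *: D i by rewrite /E => ->.
  have Eb : E d = b' by rewrite /E ltnn eqxx.
  have Ea : E d.+1 = a' by rewrite /E ltnNge leqnSn /= eqn_leq ltnn.
  have caseE i : (i < d.+2)%N -> [\/ (i < d)%N, i = d | i = d.+1].
    rewrite ltnS leq_eqVlt => /orP[/eqP ->|]; first by constructor 3.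
    by rewrite ltnS leq_eqVlt => /orP[/eqP ->|]; [constructor 2|constructor 1].
  have sep x : (forall i, (i < d.+2)%N -> bf x (E i) = 0) -> x = 0.
    move=> H0; apply: inj.
    - by move=> i id; apply: unsc => //; rewrite -ED//; apply: H0; rewrite ltnS ltnW// ltnW.
    - by rewrite -Ea; apply: H0.
    - by rewrite -Eb; apply: H0.
  clearbody s1 s2 D2.
  (* The family dual to E, from the inverse of the Gram matrix. *)
  pose y i := if (i < d)%N then D i else if i == d then s *: a' - q *: b' else q *: a' + s *: b'.
  have yD i : (i < d)%N -> y i = D i by rewrite /y => ->.
  have yb : y d = s *: a' - q *: b' by rewrite /y ltnn eqxx.
  have ya : y d.+1 = q *: a' + s *: b' by rewrite /y ltnNge leqnSn /= eqn_leq ltnn.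
  have bya : bf b' (y d.+1) = 0 by rewrite ya bfDr !bfZr Qb (bfC symS b') -/s; ring.
  have aya : bf a' (y d.+1) = q ^+ 2 + s ^+ 2 by rewrite ya bfDr !bfZr -/s -/q; ring.
  have byb : bf b' (y d) = q ^+ 2 + s ^+ 2 by rewrite yb bfBr !bfZr Qb (bfC symS b') -/s; ring.
  have ayb : bf a' (y d) = 0 by rewrite yb bfBr !bfZr -/s -/q; ring.
  have Dya i : (i < d)%N -> bf (D i) (y d.+1) = 0.
    by move=> id; rewrite ya bfDr !bfZr !(bfC symS (D i)) a'D// b'D// !mulr0 addr0.
  have Dyb i : (i < d)%N -> bf (D i) (y d) = 0.
    by move=> id; rewrite yb bfBr !bfZr !(bfC symS (D i)) a'D// b'D// !mulr0 subr0.
  have dN : d.+2 = N.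
    apply: (dual_family_size (E := E) (y := y)) => // [i|i j] /caseE[id|->|->].
    - by rewrite ED// yD// bfZl oD// eqxx mulf_neq0 ?invr_neq0 ?c0// oppr_eq0 oner_eq0.
    - by rewrite Eb byb.
    - by rewrite Ea aya.
    - rewrite yD// => /caseE[jd|->|->] ji.
      + by rewrite ED// bfZl oD// (negbTE ji) oppr0 mulr0.
      + by rewrite Eb b'D.
      + by rewrite Ea a'D.
    - move=> /caseE[jd|->|->] ji.
      + by rewrite ED// bfZl Dyb// mulr0.
      + by rewrite eqxx in ji.
      + by rewrite Ea.
    - move=> /caseE[jd|->|->] ji.
      + by rewrite ED// bfZl Dya// mulr0.
      + by rewrite Eb.
      + by rewrite eqxx in ji.
  pose p1 := q / (q ^+ 2 + s ^+ 2); pose p2 := s / (q ^+ 2 + s ^+ 2).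
  have fWx x : (forall i, (i < d)%N -> bf x (D i) = 0) -> bf fW x = bf f x.
    move=> xD; rewrite bfDl bf_suml big1 ?addr0// => i _.
    by rewrite bfZl (bfC symS) xD// mulr0.
  have fWE : fW = p1 *: a' + p2 *: b'.
    apply/eqP; rewrite -subr_eq0; apply/eqP/inj => [i id||].
    - by rewrite bfBl fWD// bfDl !bfZl a'D// b'D// !mulr0 addr0 subrr.
    - rewrite bfBl fWx// fa bfDl !bfZl (bfC symS b') -/q -/s /p1 /p2; field.
      exact: gr0.
    - rewrite bfBl fWx// fb bfDl !bfZl Qb -/s /p1 /p2; field.
      exact: gr0.
  exists d, E, mu, lam, al, be, p1, p2; split=> //.
  - by move=> x Hx; apply: sep => i id; apply: Hx; rewrite -dN.
  - by move=> i id; rewrite ED//; split; [exact: fEsc|exact: lam0|move=> j; exact: Esc].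
  - by rewrite Eb Ea; split.
  - split=> [j|]; last by rewrite -[RHS]rel1 fWE bfDr !bfZr fa fb mulr1 mulr0 addr0 addrC.
    have [Ha Hb] := H' j.
    rewrite -[RHS](rel2 j) fWE mulmxDl bfDr -!scalemxAl !bfZr Ha Hb bfBr bfDr !bfZr fa fb; ring.
have {}nb i : be i = 0 by apply/eqP/negPn/negP => bi; apply: nb; exists i.
have [e [e0 eW eA]] : exists e, [/\ e != 0, (forall i, (i < d)%N -> bf e (D i) = 0) &
    forall i, e *m A i = al i *: e].
  case/orP: ab => [a0|b0]; [exists a|exists b]; split=> // i; have [Ha Hb] := H i.
    by rewrite Ha nb scale0r subr0.
  by rewrite Hb nb scale0r add0r.
have Qe : 0 <= bf e e by apply: maxD => //; exists al.
move: Qe; rewrite le_eqVlt => /orP[/eqP Qe|Qe].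
  right; right.
  have fe : bf f e != 0 by exact: eigen_transverse eA e0.
  pose w := (bf f e)^-1 *: e.
  have fw : bf f w = 1 by rewrite bfZr mulVf.
  have wD i : (i < d)%N -> bf w (D i) = 0 by move=> id; rewrite bfZl eW// mulr0.
  have wA j : w *m A j = al j *: w by rewrite -scalemxAl eA !scalerA mulrC.
  have Qw : bf w w = 0 by rewrite bfZl bfZr -Qe !mulr0.
  have w0 : w != 0 by apply: contra_eq_neq fw => ->; rewrite bf0r eq_sym oner_neq0.
  pose r := bf f fW.
  have fWx x : (forall i, (i < d)%N -> bf x (D i) = 0) -> bf fW x = bf f x.
    move=> xD; rewrite bfDl bf_suml big1 ?addr0// => i _.
    by rewrite bfZl (bfC symS) xD// mulr0.
  have QfW : bf fW fW = r by rewrite fWx.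
  have fWw : bf fW w = 1 by rewrite fWx.
  (* A vector of W with <z, w> = 1 and <f, z> = 0; E_1, ..., E_k are chosen
     orthogonal to both. *)
  pose z := fW - r *: w.
  have zD i : (i < d)%N -> bf z (D i) = 0 by move=> id; rewrite bfBl fWD// bfZl wD// mulr0 subr0.
  have zw : bf z w = 1 by rewrite bfBl fWw bfZl Qw mulr0 subr0.
  have zfW : bf z fW = 0 by rewrite bfBl QfW bfZl (bfC symS w) fWw mulr1 subrr.
  have zE : fW = z + r *: w by rewrite subrK.
  have fz : bf f z = 0 by rewrite bfBr bfZr fw mulr1 subrr.
  have GzfW x : bf x w = 0 -> bf x z = 0 -> bf x fW = 0.
    by move=> xw xz; rewrite zE bfDr bfZr xw xz mulr0 addr0.
  clearbody z; clearbody w.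
  have [k [G [oG GP maxG]]] := max_neg_orthonormal symS
    (fun x => [/\ forall i, (i < d)%N -> bf x (D i) = 0, bf x w = 0 & bf x z = 0]).
  have GD i j : (i < k)%N -> (j < d)%N -> bf (G i) (D j) = 0 by move=> /GP[H0 _ _] /H0.
  have Gw i : (i < k)%N -> bf (G i) w = 0 by move=> /GP[].
  have Gz i : (i < k)%N -> bf (G i) z = 0 by move=> /GP[].
  have GfW i : (i < k)%N -> bf (G i) fW = 0.
    by move=> ik; apply: GzfW; [exact: Gw|exact: Gz].
  have fG i : (i < k)%N -> bf f (G i) = 0.
    move=> ik; rewrite -(fWx (G i) (fun l ld => GD i l ik ld)) (bfC symS); exact: GfW.
  have inj x : (forall i, (i < d)%N -> bf x (D i) = 0) -> bf x w = 0 -> bf x z = 0 ->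
      (forall i, (i < k)%N -> bf x (G i) = 0) -> x = 0.
    move=> xD xw xz xG; apply/eqP/negPn/negP => x0.
    have Qw0 : 0 <= bf w w by rewrite Qw.
    have [H1 H2] := lorentz_orth_le0 symS neg w0 Qw0 xw.
    have Qx : bf x x < 0.
      rewrite lt_neqAle H1 andbT; apply/eqP => /H2[t xt].
      by move: xz x0; rewrite xt bfZl (bfC symS) zw mulr1 => ->; rewrite scale0r eqxx.
    have := maxG ((Num.sqrt (- bf x x))^-1 *: x); rewrite scale_to_neg1// eqxx.
    move=> H0; apply/notF/H0 => [|i ik]; last by rewrite bfZl xG// mulr0.
    by split=> [i id||]; rewrite bfZl ?xD ?xw ?xz// mulr0.
  have exk i : exists ka : I -> R, (i < k)%N -> forall j, G i *m A j = al j *: G i + ka j *: w.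
    have [ik|ik] := ltnP i k; last by exists (fun=> 0).
    have [ka Hka] := null_eigen_shift symS comm sadj neg mD wD w0 Qw wA (fun j => GD i j ik) (Gw i ik).
    by exists ka.
  have [ka Hka] := choice exk.
  pose E i := if i is i'.+1 then
      if (i' < k)%N then G i' else if (i' < k + d)%N then (c (i' - k)%N)^-1 *: D (i' - k)%N else z
    else w.
  have EG i : (i < k)%N -> E i.+1 = G i by move=> ik; rewrite /= ik.
  have ED i : (i < d)%N -> E (k + i).+1 = (c i)^-1 *: D i.
    by move=> id; rewrite /= ltnNge leq_addr /= ltn_add2l id addKn.
  have Ez : E (k + d).+1 = z by rewrite /= ltnNge leq_addr /= ltnn.
  have caseE i : (i < (k + d).+2)%N -> [\/ i = 0%N, exists2 i', (i' < k)%N & i = i'.+1,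
      exists2 i', (i' < d)%N & i = (k + i').+1 | i = (k + d).+1].
    case: i => [|i]; first by constructor 1.
    rewrite !ltnS => ikd; have [ik|ik] := ltnP i k; first by constructor 2; exists i.
    have [ikd'|ikd'] := ltnP i (k + d).
      constructor 3; exists (i - k)%N; last by rewrite subnKC.
      by rewrite -(ltn_add2l k) subnKC.
    by constructor 4; congr _.+1; apply/eqP; rewrite eqn_leq ikd.
  have sep x : (forall i, (i < (k + d).+2)%N -> bf x (E i) = 0) -> x = 0.
    move=> H0; apply: inj.
    - move=> i id; apply: unsc => //; rewrite -ED//; apply: H0.
      by rewrite !ltnS ltnW// ltn_add2l.
    - exact: (H0 0%N).
    - by rewrite -Ez; apply: H0.
    - move=> i ik; rewrite -EG//; apply: H0.
      by rewrite !ltnS (leq_trans (ltnW ik))// leq_addr.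
  pose y i := if i is i'.+1 then if (i' < k + d)%N then E i else w else fW.
  have yG i : (i < k)%N -> y i.+1 = G i.
    by move=> ik; rewrite /y (leq_trans ik (leq_addr _ _)) EG.
  have yD i : (i < d)%N -> y (k + i).+1 = (c i)^-1 *: D i.
    by move=> id; rewrite /y ltn_add2l id ED.
  have yz : y (k + d).+1 = w by rewrite /y ltnn.
  have dN : (k + d).+2 = N.
    apply: (dual_family_size (E := E) (y := y)) => // [i|i j] /caseE[->|[i' ik ->]|[i' ik ->]|->].
    - by rewrite /= (bfC symS) fWw oner_eq0.
    - by rewrite EG// yG// oG// eqxx oppr_eq0 oner_eq0.
    - by rewrite ED// yD// bfZl bfZr oD// eqxx !mulf_neq0 ?invr_neq0 ?c0// oppr_eq0 oner_eq0.
    - by rewrite Ez yz zw oner_eq0.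
    - move=> /caseE[->|[j' jk ->]|[j' jk ->]|->] // _.
      + by rewrite EG// GfW.
      + by rewrite ED// bfZl (bfC symS) fWD// mulr0.
      + by rewrite Ez.
    - rewrite yG// => /caseE[->|[j' jk ->]|[j' jk ->]|->] ji.
      + by rewrite (bfC symS) Gw.
      + rewrite EG// oG// (_ : (j' == i') = false) ?oppr0//.
        by apply: contraNF ji => /eqP ->.
      + by rewrite ED// bfZl (bfC symS) GD// mulr0.
      + by rewrite Ez (bfC symS) Gz.
    - rewrite yD// bfZr => /caseE[->|[j' jk ->]|[j' jk ->]|->] ji.
      + by rewrite wD// mulr0.
      + by rewrite EG// GD// mulr0.
      + rewrite ED// bfZl oD// (_ : (j' == i') = false) ?oppr0 ?mulr0//.
        by apply: contraNF ji => /eqP ->.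
      + by rewrite Ez zD// mulr0.
    - rewrite yz => /caseE[->|[j' jk ->]|[j' jk ->]|->] ji.
      + by rewrite Qw.
      + by rewrite EG// Gw.
      + by rewrite ED// bfZl (bfC symS) wD// mulr0.
      + by rewrite eqxx in ji.
  have lam0' i : (k < i <= k + d)%N -> exists2 i', (i' < d)%N & i = (k + i').+1.
    case: i => // i; rewrite !ltnS => /andP[ki id]; exists (i - k)%N; last by rewrite subnKC.
    by rewrite -(ltn_add2l k) subnKC.
  pose lam' i := lam (i - k.+1)%N; pose mu' i := mu (i - k.+1)%N.
  pose ka' i := ka i.-1.
  have lamE (F : nat -> R) : \sum_(k.+1 <= i < (k + d).+1) F (i - k.+1)%N = \sum_(i < d) F i.
    rewrite -[k.+1]add0n big_addn subSS addKn big_mkord.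
    by apply: eq_bigr => i _; rewrite add0n addnK.
  (* z A_j is determined by its products with the basis; self-adjointness
     computes them from the images of the other vectors. *)
  pose rho j := bf (z *m A j) z - al j * bf z z.
  have zA j : z *m A j = al j *: z - \sum_(i < k) ka i j *: G i + rho j *: w.
    apply/eqP; rewrite -subr_eq0; apply/eqP.
    set Z := \sum_(i < k) _.
    have ZG x : (forall i, (i < k)%N -> bf x (G i) = 0) -> bf Z x = 0.
      by move=> xG; rewrite /Z bf_suml big1// => i _; rewrite bfZl (bfC symS) xG// mulr0.
    have bfz x : bf (z *m A j - (al j *: z - Z + rho j *: w)) x =
        bf z (x *m A j) - (al j * bf z x - bf Z x + rho j * bf w x).
      by rewrite bfBl (bf_sadj symS sadj) bfDl bfBl !bfZl.
    apply: inj => [i id|||i ik]; rewrite bfz.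
    - rewrite Hmu// bfZr zD// wD// ZG ?mulr0 ?subr0 ?addr0 ?subrr//.
      by move=> l lk; rewrite (bfC symS) GD.
    - rewrite wA bfZr zw Qw ZG ?mulr0 ?subr0 ?addr0 ?subrr//.
      by move=> l lk; rewrite (bfC symS) Gw.
    - rewrite (bfC symS w) zw ZG => [|l lk]; last by rewrite (bfC symS) Gz.
      by rewrite /rho (bf_sadj symS sadj); ring.
    - rewrite Hka// bfDr !bfZr zw (bfC symS z) Gz// (bfC symS w) Gw//.
      by rewrite (neg_orthonormal_free (fun i => ka i j) oG ik); ring.
  exists k, d, E, mu', lam', al, ka', rho; split.
  - split=> // x Hx; apply: sep => i id; apply: Hx; by rewrite -dN.
  - by split=> // j; exact: wA.
  - case=> // i /andP[_ ik]; rewrite EG//; split.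
      exact: fG.
    by move=> j; rewrite Hka.
  - move=> i /lam0'[i' id ->]; rewrite ED// /lam' /mu' subSS addKn.
    by split; [exact: fEsc|exact: lam0|move=> j; exact: Esc].
  - split.
    + by rewrite Ez.
    + move=> j; rewrite Ez zA big_add1 succnK big_mkord; congr (_ - _ + _).
      by apply: eq_bigr => i _; rewrite EG.
    + move=> j; rewrite (lamE lam) (lamE (fun i => lam i * mu i j)) -[RHS](rel2 j).
      congr (_ + _); rewrite -[in LHS]rel1 addrK -/r.
      rewrite zE mulmxDl bfDr -scalemxAl wA zA bfDr bfBr !bfZr fw bf_sumr big1 => [|i _].
        by rewrite fz; ring.
      by rewrite bfZr fG ?mulr0.
left.
have fe : bf f e != 0 by exact: eigen_transverse eA e0.
have inj x : (forall i, (i < d)%N -> bf x (D i) = 0) -> bf x e = 0 -> x = 0.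
  move=> xD xe; apply/eqP; rewrite -submx0.
  have <- : orthmx S (col_mx (sysmx d D) e) = 0.
    apply: (negdef_stable_zero symS comm sadj mD).
    - move=> i; apply: orthmx_stable => //; apply: col_stable => //.
      by apply: eigen_stable; exists al.
    - by move=> y /sub_orth_col[/WP].
    - move=> y /sub_orth_col[_ /sub_orth_row ye] y0.
      exact: (lorentz_orth_lt0 symS neg Qe ye y0).
  by apply/sub_orth_col; split; [apply/WP|apply/sub_orth_row].
pose E i := if i is i'.+1 then (c i')^-1 *: D i' else (bf f e)^-1 *: e.
have sep x : (forall i, (i < d.+1)%N -> bf x (E i) = 0) -> x = 0.
  move=> H0; apply: inj => [i id|]; first by apply: unsc => //; exact: (H0 i.+1).
  by have := H0 0%N isT; rewrite /= bfZr => /eqP; rewrite mulf_eq0 invr_eq0 (negbTE fe) => /eqP.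
have dN : d.+1 = N.
  apply: (dual_family_size (E := E) (y := fun i => if i is i'.+1 then D i' else e)) => //.
    case=> [|i] id /=; rewrite bfZl mulf_neq0 ?invr_neq0 ?c0//; first by rewrite gt_eqF.
    by rewrite oD// eqxx oppr_eq0 oner_eq0.
  case=> [|i] [|j] id jd //= ji; rewrite bfZl.
  - by rewrite bfC// eW// mulr0.
  - by rewrite eW// mulr0.
  - by rewrite oD// (_ : (j == i) = false) ?oppr0 ?mulr0//; apply/negbTE.
pose t := bf f e / bf e e.
have fWe : fW = t *: e.
  apply/eqP; rewrite -subr_eq0; apply/eqP/inj => [i id|].
    by rewrite bfBl fWD// bfZl eW// mulr0 subr0.
  have -> : bf (fW - t *: e) e = bf f e + bf (\sum_(i < d) c i *: D i) e - t * bf e e.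
    by rewrite bfBl bfZl /fW bfDl.
  rewrite bf_suml big1 => [|i _]; last by rewrite bfZl bfC// eW// mulr0.
  by rewrite addr0 /t divfK ?subrr// gt_eqF.
have SN (F : nat -> R) : \sum_(i < N) F i = \sum_(i < d.+1) F i by rewrite -dN.
have lN i : (i < N)%N = (i < d.+1)%N by rewrite -dN.
pose mu' i := if i is i'.+1 then mu i' else al.
pose lam' i := if i is i'.+1 then lam i' else t * bf f e.
exists E, mu', lam'; split.
- split.
  + by move=> x Hx; apply: sep => i id; apply: Hx; rewrite lN.
  + move=> i; rewrite lN; case: i => [|i] id /=; split; rewrite ?fEsc//; last by move=> j; exact: Esc.
      by rewrite bfZr mulVf.
    by move=> j; rewrite -scalemxAl eA !scalerA mulrC.
  + move=> j; rewrite (SN (fun i => lam' i * mu' i j)) big_ord_recl /= -[RHS](rel2 j); congr (_ + _).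
    by rewrite fWe -scalemxAl bfZr eA bfZr; ring.
  + by rewrite SN big_ord_recl /= -[RHS]rel1 fWe bfZr.
- by rewrite /= /t mulrAC -expr2 divr_gt0// lt_neqAle eq_sym sqrf_eq0 fe sqr_ge0.
- by case=> // i; rewrite lN ltnS /=; exact: lam0.
Qed.

End NormalForms.

(** * Gradients of explicit functions *)

Section Gradients.
Context {R : realType} {n : nat}.
Implicit Types (g h : 'rV[R]_n -> R) (u : 'rV[R]_n) (dg dh : 'I_n -> R).

Definition has_grad g u dg := differentiable g u /\ forall i, pd i g u = dg i.

Lemma has_grad_eq g u dg dg' : has_grad g u dg -> (forall i, dg i = dg' i) -> has_grad g u dg'.
Proof. by move=> [d H] E; split=> // i; rewrite H E. Qed.

Lemma has_grad_const (c : R) u : has_grad (fun=> c) u (fun=> 0).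
Proof. by split=> [|i]; [exact: diff_const|exact: pd_const]. Qed.

Lemma has_gradD g h u dg dh : has_grad g u dg -> has_grad h u dh ->
  has_grad (fun w => g w + h w) u (fun i => dg i + dh i).
Proof.
by move=> [d H] [d' H']; split=> [|i]; [exact: diff_add|rewrite pd_add// H H'].
Qed.

Lemma has_gradM g h u dg dh : has_grad g u dg -> has_grad h u dh ->
  has_grad (fun w => g w * h w) u (fun i => dg i * h u + g u * dh i).
Proof.
by move=> [d H] [d' H']; split=> [|i]; [exact: diff_mul|rewrite pd_mul// H H'].
Qed.

Lemma has_gradZ (c : R) g u dg : has_grad g u dg ->
  has_grad (fun w => c * g w) u (fun i => c * dg i).
Proof.
by move=> Hg; apply: (has_grad_eq (has_gradM (has_grad_const c u) Hg)) => i; rewrite mul0r add0r.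
Qed.

Lemma has_gradB g h u dg dh : has_grad g u dg -> has_grad h u dh ->
  has_grad (fun w => g w - h w) u (fun i => dg i - dh i).
Proof.
by move=> [d H] [d' H']; split=> [|i]; [exact: diff_sub|rewrite pd_sub// H H'].
Qed.

Lemma has_gradV g u dg : g u != 0 -> has_grad g u dg ->
  has_grad (fun w => (g w)^-1) u (fun i => - (g u)^-1 * (g u)^-1 * dg i).
Proof.
by move=> g0 [d H]; split=> [|i]; [exact: diff_inv|rewrite pd_inv// H].
Qed.

Lemma has_grad_sum (I : eqType) (r : seq I) (F : I -> 'rV[R]_n -> R) u (dF : I -> 'I_n -> R) :
  (forall k, k \in r -> has_grad (F k) u (dF k)) ->
  has_grad (fun w => \sum_(k <- r) F k w) u (fun i => \sum_(k <- r) dF k i).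
Proof.
elim: r => [_|k r IH H].
  under eq_fun do rewrite big_nil.
  by apply: (has_grad_eq (has_grad_const 0 u)) => i; rewrite big_nil.
under eq_fun do rewrite big_cons.
have Hr : forall k, k \in r -> has_grad (F k) u (dF k).
  by move=> k' k'r; apply: H; rewrite inE k'r orbT.
apply: (has_grad_eq (has_gradD (H k (mem_head _ _)) (IH Hr))) => i.
by rewrite big_cons.
Qed.

Lemma has_grad_comp (F : R -> R) (D : R) g u dg : is_derive (g u) 1 F D ->
  has_grad g u dg -> has_grad (fun w => F (g w)) u (fun i => D * dg i).
Proof.
move=> [dF DF] [d H].
have dFd : differentiable F (g u) by apply/derivable1_diffP.
split=> [|i]; first exact: (differentiable_comp d dFd).
rewrite -H !pdE /partial deriveE; last exact: (differentiable_comp d dFd).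
rewrite (diff_comp d dFd) /= (deriveE _ d) deriv1E// -DF derive1E.
by rewrite /GRing.scale /= mulrC.
Qed.

Lemma has_grad_ln g u dg : 0 < g u -> has_grad g u dg ->
  has_grad (fun w => ln (g w)) u (fun i => (g u)^-1 * dg i).
Proof. by move=> g0; apply: has_grad_comp; exact: is_derive1_ln. Qed.

Lemma has_grad_atan g u dg : has_grad g u dg ->
  has_grad (fun w => atan (g w)) u (fun i => (1 + g u ^+ 2)^-1 * dg i).
Proof. by apply: has_grad_comp; exact: is_derive1_atan. Qed.

(** The gradient of the argument of g + i h, in the chart where g is nonzero. *)
Lemma has_grad_angle g h u dg dh : g u != 0 -> has_grad g u dg -> has_grad h u dh ->
  has_grad (fun w => atan (h w / g w)) u
    (fun i => (g u ^+ 2 + h u ^+ 2)^-1 * (dh i * g u - h u * dg i)).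
Proof.
move=> g0 Hg Hh.
apply: (has_grad_eq (has_grad_atan (has_gradM Hh (has_gradV g0 Hg)))) => i.
have gh : g u ^+ 2 + h u ^+ 2 != 0.
  by rewrite paddr_eq0 ?sqr_ge0// !sqrf_eq0 (negbTE g0).
have gh' : 1 + (h u / g u) ^+ 2 != 0 by rewrite gt_eqF// ltr_pwDl// sqr_ge0.
by field; rewrite g0 gh.
Qed.

End Gradients.

Section Coordinates.
Context {R : realType} {n : nat}.

(** Right multiplication by it sends z to the row of the <z, E_c>, see
    [coord0_coordmx]. *)
Definition coordmx (S : 'M[R]_n.+1) (E : nat -> 'rV[R]_n.+1) : 'M[R]_n.+1 :=
  \matrix_(r, c) (S *m (E c)^T) r 0.

Definition coord0 (y : 'rV[R]_n.+1) (i : nat) : R := y 0 (inord i).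

Lemma coord1E y i : coord1 y i.+1 = coord0 y i.
Proof. by []. Qed.

Lemma coord0_coordmx S E z i : (i < n.+1)%N -> coord0 (z *m coordmx S E) i = bf S z (E i).
Proof.
move=> i_n; rewrite /coord0 mxE /bf -mulmxA mxE; apply: eq_bigr => k _.
by rewrite mxE inordK.
Qed.

Lemma coord0_inj y z : (forall i, (i < n.+1)%N -> coord0 y i = coord0 z i) -> y = z.
Proof. by move=> H; apply/rowP => k; have := H k (ltn_ord k); rewrite /coord0 inord_val. Qed.

Lemma coordmx_unit S E : separating S E -> coordmx S E \in unitmx.
Proof.
move=> sep; rewrite -row_free_unit; apply: inj_row_free => v vB; apply: sep => i i_n.
by rewrite -(coord0_coordmx S E)// vB /coord0 mxE.
Qed.

Lemma bf1_delta z i : (i < n.+1)%N -> bf 1%:M z (delta_mx 0 (inord i)) = coord0 z i.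
Proof. by move=> i_n; rewrite /bf mulmx1 trmx_delta -colE mxE. Qed.

Lemma has_grad_coord0 i (y : 'rV[R]_n.+1) : has_grad (coord0 ^~ i) y (fun j => (delta_mx 0 j : 'rV[R]_n.+1) 0 (inord i)).
Proof.
have d : differentiable (coord0 ^~ i) y by exact: differentiable_coord.
split=> // j; rewrite pdE /partial /derive.
rewrite (_ : (fun h => _) = (fun h : R => h^-1 * h * (delta_mx 0 j : 'rV[R]_n.+1) 0 (inord i))); last first.
  by apply/funext => h; rewrite /coord0 /= !mxE addrK /GRing.scale /= mulrA.
apply: cvg_lim => //; apply: cvg_near_cst; near=> h; rewrite mulVf ?mul1r//.
by near: h; exact: nbhs_dnbhs_neq.
Unshelve. all: by end_near. Qed.

End Coordinates.

(** * The model hypersurfaces *)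

Section Logarithms.
Context {R : realType}.

Lemma prod_powR (r : seq nat) (P : pred nat) (x al : nat -> R) : (forall i, i \in r -> P i -> 0 < x i) ->
  \prod_(i <- r | P i) x i `^ al i = expR (\sum_(i <- r | P i) al i * ln (x i)).
Proof.
move=> x0; rewrite expR_sum big_seq_cond [RHS]big_seq_cond.
by apply: eq_bigr => i /andP[ir Pi]; rewrite /powR gt_eqF// x0.
Qed.

Lemma expR_eq1 (x : R) : (expR x == 1) = (x == 0).
Proof. by rewrite -{1}expR0; apply/eqP/eqP => [/expR_inj|->]. Qed.

Lemma lnMp (x y : R) : 0 < x -> 0 < y -> ln (x * y) = ln x + ln y.
Proof. by move=> x0 y0; rewrite lnM// qualifE. Qed.

Lemma ln_divp (x y : R) : 0 < x -> 0 < y -> ln (x / y) = ln x - ln y.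
Proof. by move=> x0 y0; rewrite ln_div// qualifE. Qed.

End Logarithms.

Section Models.
Context {R : realType} {n : nat}.
Implicit Types (H Dom : set 'rV[R]_n.+1) (y z : 'rV[R]_n.+1) (alpha : nat -> R).

(** What turns the inclusion of a hypersurface in a model into equality inside
    a cone. *)
Definition radially_unique H := forall y r, 0 < r -> H y -> H (r *: y) -> r = 1.

(** [Dom] selects a part of H any two points of which are exchanged by a local
    linear symmetry of H; it is a half space for the second model, whose equation uses a
    branch of the angle. *)
Definition locally_homogeneous H Dom := forall y y', Dom y -> Dom y' -> H y -> H y' ->
  exists G : 'M[R]_n.+1, [/\ G \in unitmx, y *m G = y' & \forall z \near y, H z -> H (z *m G)].

Definition set_i alpha : set 'rV[R]_n.+1 :=
  [set y | (forall i, (1 <= i <= n.+1)%N -> 0 < coord1 y i) /\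
           \prod_(1 <= i < n.+2) coord1 y i `^ alpha i = 1].

Definition set_ii alpha : set 'rV[R]_n.+1 :=
  [set y | [/\ (forall i, (1 <= i <= n.-1)%N -> 0 < coord1 y i),
              coord1 y n.+1 != 0
            & (\prod_(1 <= i < n) coord1 y i `^ alpha i)
              * (coord1 y n ^+ 2 + coord1 y n.+1 ^+ 2) `^ alpha n
              * expR (alpha n.+1 * atan (coord1 y n / coord1 y n.+1)) = 1]].

Definition set_iii v alpha : set 'rV[R]_n.+1 :=
  [set y | [/\ 0 < coord1 y 1%N,
              (forall i, (v <= i <= n)%N -> 0 < coord1 y i)
            & coord1 y n.+1 =
                1 / (2 * coord1 y 1%N) * (\sum_(2 <= i < v) coord1 y i ^+ 2)
                - coord1 y 1%N * (- ln (coord1 y 1%N)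
                    + \sum_(v <= i < n.+1) alpha i * ln (coord1 y i))]].

Lemma set_iP alpha y : set_i alpha y <->
  (forall i, (1 <= i <= n.+1)%N -> 0 < coord1 y i) /\
  \sum_(1 <= i < n.+2) alpha i * ln (coord1 y i) = 0.
Proof.
have E : (forall i, (1 <= i <= n.+1)%N -> 0 < coord1 y i) ->
    \prod_(1 <= i < n.+2) coord1 y i `^ alpha i =
    expR (\sum_(1 <= i < n.+2) alpha i * ln (coord1 y i)).
  by move=> pos; apply: prod_powR => i; rewrite mem_index_iota ltnS => /pos.
split=> [[pos]|[pos E0]].
  by rewrite E// => /eqP; rewrite expR_eq1 => /eqP.
by rewrite /set_i /= E// E0 expR0.
Qed.

Lemma coord1Z r y i : coord1 (r *: y) i = r * coord1 y i.
Proof. by rewrite /coord1 mxE. Qed.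

Lemma set_i_radial alpha : \sum_(1 <= i < n.+2) alpha i != 0 -> radially_unique (set_i alpha).
Proof.
move=> al0 y r r0 /set_iP[pos E] /set_iP[_ E'].
have : ln r * \sum_(1 <= i < n.+2) alpha i = 0.
  have D0 : \sum_(1 <= i < n.+2) alpha i * ln (coord1 (r *: y) i) -
    \sum_(1 <= i < n.+2) alpha i * ln (coord1 y i) = 0 by rewrite E E' subrr.
  rewrite -[RHS]D0 mulr_sumr -sumrB; apply: eq_big_nat => i /andP[i1]; rewrite ltnS => i2.
  by rewrite coord1Z lnMp ?pos ?i1//; ring.
by move/eqP; rewrite mulf_eq0 (negbTE al0) orbF ln_eq0// => /eqP.
Qed.

Definition scale_coord (t : nat -> R) i : 'rV[R]_n.+1 := t i *: delta_mx 0 (inord i).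

Lemma coord1_mulcoordmx E z i : (1 <= i <= n.+1)%N ->
  coord1 (z *m coordmx 1%:M E) i = bf 1%:M z (E i.-1).
Proof. by case: i => // i /andP[_]; rewrite ltnS => i_n; rewrite coord1E coord0_coordmx. Qed.

Lemma coord1_delta z i : (1 <= i <= n.+1)%N -> bf 1%:M z (delta_mx 0 (inord i.-1)) = coord1 z i.
Proof. by case: i => // i /andP[_]; rewrite ltnS => i_n; rewrite bf1_delta. Qed.

Lemma coord1_inj y z : (forall i, (1 <= i <= n.+1)%N -> coord1 y i = coord1 z i) -> y = z.
Proof. by move=> E; apply: coord0_inj => i i_n; rewrite -!coord1E E. Qed.

Lemma coordmx_unit1 (E : nat -> 'rV[R]_n.+1) :
  (forall x, (forall i, (1 <= i <= n.+1)%N -> bf 1%:M x (E i.-1) = 0) ->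
     forall i, (1 <= i <= n.+1)%N -> coord1 x i = 0) -> coordmx 1%:M E \in unitmx.
Proof.
move=> inj; apply: coordmx_unit => x Hx; apply: coord1_inj => i i_n.
rewrite [RHS]mxE; apply: inj => // j /andP[j0 j_n]; apply: Hx.
by rewrite prednK.
Qed.

(** Diagonal matrices act simply transitively on the positive orthant, and
    those connecting two points of the model preserve its equation. *)
Lemma set_i_homogeneous alpha : locally_homogeneous (set_i alpha) setT.
Proof.
move=> y y' _ _ /set_iP[pos E] /set_iP[pos' E'].
pose t i := coord1 y' i.+1 / coord1 y i.+1.
have t0 i : (1 <= i <= n.+1)%N -> 0 < t i.-1.
  by case: i => // i i_n; rewrite /t /= divr_gt0 ?pos ?pos'.
pose G := coordmx 1%:M (scale_coord t).
have GE z i : (1 <= i <= n.+1)%N -> coord1 (z *m G) i = t i.-1 * coord1 z i.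
  by move=> i_n; rewrite coord1_mulcoordmx// /scale_coord bfZr coord1_delta.
exists G; split.
- apply: coordmx_unit1 => x Hx i i_n; have := Hx i i_n.
  rewrite /scale_coord bfZr coord1_delta// => /eqP.
  by rewrite mulf_eq0 gt_eqF ?t0//= => /eqP.
- apply: coord1_inj => i i_n; rewrite GE//; case: i i_n => // i i_n.
  by rewrite /t /= divfK// gt_eqF// pos.
- near=> z => /set_iP[posz Ez]; apply/set_iP; split=> [i i_n|].
    by rewrite GE// mulr_gt0 ?posz ?t0.
  have D0 : \sum_(1 <= i < n.+2) alpha i * ln (coord1 z i) +
    (\sum_(1 <= i < n.+2) alpha i * ln (coord1 y' i) -
     \sum_(1 <= i < n.+2) alpha i * ln (coord1 y i)) = 0 by rewrite E E' Ez subrr addr0.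
  rewrite -[RHS]D0 -sumrB -big_split /=; apply: eq_big_nat => i /andP[i1]; rewrite ltnS => i2.
  have i_n : (1 <= i <= n.+1)%N by rewrite i1.
  rewrite GE// lnMp ?posz ?t0//; case: i i_n {i1 i2} => // i i_n.
  rewrite /t /= (ln_divp (pos' _ i_n) (pos _ i_n)); ring.
Unshelve. all: by end_near. Qed.

Section ModelII.
Context (alpha : nat -> R) (n0 : (0 < n)%N).

Let logii y := \sum_(1 <= i < n) alpha i * ln (coord1 y i)
    + alpha n * ln (coord1 y n ^+ 2 + coord1 y n.+1 ^+ 2)
    + alpha n.+1 * atan (coord1 y n / coord1 y n.+1).

Let leq_predn i : (i <= n.-1)%N = (i < n)%N.
Proof. by rewrite -[in RHS](prednK n0) ltnS. Qed.

Lemma set_iiP y : set_ii alpha y <->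
  [/\ (forall i, (1 <= i <= n.-1)%N -> 0 < coord1 y i), coord1 y n.+1 != 0 & logii y = 0].
Proof.
have E : (forall i, (1 <= i <= n.-1)%N -> 0 < coord1 y i) -> coord1 y n.+1 != 0 ->
    (\prod_(1 <= i < n) coord1 y i `^ alpha i)
              * (coord1 y n ^+ 2 + coord1 y n.+1 ^+ 2) `^ alpha n
              * expR (alpha n.+1 * atan (coord1 y n / coord1 y n.+1)) = expR (logii y).
  move=> pos y0; rewrite prod_powR => [|i]; last first.
    by rewrite mem_index_iota => i_n _; apply: pos; rewrite leq_predn.
  rewrite /powR gt_eqF; last by rewrite ltr_wpDl ?sqr_ge0// lt_neqAle eq_sym sqrf_eq0 y0 sqr_ge0.
  by rewrite /logii !expRD.
split=> [[pos y0]|[pos y0 L0]].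
  by rewrite E// => /eqP; rewrite expR_eq1 => /eqP L0; split.
by split=> //; rewrite E// L0 expR0.
Qed.

Lemma sq_pos (a b : R) : b != 0 -> 0 < a ^+ 2 + b ^+ 2.
Proof. by move=> b0; rewrite ltr_wpDl ?sqr_ge0// lt_neqAle eq_sym sqrf_eq0 b0 sqr_ge0. Qed.

Lemma set_ii_radial : 2 * alpha n + \sum_(1 <= i < n) alpha i != 0 ->
  radially_unique (set_ii alpha).
Proof.
move=> al0 y r r0 /set_iiP[pos y0 E] /set_iiP[_ _ E'].
have D0 : logii (r *: y) - logii y = 0 by rewrite E E' subrr.
have : ln r * (2 * alpha n + \sum_(1 <= i < n) alpha i) = 0.
  rewrite -[RHS]D0 /logii !coord1Z.
  have -> : r * coord1 y n / (r * coord1 y n.+1) = coord1 y n / coord1 y n.+1.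
    by field; rewrite y0 gt_eqF.
  have -> : (r * coord1 y n) ^+ 2 + (r * coord1 y n.+1) ^+ 2 =
      r * (r * (coord1 y n ^+ 2 + coord1 y n.+1 ^+ 2)) by ring.
  rewrite !lnMp ?mulr_gt0 ?sq_pos//.
  have -> : \sum_(1 <= i < n) alpha i * ln (coord1 (r *: y) i) =
     ln r * \sum_(1 <= i < n) alpha i + \sum_(1 <= i < n) alpha i * ln (coord1 y i).
    rewrite mulr_sumr -big_split /=; apply: eq_big_nat => i /andP[i1 i2].
    rewrite coord1Z lnMp ?pos ?i1 ?leq_predn//=.
    by ring.
  by ring.
by move/eqP; rewrite mulf_eq0 (negbTE al0) orbF ln_eq0// => /eqP.
Qed.

(** As for the first model, with a complex multiplication by
    zeta = (a' + i b') / (a + i b) = c + i s on the last two coordinates.  The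
    argument of zeta z is that of z up to a locally constant summand, so its
    gradient is compared instead of the values of the arctangents. *)
Lemma set_ii_homogeneous :
  locally_homogeneous (set_ii alpha) [set y | 0 < coord1 y n.+1].
Proof.
move=> y y' /= Dy Dy' /set_iiP[pos ya0 E] /set_iiP[pos' ya0' E'].
pose a := coord1 y n.+1; pose b := coord1 y n.
pose a' := coord1 y' n.+1; pose b' := coord1 y' n.
pose D := b ^+ 2 + a ^+ 2.
have D0 : 0 < D by exact: sq_pos.
pose c := (a * a' + b * b') / D; pose s := (a * b' - b * a') / D.
have zeta : c ^+ 2 + s ^+ 2 = (b' ^+ 2 + a' ^+ 2) / D.
  by rewrite /c /s /D; field; rewrite gt_eqF.
have zeta0 : 0 < c ^+ 2 + s ^+ 2 by rewrite zeta divr_gt0//; exact: sq_pos.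
pose t i := coord1 y' i / coord1 y i.
have t0 i : (1 <= i <= n.-1)%N -> 0 < t i by move=> i_n; rewrite divr_gt0 ?pos ?pos'.
pose e i : 'rV[R]_n.+1 := delta_mx 0 (inord i.-1).
pose Em i := if i == n.+1 then c *: e n.+1 - s *: e n else
  if i == n then s *: e n.+1 + c *: e n else t i *: e i.
pose G := coordmx 1%:M (fun i => Em i.+1).
have nn : (1 <= n <= n.+1)%N by rewrite n0 leqnSn.
have n1n : (1 <= n.+1 <= n.+1)%N by rewrite leqnn.
have EmE z i : (1 <= i <= n.-1)%N -> bf 1%:M z (Em i) = t i * coord1 z i.
  move=> /andP[i1 i2]; have i_n : (i < n)%N by rewrite -(prednK n0) ltnS.
  rewrite /Em !ltn_eqF//; last exact: ltnW.
  by rewrite bfZr coord1_delta// i1 ltnW// ltnS ltnW.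
have Emn z : bf 1%:M z (Em n) = s * coord1 z n.+1 + c * coord1 z n.
  by rewrite /Em ltn_eqF// eqxx bfDr !bfZr !coord1_delta.
have Emn1 z : bf 1%:M z (Em n.+1) = c * coord1 z n.+1 - s * coord1 z n.
  by rewrite /Em eqxx bfBr !bfZr !coord1_delta.
have GE z i : (1 <= i <= n.+1)%N -> coord1 (z *m G) i = bf 1%:M z (Em i).
  by case: i => // i i_n; rewrite coord1_mulcoordmx.
have caseI i : (1 <= i <= n.+1)%N -> [\/ (1 <= i <= n.-1)%N, i = n | i = n.+1].
  move=> /andP[i1]; rewrite leq_eqVlt => /orP[/eqP ->|]; first by constructor 3.
  rewrite ltnS leq_eqVlt => /orP[/eqP ->|i2]; first by constructor 2.
  by constructor 1; rewrite i1 leq_predn.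
exists G; split.
- apply: coordmx_unit1 => x Hx.
  have Hx' i : (1 <= i <= n.+1)%N -> bf 1%:M x (Em i) = 0.
    by case: i => // i i_n; exact: (Hx i.+1).
  have := Hx' _ nn; have := Hx' _ n1n; rewrite Emn Emn1 => H1 H2.
  have xa : (c ^+ 2 + s ^+ 2) * coord1 x n.+1 = 0.
    have -> : (c ^+ 2 + s ^+ 2) * coord1 x n.+1 = c * (c * coord1 x n.+1 - s * coord1 x n)
      + s * (s * coord1 x n.+1 + c * coord1 x n) by ring.
    by rewrite H1 H2 !mulr0 addr0.
  have xb : (c ^+ 2 + s ^+ 2) * coord1 x n = 0.
    have -> : (c ^+ 2 + s ^+ 2) * coord1 x n = c * (s * coord1 x n.+1 + c * coord1 x n)
      - s * (c * coord1 x n.+1 - s * coord1 x n) by ring.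
    by rewrite H1 H2 !mulr0 subr0.
  move=> i /[dup] i_n /caseI[i1|->|->].
  + have := Hx' i i_n; rewrite EmE// => /eqP.
    by rewrite mulf_eq0 (gt_eqF (t0 i i1)) => /eqP.
  + by apply/eqP; move/eqP: xb; rewrite mulf_eq0 (gt_eqF zeta0).
  + by apply/eqP; move/eqP: xa; rewrite mulf_eq0 (gt_eqF zeta0).
- apply: coord1_inj => i /[dup] i_n /caseI[i1|->|->]; rewrite GE//.
  + by rewrite EmE// /t divfK// gt_eqF// pos.
  + by rewrite Emn -/a -/b -/b' /s /c /D; field; rewrite gt_eqF.
  + by rewrite Emn1 -/a -/b -/a' /s /c /D; field; rewrite gt_eqF.
pose za z := c * coord1 z n.+1 - s * coord1 z n.
pose zb z := s * coord1 z n.+1 + c * coord1 z n.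
have cont (P : 'rV[R]_n.+1 -> R) : {for y, continuous P} -> 0 < P y -> \forall z \near y, 0 < P z.
  by move=> cP Py; have := cP _ (lt_nbhsr Py).
have cc1 i : continuous (fun z : 'rV[R]_n.+1 => coord1 z i) by move=> z; exact: coord_continuous.
have zay : za y = a'.
  by rewrite /za -/a -/b /s /c /D; field; rewrite gt_eqF.
have zby : zb y = b'.
  by rewrite /zb -/a -/b /s /c /D; field; rewrite gt_eqF.
have near1 : \forall z \near y, 0 < coord1 z n.+1 by apply: cont => //; exact: cc1.
have near2 : \forall z \near y, 0 < za z.
  apply: cont; last by rewrite zay.
  have [d _] := has_gradB (has_gradZ c (has_grad_coord0 n y)) (has_gradZ s (has_grad_coord0 n.-1 y)).
  exact: (differentiable_continuous d).
have /nbhs_ballP[rho /= rho0 Hrho] : \forall z \near y, 0 < coord1 z n.+1 /\ 0 < za z.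
  by apply: filterS2 near1 near2.
pose psi z := atan (zb z / za z) - atan (coord1 z n / coord1 z n.+1).
have gradpsi z : ball y rho z -> has_grad psi z (fun=> 0).
  move=> /Hrho[z1 z2].
  have g1 := has_grad_coord0 n z; have g2 := has_grad_coord0 n.-1 z.
  have ga := has_gradB (has_gradZ c g1) (has_gradZ s g2).
  have gb := has_gradD (has_gradZ s g1) (has_gradZ c g2).
  have za0 : za z != 0 by rewrite gt_eqF.
  have z10 : coord1 z n.+1 != 0 by rewrite gt_eqF.
  apply: (has_grad_eq (has_gradB (has_grad_angle za0 ga gb) (has_grad_angle z10 g1 g2))) => j.
  rewrite /= /za /zb -[coord0 z n]/(coord1 z n.+1) -[coord0 z n.-1]/(coord1 z n).
  set da := delta_mx _ _ _ _; set db := delta_mx _ _ _ _.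
  have zz : 0 < coord1 z n.+1 ^+ 2 + coord1 z n ^+ 2 by rewrite addrC sq_pos.
  move: (coord1 z n.+1) (coord1 z n) zz => p q zz.
  have -> : (c * p - s * q) ^+ 2 + (s * p + c * q) ^+ 2 = (c ^+ 2 + s ^+ 2) * (p ^+ 2 + q ^+ 2) by ring.
  by field; rewrite !gt_eqF.
have psiE z : ball y rho z -> psi z = psi y.
  apply: const_on_ball => [w /gradpsi[]//|w i /gradpsi[_ ->]//].
apply/nbhs_ballP; exists rho => //= z zr /set_iiP[posz z0 Ez].
have [z1 z2] := Hrho z zr.
have Gz1 : coord1 (z *m G) n.+1 = za z by rewrite GE// Emn1.
have Gz2 : coord1 (z *m G) n = zb z by rewrite GE// Emn.
apply/set_iiP; split.
- move=> i /[dup] i_n /andP[i1 i2].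
  have i_n1 : (1 <= i <= n.+1)%N by rewrite i1 (leq_trans i2)// (leq_trans (leq_pred _)).
  by rewrite GE// EmE// mulr_gt0 ?posz ?t0.
- by rewrite Gz1 gt_eqF.
have F0 : logii z + (logii y' - logii y) = 0 by rewrite E E' Ez subrr addr0.
rewrite -[RHS]F0 /logii Gz1 Gz2.
have -> : atan (zb z / za z) = atan (coord1 z n / coord1 z n.+1) + (atan (b' / a') - atan (b / a)).
  by have := psiE z zr; rewrite /psi zay zby -/a -/b => H0; rewrite -H0 addrC subrK.
have -> : zb z ^+ 2 + za z ^+ 2 = (b' ^+ 2 + a' ^+ 2) / D * (coord1 z n ^+ 2 + coord1 z n.+1 ^+ 2).
  by rewrite -zeta /za /zb; ring.
have Y'0 : 0 < b' ^+ 2 + a' ^+ 2 by exact: sq_pos.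
rewrite lnMp ?divr_gt0 ?sq_pos// (ln_divp Y'0 D0) -/a -/b -/a' -/b' -/D.
have -> : \sum_(1 <= i < n) alpha i * ln (coord1 (z *m G) i) =
    \sum_(1 <= i < n) alpha i * ln (coord1 z i) + (\sum_(1 <= i < n) alpha i * ln (coord1 y' i)
    - \sum_(1 <= i < n) alpha i * ln (coord1 y i)).
  rewrite -sumrB -big_split /=; apply: eq_big_nat => i /andP[i1 i2].
  have i_n : (1 <= i <= n.-1)%N by rewrite i1 leq_predn.
  have i_n1 : (1 <= i <= n.+1)%N by rewrite i1 ltnW// ltnS ltnW.
  rewrite GE// EmE// lnMp ?t0 ?posz//.
  by rewrite /t (ln_divp (pos' _ i_n) (pos _ i_n)); ring.
by ring.
Qed.

End ModelII.

Section ModelIII.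
Context (v : nat) (alpha : nat -> R) (v2 : (2 <= v <= n.+1)%N).

Let logiii y := coord1 y n.+1 / coord1 y 1%N
  - 2^-1 * \sum_(2 <= i < v) (coord1 y i / coord1 y 1%N) ^+ 2
  - ln (coord1 y 1%N) + \sum_(v <= i < n.+1) alpha i * ln (coord1 y i).

Lemma set_iiiP y : set_iii v alpha y <->
  [/\ 0 < coord1 y 1%N, (forall i, (v <= i <= n)%N -> 0 < coord1 y i) & logiii y = 0].
Proof.
have E : 0 < coord1 y 1%N -> coord1 y 1%N * logiii y = coord1 y n.+1 -
      (1 / (2 * coord1 y 1%N) * (\sum_(2 <= i < v) coord1 y i ^+ 2)
        - coord1 y 1%N * (- ln (coord1 y 1%N)
        + \sum_(v <= i < n.+1) alpha i * ln (coord1 y i))).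
  move=> a0; rewrite /logiii.
  have -> : \sum_(2 <= i < v) (coord1 y i / coord1 y 1%N) ^+ 2 =
     (coord1 y 1%N)^-1 ^+ 2 * \sum_(2 <= i < v) coord1 y i ^+ 2.
    by rewrite mulr_sumr; apply: eq_bigr => i _; rewrite exprMn mulrC.
  by field; rewrite gt_eqF.
split=> [[a0 pos H0]|[a0 pos H0]]; split=> //.
  have := E a0; rewrite {1}H0 subrr => /eqP.
  by rewrite mulf_eq0 (gt_eqF a0) => /eqP.
by apply/eqP; rewrite -subr_eq0 -E// H0 mulr0.
Qed.

Let n1n : (1 <= n.+1 <= n.+1)%N. Proof. by rewrite leqnn. Qed.

Lemma set_iii_radial : \sum_(v <= i < n.+1) alpha i != 1 ->
  radially_unique (set_iii v alpha).
Proof.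
move=> al0 y r r0 /set_iiiP[a0 pos E] /set_iiiP[_ _ E'].
have D0 : logiii (r *: y) - logiii y = 0 by rewrite E E' subrr.
have : ln r * (\sum_(v <= i < n.+1) alpha i - 1) = 0.
  rewrite -[RHS]D0 /logiii !coord1Z lnMp//.
  have -> : r * coord1 y n.+1 / (r * coord1 y 1%N) = coord1 y n.+1 / coord1 y 1%N.
    by field; rewrite !gt_eqF.
  have -> : \sum_(2 <= i < v) (coord1 (r *: y) i / (r * coord1 y 1%N)) ^+ 2 =
     \sum_(2 <= i < v) (coord1 y i / coord1 y 1%N) ^+ 2.
    by apply: eq_bigr => i _; rewrite coord1Z; congr (_ ^+ 2); field; rewrite !gt_eqF.
  have -> : \sum_(v <= i < n.+1) alpha i * ln (coord1 (r *: y) i) =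
     ln r * \sum_(v <= i < n.+1) alpha i + \sum_(v <= i < n.+1) alpha i * ln (coord1 y i).
    rewrite mulr_sumr -big_split /=; apply: eq_big_nat => i i_n.
    by rewrite coord1Z lnMp ?pos//; ring.
  by ring.
by move/eqP; rewrite mulf_eq0 subr_eq0 (negbTE al0) orbF ln_eq0// => /eqP.
Qed.

(** The coordinates 2, ..., v - 1 are translated by multiples of the first one,
    and the last coordinate compensates: dividing by the first coordinate turns
    the sum of squares into a paraboloid, on which such shears act
    transitively.  The shears change logiii by a constant, and the constant is
    0 because one point of the model goes to another. *)
Lemma set_iii_homogeneous : locally_homogeneous (set_iii v alpha) setT.
Proof.
move=> y y' _ _ /set_iiiP[ya0 pos E] /set_iiiP[ya0' pos' E'].
have [v2' vn] := andP v2.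
pose a0 := coord1 y' 1%N / coord1 y 1%N.
pose q0 i := (coord1 y' i - a0 * coord1 y i) / coord1 y 1%N.
pose c0 := (coord1 y' n.+1 - a0 * coord1 y n.+1 - \sum_(2 <= i < v) q0 i * coord1 y i) / coord1 y 1%N.
pose t i := coord1 y' i / coord1 y i.
have t0 i : (v <= i <= n)%N -> 0 < t i by move=> i_n; rewrite divr_gt0 ?pos ?pos'.
have a00 : 0 < a0 by rewrite divr_gt0.
pose e i : 'rV[R]_n.+1 := delta_mx 0 (inord i.-1).
pose Em i := if i == 1%N then a0 *: e 1%N else if i == n.+1 then
    a0 *: e n.+1 + c0 *: e 1%N + \sum_(2 <= j < v) q0 j *: e j
  else if (i < v)%N then a0 *: e i + q0 i *: e 1%N else t i *: e i.
pose G := coordmx 1%:M (fun i => Em i.+1).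
have e1 z : bf 1%:M z (e 1%N) = coord1 z 1%N by rewrite coord1_delta.
have n0 : (0 < n)%N by rewrite -ltnS (leq_trans v2').
have Em1 z : bf 1%:M z (Em 1%N) = a0 * coord1 z 1%N by rewrite /Em eqxx bfZr e1.
have Emq z i : (2 <= i < v)%N -> bf 1%:M z (Em i) = a0 * coord1 z i + q0 i * coord1 z 1%N.
  move=> /andP[i2 iv]; have i_n : (i < n.+1)%N by rewrite (leq_trans iv).
  rewrite /Em gtn_eqF// (ltn_eqF i_n) iv bfDr !bfZr e1 coord1_delta//.
  by rewrite (ltnW i2) ltnW.
have Emt z i : (v <= i <= n)%N -> bf 1%:M z (Em i) = t i * coord1 z i.
  move=> /andP[vi i_n]; have i2 : (1 < i)%N by rewrite (leq_trans v2').
  rewrite /Em gtn_eqF// (ltn_eqF (_ : i < n.+1)%N)// ltnNge vi bfZr coord1_delta//.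
  by rewrite (ltnW i2) ltnW.
have Emn z : bf 1%:M z (Em n.+1) = a0 * coord1 z n.+1 + c0 * coord1 z 1%N
    + \sum_(2 <= j < v) q0 j * coord1 z j.
  rewrite /Em eqSS gtn_eqF// eqxx !bfDr !bfZr e1 coord1_delta// bf_sumr; congr (_ + _).
  apply: eq_big_nat => j /andP[j2 jv]; rewrite bfZr coord1_delta//.
  by rewrite (ltnW j2) (leq_trans (ltnW jv)).
have GE z i : (1 <= i <= n.+1)%N -> coord1 (z *m G) i = bf 1%:M z (Em i).
  by case: i => // i i_n; rewrite coord1_mulcoordmx.
have caseI i : (1 <= i <= n.+1)%N ->
    [\/ i = 1%N, (2 <= i < v)%N, (v <= i <= n)%N | i = n.+1].
  move=> /andP[]; rewrite leq_eqVlt => /orP[/eqP <- _|i2]; first by constructor 1.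
  rewrite leq_eqVlt => /orP[/eqP ->|i_n]; first by constructor 4.
  by have [iv|iv] := ltnP i v; [constructor 2; rewrite i2|constructor 3].
have rq i : (2 <= i < v)%N -> (1 <= i <= n.+1)%N.
  by move=> /andP[i2 iv]; rewrite (ltnW i2) (leq_trans (ltnW iv)).
have rt i : (v <= i <= n)%N -> (1 <= i <= n.+1)%N.
  by move=> /andP[iv i_n]; rewrite ltnW ?ltnS ?(leq_trans v2' iv)// ltnW.
have yG : y *m G = y'.
  apply: coord1_inj => i /[dup] i_n /caseI[->|i1|i1|->]; rewrite GE//.
  - by rewrite Em1 /a0 divfK// gt_eqF.
  - by rewrite Emq// /q0; field; rewrite gt_eqF.
  - by rewrite Emt// /t divfK// gt_eqF// pos.
  - rewrite Emn /c0; set Sq := \sum_(2 <= j < v) _.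
    by field; rewrite gt_eqF.
pose kap := c0 / a0 - 2^-1 * \sum_(2 <= i < v) (q0 i / a0) ^+ 2 - ln a0
  + \sum_(v <= i < n.+1) alpha i * ln (t i).
have logG z : 0 < coord1 z 1%N -> (forall i, (v <= i <= n)%N -> 0 < coord1 z i) ->
    logiii (z *m G) = logiii z + kap.
  move=> z0 posz; rewrite /logiii !GE// Em1 Emn lnMp//.
  have -> : \sum_(2 <= i < v) (coord1 (z *m G) i / (a0 * coord1 z 1%N)) ^+ 2 =
     \sum_(2 <= i < v) (coord1 z i / coord1 z 1%N) ^+ 2 + \sum_(2 <= i < v) (q0 i / a0) ^+ 2
     + 2 * ((a0 * coord1 z 1%N)^-1 * \sum_(2 <= i < v) q0 i * coord1 z i).
    rewrite !mulr_sumr -!big_split /=; apply: eq_big_nat => i i_n.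
    by rewrite GE ?rq// Emq//; field; rewrite !gt_eqF.
  have -> : \sum_(v <= i < n.+1) alpha i * ln (coord1 (z *m G) i) =
     \sum_(v <= i < n.+1) alpha i * ln (t i) + \sum_(v <= i < n.+1) alpha i * ln (coord1 z i).
    rewrite -big_split /=; apply: eq_big_nat => i i_n.
    by rewrite GE ?rt// Emt// lnMp ?t0 ?posz//; ring.
  rewrite /kap; set Sq := \sum_(2 <= i < v) q0 i * coord1 z i.
  by field; rewrite !gt_eqF.
have kap0 : kap = 0.
  by have := logG y ya0 pos; rewrite yG E E' add0r => /esym.
exists G; split=> //.
- apply: coordmx_unit1 => x Hx.
  have Hx' i : (1 <= i <= n.+1)%N -> bf 1%:M x (Em i) = 0.
    by case: i => // i i_n; exact: (Hx i.+1).
  have x1 : coord1 x 1%N = 0.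
    have := Hx' 1%N isT; rewrite Em1 => /eqP.
    by rewrite mulf_eq0 (gt_eqF a00) => /eqP.
  have xq i : (2 <= i < v)%N -> coord1 x i = 0.
    move=> i_n; have := Hx' i (rq i i_n); rewrite Emq// x1 mulr0 addr0 => /eqP.
    by rewrite mulf_eq0 (gt_eqF a00) => /eqP.
  move=> i /[dup] i_n /caseI[->|i1|i1|->] //; first exact: xq.
    have := Hx' i i_n; rewrite Emt// => /eqP.
    by rewrite mulf_eq0 (gt_eqF (t0 i i1)) => /eqP.
  have := Hx' n.+1 n1n; rewrite Emn x1 mulr0 addr0 big_nat big1 ?addr0 => [/eqP|j jv].
    by rewrite mulf_eq0 (gt_eqF a00) => /eqP.
  by rewrite xq// mulr0.
near=> z => /set_iiiP[z0 posz Ez]; apply/set_iiiP; split.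
- by rewrite GE// Em1 mulr_gt0.
- by move=> i i_n; rewrite GE ?rt// Emt// mulr_gt0 ?t0 ?posz.
- by rewrite logG// Ez kap0 addr0.
Unshelve. all: by end_near. Qed.

End ModelIII.

End Models.

(** * From the geometry to the linear normal forms *)

Section BasePoint.
Context {R : realType} {n : nat} (eps : R) (f : 'rV[R]_n -> 'rV[R]_n.+1) (U : set 'rV[R]_n).
Context (oU : open U) (sf : smooth_on U f)
  (regf : forall u, U u -> immersed_at f u /\ transversal_at f u)
  (eps1 : eps = 1 \/ eps = - 1) (pdh : forall u, U u -> posdef (ca_metric eps f u))
  (flat : forall u, U u -> forall i j k l,
    curvature (levi_civita (ca_metric eps f)) i j k l u = 0)
  (par : forall u, U u -> forall l i j k,
    cov_deriv3 (levi_civita (ca_metric eps f)) (cubic_form eps f) l i j k u = 0).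
Context (u0 : 'rV[R]_n) (r : R) (r0 : 0 < r) (rU : ball u0 r `<=` U).

Let Uu0 : U u0. Proof. by apply: rU; exact: ballxx. Qed.

(** The components of the ambient_op_i (u) modulo the span of the
    ambient_op_j (u0) solve a homogeneous linear system and vanish at u0. *)
Lemma span_const u i : ball u0 r u ->
  exists P : 'I_n -> R, ambient_op eps f i u = \sum_j P j *: ambient_op eps f j u0.
Proof.
move=> ur; pose V := \matrix_(j < n) mxvec (ambient_op eps f j u0).
suff : (mxvec (ambient_op eps f i u) <= V)%MS.
  move=> /submxP[c cV]; exists (fun j => c 0 j); apply: (can_inj mxvecK).
  rewrite cV mulmx_sum_row linear_sum; apply: eq_bigr => j _.
  by rewrite rowK linearZ.
rewrite submxE; apply/eqP/rowP => c; rewrite [RHS]mxE.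
pose w k x := (mxvec (ambient_op eps f k x) *m cokermx V) 0 c.
have Cm k : Cmx 0 U (fun x => mxvec (ambient_op eps f k x)).
  move=> a b; rewrite (ord1 a); case/mxvec_indexP: b => a' b'.
  apply: (Ck_ext oU _ (ambient_op_smooth oU sf regf pdh 0 k a' b')) => x _.
  by rewrite mxvecE.
have Cw k : Ck 0 U (w k).
  have C0 : Cmx 0 U (fun _ : 'rV[R]_n => cokermx V) by move=> a b; exact: Ck_const.
  by have := Cmx_mul oU (Cm k) C0 0 c.
apply: (@linear_system_zero _ _ 'I_n w (fun l i m => LC eps f l i m) u0 r) => //.
- by move=> k x xr; apply: (Ck_diff (Cw k)); exact: rU.
- move=> l k m x xr; apply: differentiable_continuous.
  by apply: (Ck_diff (LC_smooth oU sf regf pdh 0 l k m)); exact: rU.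
- move=> l k x xr; have Ux := rU xr.
  have C0 : Cmx 0 U (fun _ : 'rV[R]_n => cokermx V) by move=> a b; exact: Ck_const.
  have dv : dmx l (fun x => mxvec (ambient_op eps f k x)) x = mxvec (dmx l (ambient_op eps f k) x).
    apply/rowP => b; case/mxvec_indexP: b => a' b'; rewrite mxvecE !dmxE.
    by congr (pd l _ x); apply/funext => y; rewrite mxvecE.
  have <- : dmx l (fun x => mxvec (ambient_op eps f k x) *m cokermx V) x 0 c = pd l (w k) x.
    by rewrite dmxE.
  rewrite (dmx_mul l (Cm k) C0 Ux) dmx_const mulmx0 addr0 dv (ambient_op_derive oU sf regf eps1 pdh flat par k l Ux).
  rewrite linear_sum mulmx_suml summxE; apply: eq_bigr => m _.
  by rewrite linearZ -scalemxAl mxE.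
- move=> k; rewrite /w.
  have -> : mxvec (ambient_op eps f k u0) = row k V by rewrite rowK.
  by rewrite -row_mul mulmx_coker row0 mxE.
Qed.

(** The frame at u0 is made the standard basis: [g] is f in these coordinates,
    where the operators at u0 become Ahat and the form becomes gram. *)
Let B0 : 'M[R]_n.+1 := invmx (frame f u0).
Let A j : 'M[R]_n.+1 := Ahat eps f j u0.
Let S : 'M[R]_n.+1 := gram eps f u0.
Let g u : 'rV[R]_n.+1 := f u *m B0.

Lemma gram_sym : S^T = S.
Proof.
have E : (- eps *: ca_metric eps f u0)^T = - eps *: ca_metric eps f u0.
  apply/matrixP => a b; rewrite mxE [LHS]mxE [RHS]mxE; congr (_ * _).
  by have := h_sym eps oU sf a b Uu0; rewrite /h -lock => ->.
have E1 : (1 : 'M[R]_1)^T = 1 by apply/matrixP => a b; rewrite !mxE eq_sym.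
by rewrite /S /gram (@tr_block_mx _ 1 n 1 n) !trmx0 E1 E.
Qed.

Lemma A_selfadjoint j : (A j *m S)^T = A j *m S.
Proof. exact: (Ahat_selfadjoint oU sf regf eps1 pdh j Uu0). Qed.

Lemma A_commute i j : A i *m A j = A j *m A i.
Proof. exact: (Ahat_comm oU sf regf eps1 pdh flat par i j Uu0). Qed.

Lemma bf_gram (a b : 'M[R]_1) (x y : 'rV[R]_n) :
  bf S (row_mx a x : 'rV[R]_(1 + n)) (row_mx b y : 'rV[R]_(1 + n)) =
  a 0 0 * b 0 0 - eps * (x *m ca_metric eps f u0 *m y^T) 0 0.
Proof.
rewrite /bf /S /gram (@mul_row_block _ 1 1 n 1 n) !mulmx0 addr0 add0r mulmx1.
rewrite (@tr_row_mx _ 1 1 n) (@mul_row_col _ 1 1 n 1) mxE; congr (_ + _).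
  by rewrite mxE big_ord1 mxE.
by rewrite -scalemxAr -scalemxAl mxE mulNr.
Qed.

Lemma g_base : g u0 = row_mx (1 : 'M[R]_1) (0 : 'rV[R]_n).
Proof.
have <- : delta_mx 0 (lshift n 0) = row_mx (1 : 'M[R]_1) (0 : 'rV[R]_n).
  apply/rowP => b; case: (split_ordP b) => k ->.
    by rewrite row_mxEl !mxE (ord1 k) !eqxx.
  by rewrite row_mxEr !mxE eq_rlshift andbF.
have fE : f u0 = delta_mx 0 (lshift n 0) *m frame f u0 :> 'rV[R]_(1 + n).
  by rewrite -rowE; apply/rowP => b; rewrite mxE frame_up.
by rewrite /g fE mulmxK//; exact: (frame_unit regf Uu0).
Qed.

Lemma g_base_A j : g u0 *m A j = row_mx (0 : 'M[R]_1) (delta_mx 0 j : 'rV[R]_n).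
Proof.
rewrite g_base /A AhatE /blk -lock (@mul_row_block _ 1 1 n 1 n) !mul0mx !addr0 !mulmx0.
by rewrite scale1r mul1mx.
Qed.

Lemma base_unit : bf S (g u0) (g u0) = 1.
Proof. by rewrite g_base bf_gram mul0mx mul0mx !mxE mulr0 subr0 mulr1. Qed.

Lemma base_orth j : bf S (g u0) (g u0 *m A j) = 0.
Proof. by rewrite g_base_A g_base bf_gram mul0mx mul0mx !mxE !mulr0 subr0. Qed.

Lemma eps_neq0 : eps != 0.
Proof. by case: eps1 => ->; rewrite ?oppr_eq0 oner_eq0. Qed.

(** In these coordinates g u0 and its images are the standard basis vectors, so
    this is the nondegeneracy of the form. *)
Lemma base_nondegenerate x : bf S (g u0) x = 0 -> (forall j, bf S (g u0 *m A j) x = 0) -> x = 0.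
Proof.
rewrite -[x](@hsubmxK _ 1 1 n); move: (@lsubmx _ 1 1 n x) (@rsubmx _ 1 1 n x) => a y H0 H1.
have a0 : a = 0.
  move: H0; rewrite g_base bf_gram mul0mx mul0mx !mxE mulr0 subr0 mul1r => a0.
  by apply/matrixP => i j; rewrite (ord1 i) (ord1 j) a0 mxE.
suff y0 : y = 0 by rewrite a0 y0 row_mx0.
have hu := posdef_unitmx (pdh Uu0).
have : ca_metric eps f u0 *m y^T = 0.
  apply/colP => j; rewrite [RHS]mxE; have := H1 j.
  rewrite g_base_A bf_gram mxE mul0r sub0r -mulmxA -rowE mxE => /eqP.
  by rewrite oppr_eq0 mulf_eq0 (negbTE eps_neq0) => /eqP.
move=> /(congr1 (mulmx (invmx (ca_metric eps f u0)))); rewrite mulKmx// mulmx0.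
by move=> /(congr1 trmx); rewrite trmxK trmx0.
Qed.

Lemma gram_lorentz x : eps = 1 -> bf S x (g u0) = 0 -> x != 0 -> bf S x x < 0.
Proof.
rewrite -[x](@hsubmxK _ 1 1 n); move: (@lsubmx _ 1 1 n x) (@rsubmx _ 1 1 n x) => a y e1 H0 x0.
have a0 : a = 0.
  move: H0; rewrite g_base bf_gram trmx0 mulmx0 !mxE mulr0 subr0 mulr1 => a0.
  by apply/matrixP => i j; rewrite (ord1 i) (ord1 j) a0 mxE.
rewrite bf_gram a0 mxE mul0r sub0r e1 mul1r oppr_lt0 -e1; apply: (pdh Uu0).
by apply: contraNneq x0 => y0; rewrite a0 y0 row_mx0.
Qed.

Lemma gram_definite x : eps = -1 -> x != 0 -> 0 < bf S x x.
Proof.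
rewrite -[x](@hsubmxK _ 1 1 n); move: (@lsubmx _ 1 1 n x) (@rsubmx _ 1 1 n x) => a y e1 x0.
rewrite bf_gram -expr2 {1}e1 mulN1r opprK.
have [y0|y0] := eqVneq y 0; last by rewrite ltr_wpDl ?sqr_ge0//; exact: (pdh Uu0).
rewrite y0 !mul0mx mxE addr0 lt_neqAle sqr_ge0 andbT eq_sym sqrf_eq0.
apply: contraNneq x0 => a0; rewrite y0.
suff -> : a = 0 by rewrite row_mx0.
by apply/matrixP => i j; rewrite (ord1 i) (ord1 j) a0 mxE.
Qed.

(** d_l f = f ambient_op_l (u), the operator is a combination of those at u0, and
    self-adjointness moves it to the fixed vector E. *)
Lemma coord_grad u : ball u0 r u -> exists P : 'I_n -> 'I_n -> R, forall E,
  has_grad (fun w => bf S (g w) E) u (fun l => \sum_j P l j * bf S (g u) (E *m A j)).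
Proof.
move=> ur; have Uu := rU ur.
have [P HP] := choice (fun l => span_const l ur).
exists P => E; pose k : 'cV[R]_n.+1 := B0 *m S *m E^T.
have bE (x : 'rV[R]_n.+1) : bf S (x *m B0) E = \sum_b k b 0 * x 0 b.
  rewrite /bf -!mulmxA mxE; apply: eq_bigr => b _.
  by rewrite mulrC /k -!mulmxA.
have Hb b : has_grad (fun w => f w 0 b) u (fun l => (f u *m ambient_op eps f l u : 'rV[R]_n.+1) 0 b).
  split=> [|l]; first exact: (differentiable_entry b (sf [::] Uu)).
  rewrite (ambient_op_frame eps sf regf l Uu); apply: esym; apply: partial_row.
  exact: (sf [::] Uu).
have Hs := @has_grad_sum _ _ _ (index_enum 'I_n.+1) _ _ _ (fun b _ => has_gradZ (k b 0) (Hb b)).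
have -> : (fun w => bf S (g w) E) = (fun w => \sum_(b <- index_enum 'I_n.+1) k b 0 * f w 0 b).
  by apply/funext => w; rewrite bE.
apply: (has_grad_eq Hs) => l; rewrite -bE HP.
rewrite mulmx_sumr mulmx_suml bf_suml; apply: eq_bigr => j _.
rewrite -scalemxAr -scalemxAl bfZl -(bfA gram_sym _ _ (A_selfadjoint j)); congr (_ * bf _ _ _).
rewrite ambient_opE /g /A !mulmxA mulmxK;[by []|]; exact: (frame_unit regf Uu0).
Qed.

End BasePoint.

(** * Integration of the normal forms *)
Section LocalModel.
Context {R : realType} {n : nat} (n0 : (0 < n)%N).
Context (g : 'rV[R]_n -> 'rV[R]_n.+1) (u0 : 'rV[R]_n) (r : R) (r0 : 0 < r).
Context (S : 'M[R]_n.+1) (A : 'I_n -> 'M[R]_n.+1).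
Context (cg : forall u, ball u0 r u -> exists P : 'I_n -> 'I_n -> R, forall E,
  has_grad (fun w => bf S (g w) E) u (fun l => \sum_j P l j * bf S (g u) (E *m A j))).

Definition lands_in (H Dom : set 'rV[R]_n.+1) : Prop := exists C : 'M[R]_n.+1, C \in unitmx /\
  exists2 r', 0 < r' <= r & forall u, ball u0 r' u -> H (g u *m C) /\ Dom (g u *m C).

Let Y E u := bf S (g u) E.

Lemma positive_near (E : nat -> 'rV[R]_n.+1) m : (forall i, (i < m)%N -> 0 < Y (E i) u0) ->
  exists2 r', 0 < r' <= r & forall u, ball u0 r' u -> forall i, (i < m)%N -> 0 < Y (E i) u.
Proof.
move=> pos; have H : \forall u \near u0, forall i : 'I_m, 0 < Y (E i) u.
  refine (@filter_forall _ _ (fun (i : 'I_m) u => is_true (0 < Y (E i) u)) _ (nbhs_filter u0) _) => i; have [P /(_ (E i))[d _]] := cg (ballxx u0 r0).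
  have c := differentiable_continuous d.
  exact: (c _ (lt_nbhsr (pos i (ltn_ord i)))).
have /nbhs_ballP[e /= e0 He] := H.
exists (Num.min e r); first by rewrite lt_min e0 r0 ge_min lexx orbT.
move=> u ur i im; apply: (He u _ (Ordinal im)).
by apply: (@le_ball _ _ u0 (Num.min e r) e _ u ur); rewrite ge_min lexx.
Qed.

Lemma const_of_grad (phi : 'rV[R]_n -> R) r' :
  (forall u, ball u0 r' u -> has_grad phi u (fun=> 0)) ->
  forall u, ball u0 r' u -> phi u = phi u0.
Proof.
by move=> H; apply: const_on_ball => [u /H[]//|u i /H[_ ->]].
Qed.

Lemma coordY E i u : (1 <= i <= n.+1)%N -> coord1 (g u *m coordmx S E) i = Y (E i.-1) u.
Proof. by case: i => // i /andP[_ i_n]; rewrite coord1E coord0_coordmx. Qed.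

(** Each Y_i = <g, E_i> has logarithmic gradient mu_i, so \sum_i lam_i ln Y_i has
    zero gradient by the relations of [form_diag]; it vanishes at u0, where all
    Y_i are 1.  The factor s allows for the sign convention of the model. *)
Lemma lands_diag E mu lam s : form_diag S A (g u0) E mu lam ->
  lands_in (set_i (fun i => s * lam i.-1)) setT.
Proof.
move=> [sep EA rel _]; exists (coordmx S E); split; first exact: coordmx_unit.
have Y0 i : (i < n.+1)%N -> Y (E i) u0 = 1 by move=> /EA[].
have [|r' /andP[r'0 r'r] pos] := @positive_near E n.+1.
  by move=> i i_n; rewrite Y0.
exists r'; first by rewrite r'0.
pose phi u := \sum_(i <- index_enum 'I_n.+1) lam i * ln (Y (E i) u).
have phi0 u : ball u0 r' u -> phi u = 0.
  move=> ur; rewrite (@const_of_grad phi r' _ u ur) => [|w wr].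
    by rewrite /phi big1// => i _; rewrite Y0// ln1 mulr0.
  have [P HP] := cg (@le_ball _ _ u0 r' r r'r w wr).
  have Hi (i : 'I_n.+1) : i \in index_enum 'I_n.+1 -> has_grad (fun w => lam i * ln (Y (E i) w)) w
      (fun l => \sum_j P l j * (lam i * mu i j)).
    move=> _; have Yi := pos w wr i (ltn_ord i).
    apply: (has_grad_eq (has_gradZ (lam i) (has_grad_ln Yi (HP (E i))))) => l.
    rewrite !mulr_sumr; apply: eq_bigr => j _.
    have [_ ->] := EA i (ltn_ord i); rewrite bfZr -/(Y (E i) w); field; exact: lt0r_neq0.
  apply: (has_grad_eq (has_grad_sum Hi)) => l.
  rewrite exchange_big big1// => j _; rewrite -mulr_sumr.
  by have := rel j; rewrite /index_enum => ->; rewrite mulr0.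
move=> u ur; split=> //; apply/set_iP; split=> [i i_n|].
  by rewrite coordY//; apply: pos => //; case: i i_n.
transitivity (s * phi u); last by rewrite phi0 ?mulr0.
rewrite big_add1 big_mkord /phi mulr_sumr; apply: eq_bigr => i _.
by rewrite coordY//= ?mulrA// ltn_ord.
Qed.

(** The complex coordinate Za + i Zb has logarithmic gradient al + i be, so the
    logarithm of its modulus has gradient al and its argument has gradient be;
    p and q weigh them so that the total potential is constant.  The model uses the square of the modulus, hence
    p / 2. *)
Lemma lands_complex d E mu lam al be p q :
  form_complex S A (g u0) d E mu lam al be p q ->
  lands_in (set_ii (fun i => if i == n.+1 then q else if i == n then p / 2 else lam i.-1))
    [set y | 0 < coord1 y n.+1].
Proof.
move=> [dN sep EA [Eb0 Ea1 EP] [rel _]].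
have nd : n = d.+1 by case: dN.
exists (coordmx S E); split; first exact: coordmx_unit.
pose E' i := if (i < d)%N then E i else E d.+1.
have [|r' /andP[r'0 r'r] pos] := @positive_near E' d.+1.
  by move=> i _; rewrite /E' /Y; case: ifPn => [/EA[-> _ _]|_]; rewrite ?Ea1 ltr01.
exists r'; first by rewrite r'0.
have posY u i : ball u0 r' u -> (i < d)%N -> 0 < Y (E i) u.
  by move=> ur id; have := pos u ur i (ltnW id); rewrite /E' id.
have posZ u : ball u0 r' u -> 0 < Y (E d.+1) u.
  by move=> ur; have := pos u ur d (ltnSn d); rewrite /E' ltnn.
pose Za := Y (E d.+1); pose Zb := Y (E d).
pose phi u := \sum_(i <- index_enum 'I_d) lam i * ln (Y (E i) u)
  + p / 2 * ln (Zb u * Zb u + Za u * Za u) + q * atan (Zb u / Za u).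
have phi0 u : ball u0 r' u -> phi u = 0.
  move=> ur; rewrite (@const_of_grad phi r' _ u ur) => [|w wr].
    rewrite /phi /Zb /Za /Y Eb0 Ea1 mul0r mulr1 mul0r add0r ln1 atan0 !mulr0 !addr0 big1// => i _.
    by have [-> _ _] := EA i (ltn_ord i); rewrite ln1 mulr0.
  have [P HP] := cg (@le_ball _ _ u0 r' r r'r w wr).
  have Hi (i : 'I_d) : i \in index_enum 'I_d -> has_grad (fun w => lam i * ln (Y (E i) w)) w
      (fun l => \sum_j P l j * (lam i * mu i j)).
    move=> _; have Yi := posY w i wr (ltn_ord i).
    apply: (has_grad_eq (has_gradZ (lam i) (has_grad_ln Yi (HP (E i))))) => l.
    rewrite !mulr_sumr; apply: eq_bigr => j _.
    have [_ _ ->] := EA i (ltn_ord i); rewrite bfZr -/(Y (E i) w); field; exact: lt0r_neq0.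
  pose aL l := \sum_j P l j * al j; pose bL l := \sum_j P l j * be j.
  have Ga : has_grad Za w (fun l => aL l * Za w - bL l * Zb w).
    apply: (has_grad_eq (HP (E d.+1))) => l; rewrite /aL /bL !mulr_suml -sumrB.
    apply: eq_bigr => j _; have [-> _] := EP j.
    by rewrite bfBr !bfZr -/(Y _ _) -/(Za w) -/(Y (E d) w) -/(Zb w); ring.
  have Gb : has_grad Zb w (fun l => bL l * Za w + aL l * Zb w).
    apply: (has_grad_eq (HP (E d))) => l; rewrite /aL /bL !mulr_suml -big_split /=.
    apply: eq_bigr => j _; have [_ ->] := EP j.
    by rewrite bfDr !bfZr -/(Y _ _) -/(Za w) -/(Y (E d) w) -/(Zb w); ring.
  have Za0 : 0 < Za w by exact: posZ.
  have Za0' : Za w != 0 by exact: lt0r_neq0.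
  have mod0 : 0 < Zb w * Zb w + Za w * Za w by rewrite ltr_wpDl// ?mulr_gt0// -expr2 sqr_ge0.
  have G2 := has_gradZ (p / 2) (has_grad_ln mod0 (has_gradD (has_gradM Gb Gb) (has_gradM Ga Ga))).
  have G3 := has_gradZ q (has_grad_angle Za0' Ga Gb).
  apply: (has_grad_eq (has_gradD (has_gradD (has_grad_sum Hi) G2) G3)) => l /=.
  have -> : \sum_(i <- index_enum 'I_d) \sum_j P l j * (lam i * mu i j) =
      - (p * aL l + q * bL l).
    rewrite exchange_big /aL /bL !mulr_sumr -big_split -sumrN; apply: eq_bigr => j _ /=.
    rewrite -mulr_sumr.
    have := rel j; set s := \sum_(i < d) _ => rj.
    have -> : s = - (p * al j + q * be j).
      by apply/eqP; rewrite -addr_eq0 addrA; apply/eqP.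
    by ring.
  have mod1 : Zb w * Zb w + Za w * Za w != 0 by exact: lt0r_neq0.
  have mod2 : Za w ^+ 2 + Zb w ^+ 2 != 0 by rewrite addrC !expr2.
  by field.
move=> u ur.
have c1 i : (1 <= i <= n.-1)%N -> coord1 (g u *m coordmx S E) i = Y (E i.-1) u.
  move=> /andP[i1 i2]; rewrite coordY// i1 /=; apply: (leq_trans i2).
  by rewrite (leq_trans (leq_pred _)).
have c2 : coord1 (g u *m coordmx S E) n = Zb u.
  by rewrite coordY ?n0 ?leqnSn// /Zb nd.
have c3 : coord1 (g u *m coordmx S E) n.+1 = Za u.
  by rewrite coordY ?leqnn// /Za /= nd.
split; last by rewrite /= c3; exact: posZ.
apply/set_iiP => //; split=> [i i_n||].
- rewrite c1//; apply: posY => //; case: i i_n => //= i.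
  by rewrite nd.
- by rewrite c3; apply: lt0r_neq0; exact: posZ.
rewrite eqxx (ltn_eqF (ltnSn n)) eqxx c2 c3 !expr2; apply: (etrans _ (phi0 u ur)); rewrite /phi; congr (_ + _ + _).
have nd1 : n.-1 = d by rewrite nd.
rewrite big_add1 nd1 big_mkord /=; apply: eq_bigr => i _.
have i_n : (i.+1 < n)%N by rewrite nd ltnS ltn_ord.
rewrite (ltn_eqF (leq_trans i_n (leqnSn _))) (ltn_eqF i_n) c1//=.
by rewrite nd ltn_ord.
Qed.

Lemma separating_scale (c : nat -> R) E : (forall i, c i != 0) -> separating S E ->
  separating S (fun i => c i *: E i).
Proof.
move=> c0 sep x Hx; apply: sep => i i_n; have := Hx i i_n; rewrite bfZr => /eqP.
by rewrite mulf_eq0 (negbTE (c0 i)) => /eqP.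
Qed.

(** With a = <g, E_0>, q_i = <g, E_i> and b = <g, E_(k+d+1)>, the functions q_i / a
    have gradients ka_i, and b / a + (1/2) \sum_i (q_i / a)^2 has gradient rho:
    the potential b / a + (1/2) \sum_i (q_i / a)^2 + rho0 ln a + \sum_i lam_i ln Y_i
    is constant by the relation of [form_null].  Dividing it by - rho0 gives the
    equation of the model after rescaling the coordinates by [c]. *)
Lemma lands_null k d E mu lam m ka rho : form_null S A (g u0) k d E mu lam m ka rho ->
  let rho0 := 1 - \sum_(k.+1 <= i < (k + d).+1) lam i in
  lands_in (set_iii k.+2 (fun i => - lam i.-1 / rho0)) setT.
Proof.
move=> [[kdN sep] [a1 Ea] Eq EY [b0 Eb rel]] rho0.
have nkd : n = (k + d).+1 by case: kdN.
have lam0 i : (k.+1 <= i < (k + d).+1)%N -> lam i < 0 by move=> /EY[].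
have rho0_gt0 : 0 < rho0.
  rewrite subr_gt0 (le_lt_trans _ ltr01)// big_nat_cond; apply: sumr_le0 => i.
  by rewrite andbT => /lam0/ltW.
(* The q_i are divided by the root of rho0 so that the quadratic term keeps its
   coefficient 1/2, and b by - rho0. *)
pose c i := if i == 0%N then 1 else if (i <= k)%N then (Num.sqrt rho0)^-1
            else if (i <= k + d)%N then 1 else - rho0^-1.
have c0 i : c i != 0.
  rewrite /c; case: ifP => _; first exact: oner_neq0.
  case: ifP => _; first by rewrite invr_eq0 sqrtr_eq0 -ltNge.
  by case: ifP => _; rewrite ?oner_neq0// oppr_eq0 invr_eq0 gt_eqF.
exists (coordmx S (fun i => c i *: E i)); split.
  exact: (coordmx_unit (separating_scale c0 sep)).
pose E' i := if (k < i <= k + d)%N then E i else E 0%N.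
have [|r' /andP[r'0 r'r] pos] := @positive_near E' (k + d).+1.
  by move=> i _; rewrite /E' /Y; case: ifP => [/EY[-> _ _]|_]; rewrite ?a1 ltr01.
exists r'; first by rewrite r'0.
have posY u i : ball u0 r' u -> (k < i <= k + d)%N -> 0 < Y (E i) u.
  by move=> ur id; have := pos u ur i; rewrite /E' id; apply; case/andP: id.
have posa u : ball u0 r' u -> 0 < Y (E 0%N) u.
  by move=> ur; have := pos u ur 0%N isT; rewrite /E'.
pose a := Y (E 0%N); pose b := Y (E (k + d).+1).
pose phi u := b u * (a u)^-1
  + 2^-1 * (\sum_(i <- index_iota 1 k.+1) (Y (E i) u * (a u)^-1) * (Y (E i) u * (a u)^-1))
  + rho0 * ln (a u) + \sum_(i <- index_iota k.+1 (k + d).+1) lam i * ln (Y (E i) u).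
have phi0 u : ball u0 r' u -> phi u = 0.
  move=> ur; rewrite (@const_of_grad phi r' _ u ur) => [|w wr].
    rewrite /phi /a /b /Y a1 b0 mul0r add0r ln1 mulr0 addr0 big_nat big1 => [|i i_k]; last first.
      by have [-> _] := Eq i i_k; rewrite !mul0r.
    rewrite mulr0 add0r big_nat big1 // => i i_k.
    by have [-> _ _] := EY i i_k; rewrite ln1 mulr0.
  have [P HP] := cg (@le_ball _ _ u0 r' r r'r w wr).
  pose mL l := \sum_j P l j * m j; pose kL i l := \sum_j P l j * ka i j.
  pose rL l := \sum_j P l j * rho j; pose muL i l := \sum_j P l j * mu i j.
  have Ga : has_grad a w (fun l => mL l * a w).
    apply: (has_grad_eq (HP (E 0%N))) => l; rewrite /mL mulr_suml.
    by apply: eq_bigr => j _; rewrite Ea bfZr mulrA.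
  have Gq i : (0 < i <= k)%N -> has_grad (Y (E i)) w (fun l => mL l * Y (E i) w + kL i l * a w).
    move=> i_k; apply: (has_grad_eq (HP (E i))) => l.
    rewrite /mL /kL !mulr_suml -big_split; apply: eq_bigr => j _ /=.
    by have [_ ->] := Eq i i_k; rewrite bfDr !bfZr mulrDr !mulrA.
  have Gb : has_grad b w (fun l => mL l * b w
      - \sum_(i <- index_iota 1 k.+1) kL i l * Y (E i) w + rL l * a w).
    apply: (has_grad_eq (HP (E (k + d).+1))) => l.
    have -> : \sum_(i <- index_iota 1 k.+1) kL i l * Y (E i) w =
        \sum_j P l j * \sum_(i <- index_iota 1 k.+1) ka i j * Y (E i) w.
      under [RHS]eq_bigr do rewrite mulr_sumr.
      rewrite exchange_big; apply: eq_bigr => i _; rewrite /kL mulr_suml.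
      by apply: eq_bigr => j _; rewrite mulrA.
    rewrite /mL /rL !mulr_suml -sumrB -big_split; apply: eq_bigr => j _ /=.
    rewrite Eb bfDr bfBr !bfZr.
    have -> : bf S (g w) (\sum_(1 <= i < k.+1) ka i j *: E i) =
        \sum_(i <- index_iota 1 k.+1) ka i j * Y (E i) w.
      by rewrite bf_sumr; apply: eq_bigr => i _; rewrite bfZr.
    by rewrite -/(Y _ _) -/(b w) -/(Y (E 0%N) w) -/(a w); ring.
  have aw0 : a w != 0 by apply: lt0r_neq0; exact: posa.
  have Gr := has_gradV aw0 Ga.
  have Gba : has_grad (fun w => b w * (a w)^-1) w
      (fun l => rL l - \sum_(i <- index_iota 1 k.+1) kL i l * (Y (E i) w * (a w)^-1)).
    apply: (has_grad_eq (has_gradM Gb Gr)) => l.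
    have -> : \sum_(i <- index_iota 1 k.+1) kL i l * (Y (E i) w * (a w)^-1) =
      (\sum_(i <- index_iota 1 k.+1) kL i l * Y (E i) w) * (a w)^-1.
      by rewrite mulr_suml; apply: eq_bigr => i _; rewrite mulrA.
    by field.
  have Gqa i : (0 < i <= k)%N -> has_grad (fun w => Y (E i) w * (a w)^-1) w (kL i).
    by move=> i_k; apply: (has_grad_eq (has_gradM (Gq i i_k) Gr)) => l; field.
  have Gqq i : i \in index_iota 1 k.+1 ->
      has_grad (fun w => (Y (E i) w * (a w)^-1) * (Y (E i) w * (a w)^-1)) w
      (fun l => 2 * (kL i l * (Y (E i) w * (a w)^-1))).
    rewrite mem_index_iota => i_k.
    by apply: (has_grad_eq (has_gradM (Gqa i i_k) (Gqa i i_k))) => l; ring.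
  have Gl i : i \in index_iota k.+1 (k + d).+1 -> has_grad (fun w => lam i * ln (Y (E i) w)) w
      (fun l => \sum_j P l j * (lam i * mu i j)).
    rewrite mem_index_iota => i_k; have Yi := posY w i wr i_k.
    apply: (has_grad_eq (has_gradZ (lam i) (has_grad_ln Yi (HP (E i))))) => l.
    rewrite !mulr_sumr; apply: eq_bigr => j _.
    have [_ _ ->] := EY i i_k; rewrite bfZr -/(Y (E i) w); field; exact: lt0r_neq0.
  have Glna := has_gradZ rho0 (has_grad_ln (posa w wr) Ga).
  apply: (has_grad_eq (has_gradD (has_gradD (has_gradD Gba (has_gradZ 2^-1 (has_grad_sum Gqq)))
    Glna) (has_grad_sum Gl))) => l /=.
  rewrite -mulr_sumr exchange_big.
  have -> : \sum_j \sum_(i <- index_iota k.+1 (k + d).+1) P l j * (lam i * mu i j) =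
      - (rho0 * mL l + rL l).
    rewrite /mL /rL mulr_sumr -big_split -sumrN; apply: eq_bigr => j _ /=.
    rewrite -mulr_sumr; have := rel j; set s := \sum_(i <- _) lam i * mu i j => rj.
    have -> : s = - (rho0 * m j + rho j) by apply/eqP; rewrite -addr_eq0 addrC; apply/eqP.
    by ring.
  rewrite -/(a w); move: (\sum_(i <- _) _) => T; field.
  exact: aw0.
move=> u ur; split=> //.
have crd i : (1 <= i <= n.+1)%N ->
    coord1 (g u *m coordmx S (fun i => c i *: E i)) i = c i.-1 * Y (E i.-1) u.
  by move=> i_n; rewrite coordY// /Y bfZr.
have crd1 : coord1 (g u *m coordmx S (fun i => c i *: E i)) 1%N = a u.
  by rewrite crd// /c /= mul1r.
have crdY i : (k.+2 <= i <= n)%N ->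
    coord1 (g u *m coordmx S (fun i => c i *: E i)) i = Y (E i.-1) u.
  move=> /andP[ki i_n]; rewrite crd; last by rewrite (leq_trans _ ki)//= ltnW.
  case: i ki i_n => // i ki i_n; have {}ki : (k < i)%N by [].
  rewrite /c /= (gtn_eqF (leq_ltn_trans (leq0n k) ki)).
  by rewrite leqNgt ki /= -ltnS -nkd i_n mul1r.
apply/set_iiiP; split; first by rewrite crd1; exact: posa.
  move=> i i_k; rewrite crdY//; apply: posY => //.
  by move: i_k; rewrite nkd; case: i.
transitivity (- rho0^-1 * phi u); last by rewrite phi0 ?mulr0.
have crdn : coord1 (g u *m coordmx S (fun i => c i *: E i)) n.+1 = - rho0^-1 * b u.
  rewrite crd ?leqnn// /c /b /= nkd /=.
  by rewrite leqNgt (leq_ltn_trans (leq_addr d k))//= ltnn.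
rewrite crd1 crdn.
have -> : \sum_(2 <= i < k.+2)
     (coord1 (g u *m coordmx S (fun i0 => c i0 *: E i0)) i / a u) ^+ 2 =
   rho0^-1 * \sum_(i <- index_iota 1 k.+1) (Y (E i) u * (a u)^-1) * (Y (E i) u * (a u)^-1).
  rewrite big_add1 /= mulr_sumr; apply: eq_big_nat => i /andP[i0 ik].
  rewrite crd; last by rewrite /= ltnS nkd; apply: (leq_trans (ltnW ik)); rewrite ltnS leq_addr.
  rewrite /c /= gtn_eqF// -ltnS ik exprMn exprMn -expr2 exprMn exprVn sqr_sqrtr ?ltW//.
  by ring.
have -> : \sum_(k.+2 <= i < n.+1) - lam i.-1 / rho0 *
     ln (coord1 (g u *m coordmx S (fun i0 => c i0 *: E i0)) i) =
   - rho0^-1 * \sum_(i <- index_iota k.+1 (k + d).+1) lam i * ln (Y (E i) u).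
  rewrite big_add1 /= -[in index_iota k.+1 (k + d).+1]nkd mulr_sumr; apply: eq_big_nat => i /andP[ki ik].
  rewrite crdY /=; last by rewrite ltnS ki.
  by ring.
rewrite /phi; move: (\sum_(i <- _) _) (\sum_(i <- _) _) => T1 T2.
by field; rewrite (lt0r_neq0 rho0_gt0) lt0r_neq0// posa.
Qed.

End LocalModel.

Section LocalTheorem.
Context {R : realType} {n : nat} (n0 : (0 < n)%N).
Implicit Types (H Dom : set 'rV[R]_n.+1).

Definition model H Dom := [/\ model_i H \/ model_ii H \/ model_iii H,
  radially_unique H & locally_homogeneous H Dom].

Lemma model_diag_definite (lam : nat -> R) : (forall i, (i < n.+1)%N -> 0 < lam i) ->
  model (set_i (fun i => 1 * lam i.-1) : set 'rV[R]_n.+1) setT.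
Proof.
move=> lam0; have pos i : (1 <= i <= n.+1)%N -> 0 < 1 * lam i.-1.
  by case: i => // i /andP[_ i_n]; rewrite mul1r; exact: lam0.
split; last exact: set_i_homogeneous.
  by left; exists (fun i => 1 * lam i.-1); split=> //; left.
apply: set_i_radial; rewrite gt_eqF// big_ltn// ltr_wpDr ?pos//.
by rewrite big_nat; apply: sumr_ge0 => i /andP[i2 i_n]; rewrite ltW// pos// (ltnW i2).
Qed.

(** The overall sign of the exponents is free; -1 makes the exceptional one, that
    of the positive direction, negative as the model requires. *)
Lemma model_diag_lorentz (lam : nat -> R) : 0 < lam 0%N -> (forall i, (0 < i < n.+1)%N -> lam i < 0) ->
  \sum_(i < n.+1) lam i = 1 -> model (set_i (fun i => -1 * lam i.-1) : set 'rV[R]_n.+1) setT.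
Proof.
move=> lam0 lamn sum1.
have sumN : \sum_(1 <= i < n.+2) -1 * lam i.-1 = -1.
  by rewrite -mulr_sumr big_add1 big_mkord sum1 mulr1.
split; last exact: set_i_homogeneous.
  left; exists (fun i => -1 * lam i.-1); split=> //; right; split.
  - by rewrite /= mulN1r oppr_lt0.
  - by case=> // i i_n; rewrite /= mulN1r oppr_gt0 lamn//; case/andP: i_n => -> ->.
  - by rewrite sumN ltrN10.
by apply: set_i_radial; rewrite sumN oppr_eq0 oner_eq0.
Qed.

Lemma model_complex d (lam : nat -> R) p q : n = d.+1 -> (forall i, (i < d)%N -> lam i < 0) ->
  \sum_(i < d) lam i + p = 1 ->
  model (set_ii (fun i => if i == n.+1 then q else if i == n then p / 2 else lam i.-1)
    : set 'rV[R]_n.+1) [set y | 0 < coord1 y n.+1].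
Proof.
set al := (fun i : nat => _) => nd lam0 sum1.
have aln : al n = p / 2 by rewrite /al (ltn_eqF (ltnSn n)) eqxx.
have ali i : (i < n)%N -> al i = lam i.-1.
  by move=> i_n; rewrite /al (ltn_eqF (leq_trans i_n (leqnSn _))) (ltn_eqF i_n).
have sumal : 2 * al n + \sum_(1 <= i < n) al i = 1.
  rewrite aln -[RHS]sum1 [RHS]addrC; congr (_ + _); first by field.
  have nd1 : n.-1 = d by rewrite nd.
  rewrite big_add1 nd1 big_mkord; apply: eq_bigr => i _.
  by rewrite ali// nd ltnS.
split; last exact: set_ii_homogeneous.
  right; left; exists al; split=> //; last by rewrite sumal.
  by move=> i /andP[i0 i_n]; rewrite ali ?lam0 //; move: i_n; rewrite nd; case: i i0.
by apply: set_ii_radial => //; rewrite sumal oner_eq0.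
Qed.

Lemma model_null k d (lam : nat -> R) : n = (k + d).+1 ->
  (forall i, (k < i <= k + d)%N -> lam i < 0) ->
  let rho0 := 1 - \sum_(k.+1 <= i < (k + d).+1) lam i in
  model (set_iii k.+2 (fun i => - lam i.-1 / rho0) : set 'rV[R]_n.+1) setT.
Proof.
move=> nkd lam0 rho0.
have rho1 : 1 <= rho0.
  rewrite lerBrDr gerDl big_nat; apply: sumr_le0 => i i_k; exact/ltW/lam0.
have rho0_gt0 : 0 < rho0 by exact: lt_le_trans rho1.
have v2 : (2 <= k.+2 <= n.+1)%N by rewrite nkd /= ltnS ltnS leq_addr.
have sumal : \sum_(k.+2 <= i < n.+1) - lam i.-1 / rho0 = 1 - rho0^-1.
  rewrite -mulr_suml sumrN big_add1 /=.
  have -> : \sum_(k.+1 <= i < n) lam i = 1 - rho0 by rewrite /rho0 nkd; ring.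
  by field; rewrite lt0r_neq0.
have lt1 : \sum_(k.+2 <= i < n.+1) - lam i.-1 / rho0 < 1.
  by rewrite sumal ltrBlDr ltrDl invr_gt0.
split; last exact: set_iii_homogeneous.
  right; right; exists k.+2, (fun i => - lam i.-1 / rho0); split=> // i i_k.
  by rewrite divr_gt0// oppr_gt0 lam0//; move: i_k; rewrite nkd; case: i.
by apply: set_iii_radial; rewrite lt_eqF.
Qed.

Context (eps : R) (f : 'rV[R]_n -> 'rV[R]_n.+1) (U : set 'rV[R]_n).
Context (oU : open U) (sf : smooth_on U f)
  (regf : forall u, U u -> immersed_at f u /\ transversal_at f u)
  (eps1 : eps = 1 \/ eps = - 1) (pdh : forall u, U u -> posdef (ca_metric eps f u))
  (flat : forall u, U u -> forall i j k l,
    curvature (levi_civita (ca_metric eps f)) i j k l u = 0)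
  (par : forall u, U u -> forall l i j k,
    cov_deriv3 (levi_civita (ca_metric eps f)) (cubic_form eps f) l i j k u = 0).

Lemma local_model u0 : U u0 -> exists H Dom, model H Dom /\
  exists2 B, B \in unitmx & \forall u \near u0, H (f u *m B) /\ Dom (f u *m B).
Proof.
move=> Uu0; have /nbhs_ballP[r /= r0 rU] : nbhs u0 U by exact: open_nbhs_nbhs.
have cg := coord_grad oU sf regf eps1 pdh flat par r0 rU.
have Huu := base_unit eps regf r0 rU.
have Hfa := base_orth eps regf r0 rU.
have Hnd := @base_nondegenerate _ _ _ _ _ regf eps1 pdh _ _ r0 rU.
have Hsym := gram_sym eps oU sf r0 rU.
have Hsa := A_selfadjoint oU sf regf eps1 pdh r0 rU.
have Hcm := A_commute oU sf regf eps1 pdh flat par r0 rU.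
have land H Dom : lands_in (fun u => f u *m invmx (frame f u0)) u0 r H Dom -> 
    exists2 B, B \in unitmx & \forall u \near u0, H (f u *m B) /\ Dom (f u *m B).
  move=> [C [Cu [r' /andP[r'0 _] HC]]]; exists (invmx (frame f u0) *m C).
    by rewrite unitmx_mul unitmx_inv Cu andbT; exact: (frame_unit regf Uu0).
  by near=> u; rewrite mulmxA; apply: HC; near: u; exact: nbhsx_ballx.
case: (eps1) => e1; last first.
  have Hpos x := @gram_definite _ _ _ _ _ pdh _ _ r0 rU x e1.
  have [E [mu [lam [HE lam0]]]] := normal_form_definite Hsym Hcm Hsa Hfa Hnd Huu Hpos.
  exists (set_i (fun i => 1 * lam i.-1)), setT; split; first exact: model_diag_definite.
  by apply: land; exact: (lands_diag r0 cg 1 HE).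
have Hneg x := @gram_lorentz _ _ _ _ _ regf pdh _ _ r0 rU x e1.
have [|[]] := normal_form_lorentz Hsym Hcm Hsa Hfa Hnd Huu Hneg.
- move=> [E [mu [lam [HE lam0 lamn]]]].
  exists (set_i (fun i => -1 * lam i.-1)), setT; split.
    by apply: model_diag_lorentz => //; case: HE.
  by apply: land; exact: (lands_diag r0 cg (-1) HE).
- move=> [d [E [mu [lam [al [be [p [q HE]]]]]]]].
  have [[dn] _ EA _ [_ sum1]] := HE.
  exists (set_ii (fun i => if i == n.+1 then q else if i == n then p / 2 else lam i.-1)),
    [set y | 0 < coord1 y n.+1]; split.
    by apply: (@model_complex d) => // i /EA[].
  by apply: land; exact: (lands_complex n0 r0 cg HE).
move=> [k [d [E [mu [lam [m [ka [rho HE]]]]]]]].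
have [[[kdn] _] _ _ EY _] := HE.
exists (set_iii k.+2 (fun i => - lam i.-1 / (1 - \sum_(k.+1 <= i < (k + d).+1) lam i))), setT.
split; first by apply: model_null => // i /EY[].
by apply: land; exact: (lands_null r0 cg HE).
Unshelve. all: by end_near. Qed.

End LocalTheorem.

(** * From local inclusions to the theorem *)

Section Cone.
Context {R : realType} {n : nat}.
Implicit Types (z : 'rV[R]_n.+1).

(** Coordinate 0 of z is the radial parameter, [base z] the remaining n. *)
Let base z : 'rV[R]_n := \row_j z 0 (lift ord0 j).

Let diff_coord k z : differentiable (fun z : 'rV[R]_n.+1 => z 0 k) z.
Proof. exact: differentiable_coord. Qed.

Let diff_base z : differentiable base z.
Proof.
apply: differentiable_rowP => k.
rewrite (_ : (fun w => _) = (fun w : 'rV[R]_n.+1 => w 0 (lift ord0 k))); first exact: diff_coord.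
by apply/funext => w; rewrite mxE.
Qed.

Let base_radial h z : base (h *: delta_mx 0 ord0 + z) = base z.
Proof.
by apply/rowP => j; rewrite !mxE eq_sym (negbTE (neq_lift _ _)) andbF mulr0 add0r.
Qed.

Let base_tangent h z j : base (h *: delta_mx 0 (lift ord0 j) + z) = h *: delta_mx 0 j + base z.
Proof. by apply/rowP => k; rewrite !mxE (inj_eq lift_inj). Qed.

Let pd_base_radial (F : 'rV[R]_n -> R) z : pd ord0 (F \o base) z = 0.
Proof.
rewrite pdE /partial /derive.
rewrite (_ : (fun h => _) = (fun _ : R => 0 : R)); last first.
  by apply/funext => h; rewrite /= base_radial subrr scaler0.
by apply: cvg_lim => //; exact: (@cvg_cst _ (0 : R) _ (dnbhs (0 : R))).
Qed.

Let pd_base_tangent (F : 'rV[R]_n -> R) z j : pd (lift ord0 j) (F \o base) z = pd j F (base z).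
Proof.
rewrite !pdE /partial /derive; do 2 f_equal; apply/funext => h.
by rewrite /= base_tangent.
Qed.

Lemma row_recl m (A : 'M[R]_(n.+1, m)) (v : 'rV[R]_n.+1) :
  v *m A = v 0 ord0 *: row ord0 A + \sum_j v 0 (lift ord0 j) *: row (lift ord0 j) A.
Proof. by rewrite mulmx_sum_row big_ord_recl. Qed.

Lemma mulmx_continuous m (B : 'M[R]_(n.+1, m)) : continuous (fun z => z *m B).
Proof.
move=> z; apply: differentiable_continuous; apply: differentiable_rowP => k.
rewrite (_ : (fun w => _) = (fun w : 'rV[R]_n.+1 => \sum_j w 0 j * B j k)); last first.
  by apply/funext => w; rewrite mxE.
by apply: diff_sum => j _; apply: diff_mul; [exact: diff_coord|exact: diff_const].
Qed.

Definition cone (T : Type) (x : T -> 'rV[R]_n.+1) (W : set T) : set 'rV[R]_n.+1 :=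
  [set y | exists r, 0 < r /\ exists2 w, W w & y = r *: x w].

Context (f : 'rV[R]_n -> 'rV[R]_n.+1) (U : set 'rV[R]_n) (oU : open U).
Context (df : forall u, U u -> differentiable f u)
  (regf : forall u, U u -> immersed_at f u /\ transversal_at f u).

(** The map (r, u) |-> r f(u) has the frame as its Jacobian, with tangent rows
    scaled by r, so it is open. *)
Lemma cone_chart_open (W : set 'rV[R]_n) : open W -> W `<=` U -> open (cone f W).
Proof.
move=> oW WU.
pose g z := z 0 ord0 *: f (base z).
pose V := [set z : 'rV[R]_n.+1 | 0 < z 0 ord0 /\ W (base z)].
have -> : cone f W = g @` V.
  apply/seteqP; split=> [y [r [r0 [w Ww ->]]]|y [z [z0 Wz] <-]]; last first.
    by exists (z 0 ord0); split=> //; exists (base z).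
  pose z : 'rV[R]_n.+1 := \row_k (if unlift ord0 k is Some j then w 0 j else r).
  have z0 : z 0 ord0 = r by rewrite mxE unlift_none.
  have zw : base z = w by apply/rowP => j; rewrite !mxE liftK.
  by exists z; rewrite /V /g /= z0 zw.
have oV : open V.
  rewrite openE => z [z0 Wz].
  have c1 := differentiable_continuous (diff_coord ord0 z).
  have c2 := differentiable_continuous (diff_base z).
  have N1 : \forall w \near z, 0 < (w : 'rV[R]_n.+1) 0 ord0 by exact: (c1 _ (lt_nbhsr z0)).
  have N2 : \forall w \near z, W (base w) by apply: (c2 W); exact: open_nbhs_nbhs.
  by apply: filterS2 N1 N2 => w.
apply: open_image => // z [z0 Wz]; have Uz := WU _ Wz.
have dfk k : differentiable ((fun u => f u 0 k) \o base) z.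
  apply: differentiable_comp; first exact: diff_base.
  exact: differentiable_entry (df Uz).
have gk k : (fun z => g z 0 k) = (fun z : 'rV[R]_n.+1 => z 0 ord0 * ((fun u => f u 0 k) \o base) z).
  by apply/funext => w; rewrite mxE.
have dg : differentiable g z.
  by apply: differentiable_rowP => k; rewrite gk; apply: diff_mul => //; exact: diff_coord.
have cgrad i k : 'J g z i k = (i == ord0)%:R * f (base z) 0 k
    + z 0 ord0 * pd i ((fun u => f u 0 k) \o base) z.
  rewrite jacobian_entry// gk (pd_mul _ (diff_coord ord0 z) (dfk k)); congr (_ * _ + _).
  have [_ /(_ i)] := has_grad_coord0 0 z; rewrite /coord0.
  rewrite (_ : inord 0 = ord0 :> 'I_n.+1); last by apply/val_inj; rewrite /= inordK.
  by move=> ->; rewrite mxE eq_sym.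
have J0 : row ord0 ('J g z) = f (base z).
  by apply/rowP => k; rewrite mxE cgrad eqxx mul1r pd_base_radial mulr0 addr0.
have Jj j : row (lift ord0 j) ('J g z) = z 0 ord0 *: row j ('J f (base z)).
  apply/rowP => k; rewrite [LHS]mxE cgrad [RHS]mxE [in RHS]mxE (negbTE (_ : lift ord0 j != ord0)) ?mul0r ?add0r; last first.
    by rewrite eq_sym neq_lift.
  by rewrite pd_base_tangent jacobian_entry//; exact: df.
split=> //; rewrite -row_free_unit; apply: inj_row_free => v; rewrite row_recl J0 => H.
have [im tr] := regf Uz; have := ca_frame_unit im tr; rewrite -row_free_unit => fr.
pose v' : 'rV[R]_n := \row_j (v 0 (lift ord0 j) * z 0 ord0).
have : row_mx (v 0 ord0)%:M v' *m ca_frame f (base z) = 0 *m ca_frame f (base z).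
  rewrite mul0mx /ca_frame (mul_row_col _ _ (f (base z)) ('J f (base z))) mul_scalar_mx -[RHS]H.
  congr (_ + _); rewrite mulmx_sum_row; apply: eq_bigr => j _.
  by rewrite Jj scalerA mxE.
move/(row_free_inj fr) => v00.
have /eq_row_mx[v0 vj] : row_mx (v 0 ord0)%:M v' = row_mx (0 : 'M[R]_1) (0 : 'rV[R]_n).
  by rewrite row_mx0.
apply/rowP => k; rewrite mxE; case: (unliftP ord0 k) => [j|] ->.
  have := congr1 (fun A : 'rV[R]_n => A 0 j) vj; rewrite !mxE => /eqP.
  by rewrite mulf_eq0 (gt_eqF z0) orbF => /eqP.
by have := congr1 (fun A : 'M[R]_1 => A 0 0) v0; rewrite !mxE mulr1n.
Qed.

End Cone.

Section Globalisation.
Context {R : realType} {n : nat} {M : topologicalType} (x : M -> 'rV[R]_n.+1).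
Context (cx : continuous x) (cone_open : forall W : set M, open W -> open (cone x W)).
Implicit Types (H Dom : set 'rV[R]_n.+1) (q : M).

(** Weaker than [locally_equivalent_at], but visibly an open condition on q. *)
Definition maps_into H q := exists2 B, B \in unitmx & \forall w \near q, H (x w *m B).

(** The open set cutting out the image is the cone over a neighbourhood of q; a
    point of H in it is r times a point of the image, and r = 1. *)
Lemma locally_equivalent_of_maps H q : radially_unique H -> maps_into H q ->
  locally_equivalent_at x q H.
Proof.
move=> Hr [B Bu /nbhs_interior HB]; set V := interior _ in HB.
have VH w : V w -> H (x w *m B) by apply: interior_subset.
exists V, [set y | cone x V (y *m invmx B)], B; split=> //.
- exact: open_interior.
- exact: nbhs_singleton.
- apply: open_comp; last by apply: cone_open; exact: open_interior.
  by move=> y _; exact: mulmx_continuous.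
apply/seteqP; split=> [_ [w Vw <-]|y [Hy [r [r0 [w Vw yE]]]]].
  split; first exact: VH.
  by exists 1; split=> //; exists w => //; rewrite mulmxK// scale1r.
have {}yE : y = r *: (x w *m B) by rewrite scalemxAl -yE mulmxKV.
have r1 : r = 1 by apply: (Hr _ _ r0 (VH _ Vw)); rewrite -yE.
by exists w; rewrite // yE r1 scale1r.
Qed.

(** Let H0 be a model near q0.  A local symmetry G of H0 takes the position of q'
    to that of q; a point x w near x q' is then taken into the open cone over a
    neighbourhood of q, and radial uniqueness of H0 places it on the
    hypersurface itself, so that it can be followed by the linear map given
    at q. *)
Lemma maps_into_nbhs H q0 H0 Dom0 B0 : radially_unique H0 -> locally_homogeneous H0 Dom0 ->
  B0 \in unitmx -> (\forall w \near q0, H0 (x w *m B0) /\ Dom0 (x w *m B0)) ->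
  exists2 N, open N /\ N q0 & forall q q', N q -> N q' -> maps_into H q -> maps_into H q'.
Proof.
move=> Hr Hh B0u /nbhs_interior HN; set N := interior _ in HN.
have NH w : N w -> H0 (x w *m B0) /\ Dom0 (x w *m B0) by apply: interior_subset.
exists N; first by split; [exact: open_interior|exact: nbhs_singleton].
move=> q q' Nq Nq' [B Bu HB].
have [Hq Dq] := NH _ Nq; have [Hq' Dq'] := NH _ Nq'.
have [G [Gu GE HG]] := Hh _ _ Dq' Dq Hq' Hq.
exists (B0 *m G *m invmx B0 *m B); first by rewrite !unitmx_mul B0u Gu unitmx_inv B0u.
pose W := interior [set w | H (x w *m B)] `&` N.
have oW : open W by apply: openI; exact: open_interior.
have Wq : W q by split=> //; exact: (nbhs_singleton (nbhs_interior HB)).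
have cB0 : {for q', continuous (fun w => x w *m B0)}.
  exact: (@continuous_comp _ _ _ x (fun y => y *m B0) q' (@cx q') (@mulmx_continuous _ _ _ _ (x q'))).
have cG : {for q', continuous (fun w => x w *m (B0 *m G *m invmx B0))}.
  exact: (@continuous_comp _ _ _ x (fun y => y *m (B0 *m G *m invmx B0)) q' (@cx q') (@mulmx_continuous _ _ _ _ (x q'))).
have N1 : \forall w \near q', H0 (x w *m B0) -> H0 (x w *m B0 *m G) by exact: (cB0 _ HG).
have N2 : \forall w \near q', cone x W (x w *m (B0 *m G *m invmx B0)).
  apply: (cG (cone x W)); apply: open_nbhs_nbhs; split; first exact: cone_open.
  by exists 1; split=> //; exists q => //; rewrite scale1r !mulmxA GE mulmxK.
near=> w.
have Nw : N w by near: w; apply: open_nbhs_nbhs; split=> //; exact: open_interior.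
have HGw : H0 (x w *m B0 *m G).
  have Himp : H0 (x w *m B0) -> H0 (x w *m B0 *m G) by near: w.
  by apply: Himp; have [] := NH _ Nw.
have [r [r0 [w' [Ww' Nw'] wE]]] : cone x W (x w *m (B0 *m G *m invmx B0)).
  by near: w.
have r1 : r = 1.
  have [H0w' _] := NH _ Nw'; apply: (Hr _ _ r0 H0w').
  by rewrite scalemxAl -wE !mulmxA mulmxKV.
by rewrite mulmxA wE r1 scale1r; exact: (interior_subset Ww').
Unshelve. all: by end_near. Qed.

Lemma maps_into_component H p :
  (forall q, exists H0 Dom0, [/\ radially_unique H0, locally_homogeneous H0 Dom0 &
    exists2 B0, B0 \in unitmx & \forall w \near q, H0 (x w *m B0) /\ Dom0 (x w *m B0)]) ->
  maps_into H p -> forall q, connected_component setT p q -> maps_into H q.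
Proof.
move=> loc Hp q Cq.
have nb q0 : exists2 N, open N /\ N q0 &
    forall q q', N q -> N q' -> maps_into H q -> maps_into H q'.
  have [H0 [Dom0 [Hr Hh [B0 B0u HB]]]] := loc q0.
  exact: maps_into_nbhs Hr Hh B0u HB.
have oS : open (maps_into H).
  rewrite openE => q0 Sq0; have [N [oN Nq0] HN] := nb q0.
  apply: (@filterS _ _ _ N) => [q' Nq'|]; last by apply: open_nbhs_nbhs.
  exact: HN Sq0.
have cS : closed (maps_into H).
  rewrite -[maps_into H]setCK; apply: open_closedC.
  rewrite openE => q0 Sq0; have [N [oN Nq0] HN] := nb q0.
  apply: (@filterS _ _ _ N) => [q' Nq' Sq'|]; last by apply: open_nbhs_nbhs.
  by apply: Sq0; exact: HN Sq'.
have CE : connected_component setT p `&` maps_into H = connected_component setT p.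
  refine (@component_connected _ setT p _ _ _ _).
  - by exists p; split=> //; exact: connected_component_refl.
  - by exists (maps_into H).
  - by exists (maps_into H).
by move: Cq; rewrite -CE => -[].
Qed.

End Globalisation.

Section ChartedHypersurface.
Context {R : realType} {n : nat} {M : topologicalType} (A : set (chart R n M))
  (x : M -> 'rV[R]_n.+1).
Context (atlas : smooth_atlas A) (hyp : centroaffine_hypersurface A x).

Lemma in_chart q : exists c, [/\ A c, is_chart c, chart_dom c q &
  forall w, chart_dom c w -> x w = local_param x c (chart_map c w)].
Proof.
have [Ac /(_ q)[c cA cq] _] := atlas; exists c; split=> //; first exact: Ac.
by move=> w cw; have [_ _ _ _ E] := Ac _ cA; rewrite /local_param /= E.
Qed.

Lemma chart_near c q (P : set 'rV[R]_n.+1) : is_chart c -> chart_dom c q ->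
  (forall w, chart_dom c w -> x w = local_param x c (chart_map c w)) ->
  (\forall u \near chart_map c q, P (local_param x c u)) -> \forall w \near q, P (x w).
Proof.
move=> [oc _ cc _ _] cq xE /(cc _ cq) HP.
have Nc : nbhs q (chart_dom c) by exact: open_nbhs_nbhs.
by apply: filterS2 Nc HP => w cw; rewrite xE.
Qed.

Lemma hypersurface_continuous : continuous x.
Proof.
move=> q P; have [c [cA ic cq xE]] := in_chart q; rewrite /= => HP.
apply: (chart_near ic cq xE); have [sf _] := hyp cA.
have df := sf [::] _ (ex_intro2 _ _ q cq erefl).
have c0 := differentiable_continuous df.
by apply: (c0 P); rewrite /= -xE.
Qed.

Lemma hypersurface_cone_open (W : set M) : open W -> open (cone x W).
Proof.
move=> oW; rewrite openE => _ [r [r0 [q Wq ->]]].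
have [c [cA ic cq xE]] := in_chart q; have [oc oU cc ci Ec] := ic.
have [sf regf] := hyp cA.
pose V := [set u | chart_img c u /\ W (chart_inv c u)].
have oV : open V.
  rewrite openE => u [Uu Wu].
  have NU : nbhs u (chart_img c) by exact: open_nbhs_nbhs.
  have NW : \forall w \near u, W (chart_inv c w) by apply: (ci _ Uu W); exact: open_nbhs_nbhs.
  by apply: filterS2 NU NW => w.
have VU : V `<=` chart_img c by move=> u [].
have oCV : open (cone (local_param x c) V).
  apply: (cone_chart_open (U := chart_img c)) => // u; exact: (sf [::]).
apply: (@filterS _ _ _ (cone (local_param x c) V)).
  by move=> _ [s [s0 [u [Uu Wu] ->]]]; exists s; split=> //; exists (chart_inv c u).
apply: open_nbhs_nbhs; split=> //; exists r; split=> //; exists (chart_map c q); last by rewrite xE.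
by split; [exists q|rewrite Ec].
Qed.

End ChartedHypersurface.

Theorem corollary1p1 (R : realType) (n : nat) (hn : (0 < n)%N)
    (M : topologicalType) (A : set (chart R n M)) (x : M -> 'rV[R]_n.+1)
    (eps : R) :
  smooth_manifold A ->
  centroaffine_hypersurface A x ->
  eps = 1 \/ eps = -1 ->
  locally_strongly_convex A x eps ->
  canonical_hypersurface A x eps ->
  forall p : M, exists H : set 'rV[R]_n.+1,
    (model_i H \/ model_ii H \/ model_iii H) /\
    forall q : M, connected_component setT p q -> locally_equivalent_at x q H.
Proof.
move=> [_ _ atlas] hyp eps1 pdh [flat par] p.
have loc (q : M) : exists H Dom, model H Dom /\
    exists2 B, B \in unitmx & \forall w \near q, H (x w *m B) /\ Dom (x w *m B).
  have [c [cA ic cq xE]] := in_chart x atlas q; have [_ oU _ _ _] := ic.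
  have [sf regf] := hyp _ cA.
  have Uq : chart_img c (chart_map c q) by exists q.
  have [H [Dom [HM [B Bu HB]]]] := local_model hn oU sf regf eps1
    (fun u => @pdh c u cA) (fun u => @flat c u cA) (fun u => @par c u cA) Uq.
  exists H, Dom; split=> //; exists B => //.
  exact: (chart_near (P := fun y => H (y *m B) /\ Dom (y *m B)) ic cq xE HB).
have [H [Dom [[HM Hr _] [B Bu HB]]]] := loc p.
exists H; split=> // q pq.
have cone_x := hypersurface_cone_open atlas hyp.
apply: (locally_equivalent_of_maps cone_x Hr).
apply: (maps_into_component (hypersurface_continuous atlas hyp) cone_x _ _ pq); last first.
  by exists B => //; apply: filterS HB => w [].
by move=> q'; have [H' [Dom' [[_ Hr' Hh'] HB']]] := loc q'; exists H', Dom'; split.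
Qed.
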